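(* Let $S$ be a set of places of $\mathbb{Q}$, $X$ the set of places of $\overline{\mathbb{Q}}$ dividing a place in $S$, $\mathcal L=LC_c(X)$, $\mathcal L_0=\{f\in\mathcal L:\int_X f\,d\lambda=0\}$, and $\mathcal L_0^*$ the algebraic dual of $\mathcal L_0$. Let $\Psi^*:\mathcal J^*\to\mathcal L_0^*$ be given by $\Psi^*(c)=\Phi_c|_{\mathcal L_0}$. Then $\Psi^*$ is a surjective linear transformation and $\ker\Psi^*=\Lambda$, where $\Lambda$ is the one-dimensional real span of the consistent map $\lambda(K,v)=[K_v:\mathbb{Q}_v]/[K:\mathbb{Q}]$.
   Context: Fix an algebraic closure $\overline{\mathbb{Q}}$; number fields lie inside it. For a number field $K$ and place $v$ of $K$, $K_v$ is the completion and $\mathbb{Q}_v$ the completion of $\mathbb{Q}$ at the place below $v$. $Y$ is the set of all places of $\overline{\mathbb{Q}}$ and $Y(K,v)=\{y\in Y:y\mid v\}$; $Y$ has the topology with basis $\{Y(K,v)\}$, and $\lambda$ is the regular Borel measure on $Y$ with $\lambda(Y(K,v))=[K_v:\mathbb{Q}_v]/[K:\mathbb{Q}]$ for every number field $K$ and place $v$ of $K$; $X\subseteq Y$ carries the subspace topology and the restriction of $\lambda$. $M_K(S)$ is the set of places of $K$ dividing a place of $S$, and $\mathcal J=\{(K,v): K \text{ a number field},\ v\in M_K(S)\}$. A map $c:\mathcal J\to\mathbb{R}$ is consistent if $c(K,v)=\sum_{w\mid v}c(L,w)$ for all $(K,v)\in\mathcal J$ and all finite extensions $L/K$; $\mathcal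 J^*$ is the real vector space of consistent maps (pointwise operations). The map $(K,v)\mapsto [K_v:\mathbb{Q}_v]/[K:\mathbb{Q}]$ on $\mathcal J$ is consistent and is also denoted $\lambda$. $LC_c(X)$ is the space of locally constant, compactly supported real functions on $X$. For each $f\in LC_c(X)$ there is a number field $K$ with $f$ constant on each $Y(K,v)$, $v\in M_K(S)$, with value $f(v)$ zero for all but finitely many $v$; for consistent $c$, $\Phi_c(f)=\sum_{v\in M_K(S)}c(K,v)f(v)$, independent of such $K$. *)

(* Defs.v *)
From HB Require Import structures.
From mathcomp Require Import all_boot all_order all_algebra all_field.
From mathcomp Require Import boolp classical_sets reals exp.
From Stdlib Require List.

Set Implicit Arguments.
Unset Strict Implicit.
Unset Printing Implicit Defensive.

Import Order.TTheory GRing.Theory Num.Theory.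
Local Open Scope ring_scope.
Local Open Scope classical_set_scope.

Section Places.
Variable R : realType.

Definition Qset : set algC := range (fun q : rat => ratr q).

Definition subfield (K : set algC) : Prop :=
  K 0 /\ K 1 /\ (forall x y, K x -> K y -> K (x - y)) /\
  (forall x y, K x -> K y -> K (x * y)) /\ (forall x, K x -> x != 0 -> K x^-1).

Definition Q_indep n (x : 'I_n -> algC) : Prop :=
  forall q : 'I_n -> rat, \sum_(i < n) ratr (q i) * x i = 0 -> forall i, q i = 0.

Definition Q_spans (K : set algC) n (x : 'I_n -> algC) : Prop :=
  forall y, K y <-> exists q : 'I_n -> rat, y = \sum_(i < n) ratr (q i) * x i.

Definition number_field (K : set algC) : Prop :=
  subfield K /\ exists n (x : 'I_n -> algC), Q_spans K x.

Definition degree (K : set algC) : nat :=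
  xget 0%N [set n | exists x : 'I_n -> algC, Q_indep x /\ Q_spans K x].

Definition absval (K : set algC) (phi : algC -> R) : Prop :=
  (forall x, K x -> 0 <= phi x) /\
  (forall x, K x -> (phi x = 0 <-> x = 0)) /\
  (forall x y, K x -> K y -> phi (x * y) = phi x * phi y) /\
  (forall x y, K x -> K y -> phi (x + y) <= phi x + phi y) /\
  (exists x, K x /\ x != 0 /\ phi x != 1).

Definition absval_equiv (K : set algC) (phi psi : algC -> R) : Prop :=
  exists t : R, 0 < t /\ forall x, K x -> psi x = phi x `^ t.

Definition place (K : set algC) (v : set (algC -> R)) : Prop :=
  exists phi, absval K phi /\ v = [set psi | absval K psi /\ absval_equiv K phi psi].

(* w (place of L) divides v (place of K), for K a subfield of L *)
Definition divides (K : set algC) (v w : set (algC -> R)) : Prop :=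
  exists psi, w psi /\ v psi.

Definition Ybasis (K : set algC) (v y : set (algC -> R)) : Prop :=
  place setT y /\ divides K v y.

(* K_v = Cauchy sequences of K modulo null sequences; Q_v sits inside as
   classes of rational Cauchy sequences.  [K_v:Q_v] is the dimension. *)
Definition cauchy (K : set algC) (phi : algC -> R) (u : nat -> algC) : Prop :=
  (forall k, K (u k)) /\
  forall e : R, 0 < e -> exists N, forall m n, (N <= m)%N -> (N <= n)%N ->
    phi (u m - u n) < e.

Definition null (phi : algC -> R) (u : nat -> algC) : Prop :=
  forall e : R, 0 < e -> exists N, forall n, (N <= n)%N -> phi (u n) < e.

Definition local_indep (K : set algC) (phi : algC -> R) n
    (x : 'I_n -> nat -> algC) : Prop :=
  (forall i, cauchy K phi (x i)) /\
  forall a : 'I_n -> nat -> rat,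
    (forall i, cauchy Qset phi (fun k => ratr (a i k))) ->
    null phi (fun k => \sum_(i < n) ratr (a i k) * x i k) ->
    forall i, null phi (fun k => ratr (a i k)).

Definition local_degree (K : set algC) (v : set (algC -> R)) : nat :=
  xget 0%N [set n | exists phi, v phi /\
     (exists x : 'I_n -> nat -> algC, local_indep K phi x) /\
     ~ (exists x : 'I_n.+1 -> nat -> algC, local_indep K phi x)].

Variable S : set (set (algC -> R)).

Definition MKS (K : set algC) (v : set (algC -> R)) : Prop :=
  exists s, S s /\ divides Qset s v.

Definition J : Type :=
  {p : set algC * set (algC -> R) | number_field p.1 /\ place p.1 p.2 /\ MKS p.1 p.2}.

Definition jK (j : J) : set algC := (proj1_sig j).1.
Definition jv (j : J) : set (algC -> R) := (proj1_sig j).2.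

Definition is_finsum (T : Type) (A : set T) (F : T -> R) (r : R) : Prop :=
  exists s : seq T, List.NoDup s /\
    (forall x, List.In x s <-> (A x /\ F x != 0)) /\ r = \sum_(x <- s) F x.

Definition consistent (c : J -> R) : Prop :=
  forall (j : J) (L : set algC), number_field L -> jK j `<=` L ->
    is_finsum [set w : J | jK w = L /\ divides (jK j) (jv j) (jv w)] c (c j).

Definition lam (j : J) : R :=
  (local_degree (jK j) (jv j))%:R / (degree (jK j))%:R.

Definition Xt : Type :=
  {y : set (algC -> R) | place setT y /\ exists s, S s /\ divides Qset s y}.

Definition openX (U : set Xt) : Prop :=
  forall x, U x -> exists K v, number_field K /\ place K v /\
    Ybasis K v (proj1_sig x) /\ forall x' : Xt, Ybasis K v (proj1_sig x') -> U x'.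

Definition closureX (A : set Xt) : set Xt :=
  [set x | forall U, openX U -> U x -> exists z, U z /\ A z].

Definition compactX (C : set Xt) : Prop :=
  forall F : set (set Xt), (forall U, F U -> openX U) ->
    (forall x, C x -> exists U, F U /\ U x) ->
    exists s : seq (set Xt), (forall U, List.In U s -> F U) /\
      forall x, C x -> exists U, List.In U s /\ U x.

Definition LCc (f : Xt -> R) : Prop :=
  (forall x, exists U, openX U /\ U x /\ forall z, U z -> f z = f x) /\
  compactX (closureX [set x | f x != 0]).

Definition adapted (K : set algC) (f : Xt -> R) (g : J -> R) : Prop :=
  number_field K /\
  (forall j : J, jK j = K -> forall x : Xt, Ybasis K (jv j) (proj1_sig x) -> f x = g j) /\
  exists s : seq J, forall j, jK j = K -> g j != 0 -> List.In j s.

Definition Phi (c : J -> R) (f : Xt -> R) : R :=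
  xget 0 [set r | exists K g, adapted K f g /\
                     is_finsum [set j : J | jK j = K] (fun j => c j * g j) r].

(* int_X f dlambda, for f in LC_c(X) (= Phi_lambda f) *)
Definition integral (f : Xt -> R) : R := Phi lam f.

Definition L0 (f : Xt -> R) : Prop := LCc f /\ integral f = 0.

Definition linL0 (l : (Xt -> R) -> R) : Prop :=
  forall f g (a b : R), L0 f -> L0 g ->
    l (fun x => a * f x + b * g x) = a * l f + b * l g.

End Places.

(* Main.v *)
(** The maps [Phi_c] and [c] determine each other through the indicator functions of the
    sets [Y(K,v)], so the theorem is linear algebra once three facts are known: every
    [Y(K,v)] is nonempty, it is compact, and [lambda] is consistent.  All three are proved
    uniformly for archimedean and non-archimedean places.

    Nonempty: an absolute value of [K] extends to [algC].  The spectral radius is a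
    power-multiplicative seminorm on [algC]; a minimal such seminorm [p] is multiplicative,
    because [inf_n p (x f^n) / p f ^ n] is again one.

    Consistent: let [psi] be an absolute value of [algC] and [v] its restriction to [K].
    With [T] the trace of [L / K] and dual bases [f], [b] of [L] over [K], the
    coordinates [T (x b_j)] of [x] are small at [v] as soon as [x] is small at all
    conjugates [psi o nu].  By weak approximation the [psi o nu] are then all the places
    above [v], and [x |-> (T (x b_j))_j] induces an isomorphism from the product of the
    completions [L_w], [w | v], to [K_v ^ [L : K]], whence
    [sum_w [L_w : Q_v] = [L : K] [K_v : Q_v]].

    Compact: Koenig's lemma along a chain of number fields exhausting [algC]. *)

Require Import Defs.
From HB Require Import structures.
From mathcomp Require Import all_boot all_order all_algebra all_fingroup all_field.
From mathcomp Require Import boolp classical_sets functions reals exp.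
From mathcomp Require Import ring lra.

Set Implicit Arguments.
Unset Strict Implicit.
Unset Printing Implicit Defensive.

Import Order.TTheory GRing.Theory Num.Theory.
Local Open Scope ring_scope.
Local Open Scope classical_set_scope.

(** * Number fields and traces *)

(** A place is a class of absolute values up to powers, whereas sums, limits and traces need actual
    values. To remove this obstacle an absolute value [psi] of [algC] is fixed and only its
    conjugates under embeddings are compared: they agree with [psi] on the base field, where it is
    nontrivial, so equivalence between them becomes equality. The only completion that is built is
    that of the rationals; [L_w] enters through coordinate maps from Cauchy sequences to row vectors
    over it, so that local degrees become ranks. The trace acts as a projection to the base field:
    it keeps the spectral radius of 1 from dropping below 1, provides dual bases, and carries
    smallness from [x] to its coordinates. For surjectivity fix [j0]: as [lam j0 > 0], a functional
    [l] on [L0] extends uniquely to a functional on [LC_c(X)] that vanishes on the indicator of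
    [j0], and its value on the indicator of [j] is that of [l] on
    [indic j - (lam j / lam j0) * indic j0]. The same functions detect the kernel. *)

Section Subfield.
Variables (K : set algC) (sfK : subfield K).

Lemma subfield0 : K 0. Proof. by case: sfK. Qed.
Lemma subfield1 : K 1. Proof. by case: sfK => _ []. Qed.
Lemma subfieldB x y : K x -> K y -> K (x - y).
Proof. by case: sfK => _ [_ [H _]]; exact: H. Qed.
Lemma subfieldM x y : K x -> K y -> K (x * y).
Proof. by case: sfK => _ [_ [_ [H _]]]; exact: H. Qed.
Lemma subfieldV x : K x -> K x^-1.
Proof.
move=> Kx; have [->|x0] := eqVneq x 0; first by rewrite invr0; exact: subfield0.
by case: sfK => _ [_ [_ [_ H]]]; exact: H.
Qed.
Lemma subfieldN x : K x -> K (- x).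
Proof. by move=> Kx; rewrite -[- x]add0r; apply: subfieldB => //; exact: subfield0. Qed.
Lemma subfieldD x y : K x -> K y -> K (x + y).
Proof. by move=> Kx Ky; rewrite -[y]opprK; apply: subfieldB => //; exact: subfieldN. Qed.
Lemma subfield_sum I (r : seq I) (P : pred I) (F : I -> algC) :
  (forall i, P i -> K (F i)) -> K (\sum_(i <- r | P i) F i).
Proof.
move=> KF; apply: (big_ind K) => //; [exact: subfield0 | exact: subfieldD].
Qed.
Lemma subfieldX x n : K x -> K (x ^+ n).
Proof.
move=> Kx; elim: n => [|n IH]; first by rewrite expr0; exact: subfield1.
by rewrite exprS; exact: subfieldM.
Qed.
Lemma subfield_nat n : K n%:R.
Proof.
elim: n => [|n IH]; first exact: subfield0.
by rewrite mulrSr; apply: subfieldD => //; exact: subfield1.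
Qed.
Lemma subfield_rat (q : rat) : K (ratr q).
Proof.
rewrite /ratr; apply: subfieldM; last first.
  by apply/subfieldV; case: (denq q) => n; rewrite ?NegzE ?mulrNz;
    [exact: subfield_nat | apply/subfieldN/subfield_nat].
by case: (numq q) => n; rewrite ?NegzE ?mulrNz;
    [exact: subfield_nat | apply/subfieldN/subfield_nat].
Qed.

End Subfield.

Lemma number_field_subfield K : number_field K -> subfield K.
Proof. by case. Qed.

Lemma Q_spans_mem (K : set algC) n (x : 'I_n -> algC) i : Q_spans K x -> K (x i).
Proof.
move=> spx; apply/spx; exists (fun j => (j == i)%:R).
rewrite (bigD1 i) //= eqxx rmorph1 mul1r big1 ?addr0 //.
by move=> j /negPf->; rewrite rmorph0 mul0r.
Qed.

Lemma number_field_span (K : set algC) : number_field K ->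
  exists n (x : 'I_n -> algC), (forall i, K (x i)) /\ Q_spans K x.
Proof.
move=> [sfK [n [x Kx]]]; exists n, x; split=> // i; exact: (Q_spans_mem _ Kx).
Qed.

Lemma number_field_Q : number_field Qset.
Proof.
split.
  split; first by exists 0 => //; rewrite rmorph0.
  split; first by exists 1 => //; rewrite rmorph1.
  split; first by move=> _ _ [p _ <-] [q _ <-]; exists (p - q) => //; rewrite rmorphB.
  split; first by move=> _ _ [p _ <-] [q _ <-]; exists (p * q) => //; rewrite rmorphM.
  by move=> _ [p _ <-] _; exists (p^-1) => //; rewrite fmorphV.
exists 1%N, (fun=> 1) => y; split=> [[q _ <-]|[q ->]].
  by exists (fun=> q); rewrite big_ord1 mulr1.
by exists (q ord0) => //; rewrite big_ord1 mulr1.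
Qed.

Lemma rmorph_rat (nu : {rmorphism algC -> algC}) (q : rat) : nu (ratr q) = ratr q.
Proof. exact: fmorph_rat. Qed.

Section NumFieldImage.
Variables (Qs : fieldExtType rat) (QsC : {rmorphism Qs -> algC}).

Lemma rmorphZ_rat (a : rat) (z : Qs) : QsC (a *: z) = ratr a * QsC z.
Proof. by rewrite rmorphZ_num. Qed.

Lemma number_field_image : number_field (range QsC).
Proof.
split.
  split; first by exists 0 => //; rewrite rmorph0.
  split; first by exists 1 => //; rewrite rmorph1.
  split; first by move=> _ _ [p _ <-] [q _ <-]; exists (p - q) => //; rewrite rmorphB.
  split; first by move=> _ _ [p _ <-] [q _ <-]; exists (p * q) => //; rewrite rmorphM.
  by move=> _ [p _ <-] _; exists (p^-1) => //; rewrite fmorphV.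
pose b := vbasis {:Qs}.
exists (\dim {:Qs}), (fun i => QsC b`_i) => y; split=> [[z _ <-]|[q ->]].
  exists (fun i => coord b i z); rewrite {1}(coord_vbasis (memvf z)) rmorph_sum /=.
  by apply: eq_bigr => i _; rewrite rmorphZ_rat.
exists (\sum_i q i *: b`_i) => //; rewrite rmorph_sum /=.
by apply: eq_bigr => i _; rewrite rmorphZ_rat.
Qed.

(** Turns a number field given as a set into a [{subfield Qs}], to which Galois theory applies. *)
Lemma subfield_of_number_field (K : set algC) : number_field K -> K `<=` range QsC ->
  exists E : {subfield Qs}, forall z, z \in E <-> K (QsC z).
Proof.
move=> nfK sK; have [n [x [Kx spx]]] := number_field_span nfK.
have sfK := number_field_subfield nfK.
have /choice[zz zzP] : forall i, exists z, QsC z = x i.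
  by move=> i; have [z _ <-] := sK _ (Kx i); exists z.
pose X := [tuple zz i | i < n].
have nX (i : 'I_n) : X`_i = zz i by rewrite -(tnth_mktuple zz i) (tnth_nth 0).
have memE z : z \in <<X>>%VS <-> K (QsC z).
  split=> [/coord_span->|/spx[q Dz]].
    rewrite rmorph_sum; apply: (subfield_sum sfK) => i _ /=; rewrite rmorphZ_rat.
    apply: (subfieldM sfK); first exact: subfield_rat.
    by rewrite nX zzP.
  have -> : z = \sum_i q i *: X`_i.
    apply: (fmorph_inj QsC); rewrite Dz rmorph_sum; apply: eq_bigr => i _ /=.
    by rewrite rmorphZ_rat nX zzP.
  by apply: memv_suml => i _; apply/memvZ/memv_span; rewrite mem_nth // size_tuple.
have aE : is_aspace <<X>>%VS.
  apply/andP; split.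
    by apply/has_algid1/memE; rewrite rmorph1; exact: subfield1.
  apply/prodvP=> u v /memE Ku /memE Kv; apply/memE; rewrite rmorphM.
  exact: subfieldM.
by exists (ASpace aE) => z; exact: memE.
Qed.

End NumFieldImage.

(** The product of the rational minimal polynomials of the elements of [s] has all of them among its
    roots, and the field generated by its roots is a splitting field. *)
Lemma galois_closure (s : seq algC) :
  exists (Qs : splittingFieldType rat) (QsC : {rmorphism Qs -> algC}),
    forall x, x \in s -> exists z, QsC z = x.
Proof.
pose pr : {poly rat} := \prod_(x <- s) sval (minCpolyP x).
have mpr : pr \is monic.
  by apply: monic_prod => x _; case: (minCpolyP x) => p [[]].
have [r Dr] := closed_field_poly_normal (map_poly ratr pr : {poly algC}).
have lc : lead_coef (map_poly ratr pr : {poly algC}) = 1.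
  by apply/eqP; rewrite -[_ == 1]/(_ \is monic) map_monic.
rewrite lc scale1r in Dr.
have rs x : x \in s -> x \in r.
  move=> sx; rewrite -root_prod_XsubC -Dr /pr rmorph_prod /= rootE horner_prod prodf_seq_eq0.
  apply/hasP; exists x => //=; case: (minCpolyP x) => p /= [[Dp _] _].
  by rewrite -Dp -rootE root_minCpoly.
have [Qr [QrC [rr Drr genQr]]] := num_field_exists r.
pose p := map_poly (in_alg Qr) pr.
have Qp : p \is a polyOver 1%VS.
  by apply/polyOverP=> i; rewrite coef_map memvZ ?memv_line.
have splitQr : SplittingField.axiom Qr.
  exists p => //; exists rr => //.
  congr (_ %= _): (eqpxx p); apply/(map_poly_inj QrC).
  rewrite /p -map_poly_comp (eq_map_poly (g := ratr)); last first.
    by move=> a /=; rewrite rmorphZ_rat rmorph1 mulr1.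
  rewrite Dr -Drr big_map rmorph_prod /=; apply: eq_bigr => zz _.
  by rewrite map_polyXsubC.
pose mix := FieldExt_isSplittingField.Build rat Qr splitQr.
pose Qs : splittingFieldType rat := HB.pack (FieldExt.sort Qr) mix.
exists Qs, QrC => x /rs; rewrite -Drr => /mapP[z _ ->]; by exists z.
Qed.

Lemma number_field_ext (K : set algC) (s : seq algC) : number_field K ->
  exists M, [/\ number_field M, K `<=` M & forall x, x \in s -> M x].
Proof.
move=> nfK; have [n [x [Kx spx]]] := number_field_span nfK.
have [Qs [QsC [s1 Ds _]]] := num_field_exists (s ++ codom x).
have nfM := number_field_image QsC.
have sM z : z \in s ++ codom x -> range QsC z.
  by rewrite -Ds => /mapP[z1 _ ->]; exists z1.
exists (range QsC); split=> // [y /spx[q ->]|y sy].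
  apply: (subfield_sum (number_field_subfield nfM)) => i _.
  apply: (subfieldM (number_field_subfield nfM)).
    exact: (subfield_rat (number_field_subfield nfM)).
  by apply: sM; rewrite mem_cat codom_f orbT.
by apply: sM; rewrite mem_cat sy.
Qed.

Lemma number_field_sub_ext (K L : set algC) : number_field K -> number_field L ->
  exists M, [/\ number_field M, K `<=` M & L `<=` M].
Proof.
move=> nfK nfL; have [n [x [Lx spx]]] := number_field_span nfL.
have [M [nfM KM sM]] := number_field_ext (codom x) nfK.
have sfM := number_field_subfield nfM.
exists M; split=> // y /spx[q ->]; apply: (subfield_sum sfM) => i _.
by apply: (subfieldM sfM); [exact: subfield_rat | apply: sM; exact: codom_f].
Qed.

Lemma In_mapP (A : eqType) (B : Type) (f : A -> B) (s : seq A) y :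
  List.In y (map f s) -> exists2 x, x \in s & y = f x.
Proof.
elim: s => [//|a s IH] /= [<-|/IH[x sx ->]]; first by exists a; rewrite ?mem_head.
by exists x => //; rewrite inE sx orbT.
Qed.

Definition tr (s : seq {rmorphism algC -> algC}) (x : algC) : algC :=
  \sum_(nu <- s) nu x.

(* A multiple of the trace of [L / K]: [s] lists extensions to [algC] of the Galois group
   over [K] of a normal closure of [L]. *)
Definition trace_system (K L : set algC) (s : seq {rmorphism algC -> algC}) :=
  [/\ (0 < size s)%N, forall nu, List.In nu s -> forall x, K x -> nu x = x &
      forall x, L x -> K (tr s x)].

Lemma trace_system_exists (K L : set algC) :
  number_field K -> number_field L -> K `<=` L -> exists s, trace_system K L s.
Proof.
move=> nfK nfL KL; have [n [x [Lx spx]]] := number_field_span nfL.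
have [Qs [QsC QsP]] := galois_closure (codom x).
have sL : L `<=` range QsC.
  have sfM := number_field_subfield (number_field_image QsC).
  move=> y /spx[q ->]; apply: (subfield_sum sfM) => i _.
  apply: (subfieldM sfM); first exact: subfield_rat.
  by have [z <-] := QsP _ (codom_f x i); exists z.
have [E EP] := subfield_of_number_field nfK (subset_trans KL sL).
(* Separability is characteristic 0; normality comes from the splitting polynomial over the prime
   field, and both pass up to [E]. *)
have galE : galois E {:Qs}.
  apply: (@galoisS _ _ 1%AS); first by rewrite sub1v subvf.
  have [p Qp sp] := splittingFieldP Qs.
  apply/and3P; split; first exact: sub1v.
    apply/separableP => y _; apply: pcharf0_separable => q.
    by rewrite pchar_lalg pchar_num.
  by apply/splitting_normalField; [exact: sub1v | exists p].
(* Automorphisms are extended to all of [algC] so that absolute values of [algC] can be composed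
   with them. *)
have /choice[nu nuP] : forall g : gal_of {:Qs}, exists nu : {rmorphism algC -> algC},
    forall z, QsC (g z) = nu (QsC z).
  move=> g.
  pose g' : {rmorphism Qs -> Qs} :=
    GRing.RMorphism.clone _ _ (fun_of_lfun (ahval (gal_repr g))) _.
  have [nu Dnu] := extend_algC_subfield_aut QsC g'.
  by exists nu.
exists [seq nu g | g <- enum 'Gal({:Qs} / E)%g]; split.
- by rewrite size_map -cardE cardG_gt0.
- move=> nu' nuI y Ky; have [g Gg ->] := In_mapP nuI; rewrite mem_enum in Gg.
  have [z _ Dz] := sL _ (KL _ Ky); rewrite -Dz -nuP (fixed_gal (subvf _) Gg) //.
  by apply/EP; rewrite Dz.
move=> y Ly; have [z _ Dz] := sL _ Ly.
suff -> : tr [seq nu g | g <- enum 'Gal({:Qs} / E)%g] y = QsC (galTrace E {:Qs} z).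
  by apply/EP; apply: (mem_galTrace galE); exact: memvf.
rewrite /tr big_map big_enum /= rmorph_sum -Dz.
by apply: eq_bigr => g _; rewrite nuP.
Qed.

(** A row vector in the kernel of the coordinate matrix is a rational relation between the [f i], so
    this matrix has rank [m]. *)
Lemma Q_indep_leq (L : set algC) n m (x : 'I_n -> algC) (f : 'I_m -> algC) :
  Q_spans L x -> (forall i, L (f i)) -> Q_indep f -> (m <= n)%N.
Proof.
move=> spx Lf indf.
have /choice[A AP] : forall i, exists q : 'I_n -> rat,
    f i = \sum_(j < n) ratr (q j) * x j by move=> i; apply/spx.
pose M := \matrix_(i < m, j < n) A i j.
suff : kermx M == 0 by rewrite kermx_eq0 => /eqP <-; exact: rank_leq_col.
apply/rowV0P => v /sub_kermxP vM0; apply/rowP => i; rewrite mxE.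
apply: (indf (fun i => v ord0 i)) => {i}.
under eq_bigr => i _ do rewrite AP mulr_sumr.
rewrite exchange_big /= big1 // => j _.
have := congr1 (fun w : 'rV_n => ratr (w ord0 j) : algC) vM0; rewrite !mxE rmorph0 => h.
apply: (etrans _ (mul0r (x j))); rewrite -[X in _ = X * _]h rmorph_sum mulr_suml.
apply: eq_bigr => i _ /=.
by rewrite mxE rmorphM mulrA.
Qed.

Lemma degreeP (K : set algC) n (x : 'I_n -> algC) :
  Q_indep x -> Q_spans K x -> degree K = n.
Proof.
move=> ix spx; have Kx i : K (x i) by exact: (Q_spans_mem _ spx).
apply: xget_unique; first by exists x.
move=> m [y [iy spy]]; have Ky i : K (y i) by exact: (Q_spans_mem _ spy).
apply/eqP; rewrite eqn_leq (Q_indep_leq spx Ky iy) (Q_indep_leq spy Kx ix) //.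
Qed.

Section Trace.
Variables (K L : set algC) (nfK : number_field K) (nfL : number_field L).
Variables (KL : K `<=` L) (s : seq {rmorphism algC -> algC}) (trs : trace_system K L s).
Let sfK := number_field_subfield nfK.
Let sfL := number_field_subfield nfL.

Lemma tr_in x : L x -> K (tr s x). Proof. by case: trs => _ _; exact. Qed.

Lemma trD x y : tr s (x + y) = tr s x + tr s y.
Proof. by rewrite /tr -big_split; apply: eq_bigr => nu _; rewrite rmorphD. Qed.

Lemma trN x : tr s (- x) = - tr s x.
Proof. by rewrite /tr -sumrN; apply: eq_bigr => nu _; rewrite rmorphN. Qed.

Lemma trB x y : tr s (x - y) = tr s x - tr s y.
Proof. by rewrite trD trN. Qed.

Lemma tr_sum I (r : seq I) (F : I -> algC) :
  tr s (\sum_(i <- r) F i) = \sum_(i <- r) tr s (F i).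
Proof.
by rewrite /tr exchange_big; apply: eq_bigr => nu _; rewrite rmorph_sum.
Qed.

Lemma trM a x : K a -> tr s (a * x) = a * tr s x.
Proof.
case: trs => _ fixK _ Ka; rewrite /tr.
elim: s fixK => [|nu s' IH] fixK; first by rewrite !big_nil mulr0.
rewrite !big_cons mulrDr IH; last by move=> nu' s'nu; apply: fixK; right.
by rewrite rmorphM (fixK nu) //; left.
Qed.

Lemma tr1 : tr s 1 = (size s)%:R.
Proof.
rewrite /tr (eq_bigr (fun=> 1)) => [|nu _]; last by rewrite rmorph1.
by rewrite big_const_seq count_predT iter_addr_0.
Qed.

Lemma size_trace_neq0 : (size s)%:R != 0 :> algC.
Proof. by case: trs => s0 _ _; rewrite pnatr_eq0 -lt0n. Qed.

Lemma tr0 : tr s 0 = 0.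
Proof. by rewrite /tr big1 // => nu _; rewrite rmorph0. Qed.

Lemma tr_coord m (f b a : 'I_m -> algC) j :
  (forall i j, tr s (f i * b j) = (i == j)%:R) -> (forall i, K (a i)) ->
  tr s ((\sum_i a i * f i) * b j) = a j.
Proof.
move=> fb Ka; rewrite mulr_suml tr_sum (bigD1 j) //= -mulrA trM // fb eqxx mulr1.
by rewrite big1 ?addr0 // => i ij; rewrite -mulrA trM // fb (negPf ij) mulr0.
Qed.

(** Indexing by [nat] lets a pair of families be enlarged by overwriting the entry [m], with no
    change of type. *)
Definition dual_upto m (f b : nat -> algC) :=
  [/\ forall i, L (f i), forall i, L (b i) &
      forall i j, (i < m)%N -> (j < m)%N -> tr s (f i * b j) = (i == j)%:R].

(** Pairing with [b j] reads off the coefficient of [f j], so the first [m] entries of [f] are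
    independent over the rationals. *)
Lemma dual_upto_bounded : exists n, forall m f b, dual_upto m f b -> (m <= n)%N.
Proof.
have [n [x [Lx spx]]] := number_field_span nfL.
exists n => m f b [Lf Lb fb]; pose f' (i : 'I_m) := f i.
apply: (@Q_indep_leq _ _ _ x f' spx) => [i|q q0 j]; first exact: Lf.
apply: (fmorph_inj (ratr : rat -> algC)); rewrite rmorph0 /=.
rewrite -(@tr_coord m f' (fun i => b i) (fun i => ratr (q i))) ?q0 ?mul0r ?tr0 //.
  by move=> i k; apply: fb.
by move=> i; exact: subfield_rat.
Qed.

(* A maximal pair of dual families spans: were [x' <> 0] orthogonal to all
   [b j], then [tr (x' / x') <> 0] would allow to enlarge both families. *)
Lemma dual_basis : exists m (f b : 'I_m -> algC),
  [/\ forall i, L (f i), forall i, L (b i),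
      forall i j, tr s (f i * b j) = (i == j)%:R &
      forall x, L x -> x = \sum_j tr s (x * b j) * f j].
Proof.
have [n bnd] := dual_upto_bounded.
pose P m := `[< exists f b, dual_upto m f b >].
have exP : exists m, P m.
  by exists 0%N; apply/asboolP; exists (fun=> 0), (fun=> 0); split=> // i;
    exact: subfield0.
have ubP m : P m -> (m <= n)%N by move=> /asboolP[f [b]]; exact: bnd.
case: (ex_maxnP exP ubP) => m /asboolP[f [b [Lf Lb fb]]] maxm.
exists m, (fun i : 'I_m => f i), (fun i : 'I_m => b i); split=> // [i j|x Lx].
  exact: fb.
apply/eqP; rewrite -subr_eq0; apply/negPn/negP => x'0.
set x' := x - _ in x'0.
have Ltr z i : L z -> L (tr s (z * b i)).
  by move=> Lz; apply/KL/tr_in; exact: subfieldM.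
have Lx' : L x'.
  apply: (subfieldB sfL) => //; apply: (subfield_sum sfL) => i _.
  by apply: (subfieldM sfL) => //; exact: Ltr.
have Kxb i : K (tr s (x * b i)) by apply: tr_in; exact: subfieldM.
have x'b j : (j < m)%N -> tr s (x' * b j) = 0.
  move=> jm; rewrite /x' mulrBl trB mulr_suml tr_sum.
  rewrite (bigD1 (Ordinal jm)) //= -mulrA (trM _ (Kxb _)) fb //.
  rewrite eqxx mulr1 big1 ?addr0 ?subrr // => i ij.
  rewrite -mulrA (trM _ (Kxb _)) fb //.
  by rewrite -val_eqE /= in ij; rewrite (negPf ij) mulr0.
(* As [tr s 1] is [size s], this scaling gives [tr s (x' * c) = 1]. Subtracting a combination of the
   [b j] then makes [c'] orthogonal to the [f i] without changing the pairing with [x']. *)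
pose c := x'^-1 / (size s)%:R.
have Lc : L c.
  by apply: (subfieldM sfL); apply: (subfieldV sfL) => //; exact: subfield_nat.
pose c' := c - \sum_(j < m) tr s (f j * c) * b j.
have KM i : K (tr s (f i * c)) by apply: tr_in; exact: subfieldM.
have Lc' : L c'.
  apply: (subfieldB sfL) => //; apply: (subfield_sum sfL) => i _.
  by apply: (subfieldM sfL) => //; exact: KL.
have fc' i : (i < m)%N -> tr s (f i * c') = 0.
  move=> im; rewrite /c' mulrBr trB mulr_sumr tr_sum.
  rewrite (bigD1 (Ordinal im)) //= [_ * (tr _ _ * _)]mulrCA (trM _ (KM _)) fb //.
  rewrite eqxx mulr1 big1 ?addr0 ?subrr //.
  move=> j ij; rewrite [_ * (tr _ _ * _)]mulrCA (trM _ (KM _)) fb //.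
  by rewrite -val_eqE /= in ij; rewrite eq_sym (negPf ij) mulr0.
have x'c' : tr s (x' * c') = 1.
  rewrite /c' mulrBr trB mulr_sumr tr_sum big1 ?subr0.
    have Kn : K (size s)%:R^-1 by apply/(subfieldV sfK)/(subfield_nat sfK).
    by rewrite /c mulrA divff // mulrC (trM _ Kn) tr1 mulVf // size_trace_neq0.
  by move=> j _; rewrite [_ * (tr _ _ * _)]mulrCA (trM _ (KM _)) x'b ?mulr0.
suff /maxm : P m.+1 by rewrite ltnn.
apply/asboolP; exists (fun i => if i == m then x' else f i),
  (fun i => if i == m then c' else b i); split=> [i|i|i j]; try by case: ifP.
rewrite !ltnS (leq_eqVlt i) (leq_eqVlt j); case: eqVneq => [->|im] /=; case: eqVneq => [->|jm] /=.
- by rewrite x'c' ?eqxx.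
- by move=> _ /x'b->; rewrite ?[m == j]eq_sym ?(negPf jm).
- by move=> /fc'-> _; rewrite ?(negPf im).
- exact: fb.
Qed.

(** Tower law: the products [f i * e j] form a rational basis of [L], and [mxvec] numbers them by a
    single index. *)
Lemma trace_degree m (f b : 'I_m -> algC) n (e : 'I_n -> algC) :
  (forall i, L (f i)) -> (forall i, L (b i)) ->
  (forall i j, tr s (f i * b j) = (i == j)%:R) ->
  (forall x, L x -> x = \sum_j tr s (x * b j) * f j) ->
  Q_indep e -> Q_spans K e -> degree L = (m * n)%N.
Proof.
move=> Lf Lb fb spf inde spe.
have Ke i : K (e i) by exact: (Q_spans_mem _ spe).
pose g := mxvec (\matrix_(i < m, j < n) (f i * e j)) : 'rV[algC]_(m * n).
have gE (q : 'I_(m * n) -> rat) : \sum_k ratr (q k) * g ord0 k =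
    \sum_i (\sum_j ratr (q (mxvec_index i j)) * e j) * f i.
  rewrite (reindex _ (curry_mxvec_bij _ _)) /=.
  under [RHS]eq_bigr => i _ do rewrite mulr_suml.
  rewrite pair_bigA; apply: eq_bigr => [[i j] _] /=.
  by rewrite mxvecE mxE [f i * _]mulrC mulrA.
have Kq (q : 'I_n -> rat) : K (\sum_j ratr (q j) * e j) by apply/spe; exists q.
apply: (@degreeP _ _ (fun k => g ord0 k)) => [q|y].
  rewrite gE => q0; have q0' j : \sum_l ratr (q (mxvec_index j l)) * e l = 0.
    have := @tr_coord _ f b (fun i => \sum_l ratr (q (mxvec_index i l)) * e l) j fb.
    by rewrite q0 mul0r tr0 => <- // i; exact: Kq.
  by move=> k; case/mxvec_indexP: k => i j; apply: (inde (fun l => q (mxvec_index i l))).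
split=> [Ly|[q ->]].
  have /choice[q qP] : forall i, exists q : 'I_n -> rat,
      tr s (y * b i) = \sum_j ratr (q j) * e j.
    by move=> i; apply/spe/tr_in; exact: subfieldM.
  pose Q := mxvec (\matrix_(i < m, j < n) q i j) : 'rV[rat]_(m * n).
  exists (fun k => Q ord0 k); rewrite gE {1}(spf _ Ly); apply: eq_bigr => i _.
  by rewrite qP; congr (_ * _); apply: eq_bigr => j _; rewrite mxvecE mxE.
rewrite gE; apply: (subfield_sum sfL) => i _; apply: (subfieldM sfL) => //.
exact/KL/Kq.
Qed.

End Trace.

(** An instance of trace duality over [Qset]: the family [f] of a dual pair is a rational basis. *)
Lemma number_field_basis (K : set algC) : number_field K ->
  exists n (e : 'I_n -> algC), [/\ (0 < n)%N, Q_indep e, Q_spans K e & degree K = n].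
Proof.
move=> nfK; have sfK := number_field_subfield nfK.
have QK : Qset `<=` K by move=> _ [q _ <-]; exact: subfield_rat.
have [s trs] := trace_system_exists number_field_Q nfK QK.
have [m [f [b [Kf Kb fb spf]]]] := dual_basis number_field_Q nfK QK trs.
have indf : Q_indep f.
  move=> q q0 j; apply: (fmorph_inj (ratr : rat -> algC)); rewrite rmorph0 /=.
  have Qq i : Qset (ratr (q i)) by exists (q i).
  by rewrite -(tr_coord trs j fb Qq) q0 mul0r tr0.
have spanf : Q_spans K f.
  move=> y; split=> [Ky|[q ->]].
    have /choice[q qP] : forall i, exists q : rat, ratr q = tr s (y * b i).
      move=> i; have [q _ <-] : Qset (tr s (y * b i)); last by exists q.
      by apply: (tr_in trs); exact: subfieldM.
    by exists q; rewrite {1}(spf _ Ky); apply: eq_bigr => i _; rewrite qP.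
  apply: (subfield_sum sfK) => i _; apply: (subfieldM sfK) => //; exact: subfield_rat.
exists m, f; split=> //; last exact: degreeP indf spanf.
rewrite lt0n; apply/eqP => m0; move: f b Kf Kb fb spf indf spanf; rewrite m0.
move=> f b _ _ _ spf _ _; have := spf 1 (subfield1 sfK); rewrite big_ord0.
by move/eqP; rewrite oner_eq0.
Qed.

(** * Extension of absolute values *)

Section RealLemmas.
Variable R : realType.
Implicit Types (C q e d : R).

Lemma bernoulli d n : 0 <= d -> 1 + d *+ n <= (1 + d) ^+ n.
Proof.
move=> d0; elim: n => [|n IH]; first by rewrite mulr0n addr0 expr0.
rewrite exprS (le_trans _ (ler_wpM2l _ IH)) ?addr_ge0 //.
rewrite mulrDl mul1r mulrDr mulr1 mulrSr.
have : 0 <= d * (d *+ n) by rewrite mulr_ge0 ?mulrn_wge0.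
lra.
Qed.

Lemma pow_small C q e : 0 <= q -> q < 1 -> 0 < e ->
  exists N, forall n, (N <= n)%N -> C * q ^+ n < e.
Proof.
move=> q0 q1 e0; have [C0|C0] := leP C 0.
  by exists 0%N => n _; rewrite (le_lt_trans _ e0) // mulr_le0_ge0 // exprn_ge0.
have [qq|qn0] := eqVneq q 0.
  by exists 1%N => n n1; rewrite qq expr0n gtn_eqF // mulr0.
have {q0 qn0} q0 : 0 < q by rewrite lt0r qn0 q0.
pose d := q^-1 - 1; have d0 : 0 < d by rewrite subr_gt0 invf_gt1.
have Ce : 0 <= C / e / d by rewrite !divr_ge0 ?ltW.
exists (Num.bound (C / e / d)) => n nN.
have : C / e / d < n%:R by rewrite (lt_le_trans (archi_boundP Ce)) // ler_nat.
rewrite ltr_pdivrMr // ltr_pdivrMr // => H.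
have d1 : 1 + d = q^-1 by rewrite /d addrC subrK.
have := bernoulli n (ltW d0); rewrite d1 exprVn => B.
rewrite -ltr_pdivlMr ?exprn_gt0 // (lt_le_trans H) // mulrC.
by rewrite ler_pM2l // (le_trans _ B) // mulr_natl lerDr.
Qed.

End RealLemmas.

Section AbsVal.
Variables (R : realType) (K : set algC) (sfK : subfield K) (phi : algC -> R).
Hypothesis av : absval K phi.

Lemma absval_ge0 x : K x -> 0 <= phi x.
Proof. by case: av => + _; exact. Qed.

Lemma absval_eq0 x : K x -> phi x = 0 <-> x = 0.
Proof. by case: av => _ [+ _]; exact. Qed.

Lemma absvalM x y : K x -> K y -> phi (x * y) = phi x * phi y.
Proof. by case: av => _ [_ [+ _]]; exact. Qed.

Lemma absvalD x y : K x -> K y -> phi (x + y) <= phi x + phi y.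
Proof. by case: av => _ [_ [_ [+ _]]]; exact. Qed.

Lemma absval0 : phi 0 = 0.
Proof. by apply/absval_eq0 => //; exact: subfield0. Qed.

Lemma absval_gt0 x : K x -> x != 0 -> 0 < phi x.
Proof.
move=> Kx x0; rewrite lt0r absval_ge0 // andbT; apply: contra_neq x0.
by move/absval_eq0; apply.
Qed.

Lemma absval1 : phi 1 = 1.
Proof.
have K1 := subfield1 sfK; have p1 := absval_gt0 K1 (oner_neq0 _).
by apply: (mulfI (lt0r_neq0 p1)); rewrite -absvalM // !mulr1.
Qed.

Lemma absvalN x : K x -> phi (- x) = phi x.
Proof.
move=> Kx; have K1 := subfieldN sfK (subfield1 sfK).
rewrite -mulN1r absvalM //; suff -> : phi (-1) = 1 by rewrite mul1r.
have : phi (-1) ^+ 2 = 1 by rewrite expr2 -absvalM // mulrNN mulr1 absval1.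
by move/eqP; rewrite sqrf_eq1 => /orP[/eqP //|/eqP p1];
  have := absval_ge0 K1; rewrite p1 lerNr oppr0 ler10.
Qed.

Lemma absvalB x y : K x -> K y -> phi (x - y) <= phi x + phi y.
Proof. by move=> Kx Ky; rewrite -(absvalN Ky) absvalD //; exact: subfieldN. Qed.

Lemma absvalX x n : K x -> phi (x ^+ n) = phi x ^+ n.
Proof.
move=> Kx; elim: n => [|n IH]; first by rewrite !expr0 absval1.
by rewrite !exprS absvalM ?IH //; exact: subfieldX.
Qed.

Lemma absvalV x : K x -> phi x^-1 = (phi x)^-1.
Proof.
move=> Kx; have [->|x0] := eqVneq x 0; first by rewrite invr0 absval0 invr0.
apply: (mulfI (lt0r_neq0 (absval_gt0 Kx x0))).
rewrite -absvalM ?mulfV ?absval1 //; last exact: subfieldV.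
by rewrite gt_eqF // absval_gt0.
Qed.

Lemma absval_sum I (r : seq I) (F : I -> algC) : (forall i, K (F i)) ->
  phi (\sum_(i <- r) F i) <= \sum_(i <- r) phi (F i).
Proof.
move=> KF; elim: r => [|i r IH]; first by rewrite !big_nil absval0.
rewrite !big_cons (le_trans (absvalD _ _)) ?lerD2l //; exact: subfield_sum.
Qed.

Lemma absval_nat n : phi n%:R <= n%:R.
Proof.
elim: n => [|n IH]; first by rewrite absval0.
rewrite !mulrSr (le_trans (absvalD _ _)) ?absval1 ?lerD2r //; last exact: subfield1.
exact: subfield_nat.
Qed.

Lemma absval_nontrivial : exists x, [/\ K x, x != 0 & phi x != 1].
Proof. by case: av => _ [_ [_ [_ [x [Kx [x0 x1]]]]]]; exists x. Qed.

End AbsVal.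

(** * Square-multiplicative seminorms and the spectral radius *)

Section Seminorm.
Variables (R : realType) (K : set algC) (nfK : number_field K) (phi : algC -> R).
Hypothesis av : absval K phi.
Let sfK := number_field_subfield nfK.

(** Multiplicativity is asked for squares only: this passes to the infima formed below and already
    implies it for all powers. On [K] an inequality is enough, since it becomes an equality once [p]
    is multiplicative. *)
Definition sq_seminorm (p : algC -> R) :=
  [/\ forall x, 0 <= p x, forall x y, p (x + y) <= p x + p y,
      forall x y, p (x * y) <= p x * p y, forall x, p (x ^+ 2) = p x ^+ 2 &
      p 1 = 1 /\ forall a, K a -> p a <= phi a].

Lemma le_inf_mul (A : set R) (z c : R) : A !=set0 -> 0 <= c ->
  (forall r, A r -> z <= r * c) -> z <= inf A * c.
Proof.
move=> A0 c0 H; have [c00|cn0] := eqVneq c 0.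
  by have [r Ar] := A0; have := H r Ar; rewrite c00 !mulr0.
rewrite -ler_pdivrMr ?lt0r ?cn0 //; apply: lb_le_inf => // r Ar.
by rewrite ler_pdivrMr ?lt0r ?cn0 //; exact: H.
Qed.

(** Serves three times: for the spectral bounds, for chains of seminorms and for shrinking. The
    slack [e] in the last condition is there for the spectral bounds, which are strictly
    positive. *)
Lemma sq_seminorm_inf (A : algC -> set R) :
  (forall x r, A x r -> 0 <= r) -> (forall x, A x !=set0) ->
  (forall x y r r', A x r -> A y r' -> exists2 r'', A (x + y) r'' & r'' <= r + r') ->
  (forall x y r r', A x r -> A y r' -> exists2 r'', A (x * y) r'' & r'' <= r * r') ->
  (forall x r, A (x ^+ 2) r -> exists2 r', A x r' & r' ^+ 2 <= r) ->
  (forall r, A 1 r -> 1 <= r) ->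
  (forall a e, K a -> 0 < e -> exists2 r, A a r & r <= phi a + e) ->
  sq_seminorm (fun x => inf (A x)).
Proof.
move=> A0 An AD AM AQ A1 AK.
have lbA x r : A x r -> inf (A x) <= r.
  by apply: ge_inf; exists 0 => ? /A0.
have infA x : has_inf (A x) by split=> //; exists 0 => ? /A0.
have inf0 x : 0 <= inf (A x) by apply: lb_le_inf => // r /A0.
have infM x y : inf (A (x * y)) <= inf (A x) * inf (A y).
  apply: le_inf_mul => // r Ar; rewrite [r * _]mulrC; apply: le_inf_mul => //.
    exact: A0 Ar.
  move=> r' Ar'; have [r'' Ar'' /(le_trans (lbA _ _ Ar''))] := AM _ _ _ _ Ar Ar'.
  by rewrite [r * _]mulrC.
have infK a : K a -> inf (A a) <= phi a.
  move=> Ka; apply/ler_addgt0Pr => d d0; have [r /lbA Ar] := AK a d Ka d0.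
  exact: le_trans.
split=> //.
- move=> x y; apply/ler_addgt0Pr => e e0; have e20 : 0 < e / 2 by rewrite divr_gt0.
  have [r Ar rx] := inf_adherent e20 (infA x).
  have [r' Ar' ry] := inf_adherent e20 (infA y).
  have [r'' /lbA + rr] := AD _ _ _ _ Ar Ar'; lra.
- move=> x; apply/eqP; rewrite eq_le {1}expr2 [in X in _ <= X]expr2 infM /=.
  apply: lb_le_inf => // r /AQ[r' Ar']; apply: le_trans.
  by rewrite lerXn2r ?nnegrE //; [exact: A0 Ar' | exact: lbA].
split=> //; apply/eqP; rewrite eq_le; apply/andP; split.
  by rewrite -(absval1 sfK av) infK //; exact: subfield1.
by apply: lb_le_inf => // r /A1.
Qed.

(** Equality holds for exponents that are powers of 2. Padding [n] to [2 ^ n] bounds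
    [p x ^+ (2 ^ n)] by [p (x ^+ n) * p x ^+ (2 ^ n - n)], and the last factor cancels. *)
Lemma sq_seminormX p x n : sq_seminorm p -> p (x ^+ n) = p x ^+ n.
Proof.
case=> p0 _ pM pQ [p1 _].
have pX m : p (x ^+ m) <= p x ^+ m.
  elim: m => [|m IH]; first by rewrite !expr0 p1.
  by rewrite !exprS (le_trans (pM _ _)) // ler_wpM2l.
have p2 k : p (x ^+ (2 ^ k)) = p x ^+ (2 ^ k).
  by elim: k => [|k IH]; [rewrite !expn0 !expr1 | rewrite expnSr !exprM pQ IH].
apply/eqP; rewrite eq_le pX /=.
have [px0|px0] := eqVneq (p x) 0.
  rewrite px0 expr0n; case: n => [|n]; last by rewrite mulr0n p0.
  by rewrite expr0 p1.
have {px0} px0 : 0 < p x by rewrite lt0r px0 p0.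
have n2 : (n <= 2 ^ n)%N by rewrite ltnW // ltn_expl.
rewrite -(ler_pM2r (exprn_gt0 (2 ^ n - n) px0)) -exprD subnKC // -p2.
by rewrite -{1}(subnKC n2) exprD (le_trans (pM _ _)) // ler_wpM2l.
Qed.

(* The terms of the infimum decrease with [n]; the resulting seminorm lies below [p]
   and satisfies [q (x * f) = p f * q x], so a minimal [p] is multiplicative. *)
Lemma sq_seminorm_shrink p f : sq_seminorm p -> 0 < p f ->
  sq_seminorm (fun x => inf [set r | exists n, r = p (x * f ^+ n) / p f ^+ n]).
Proof.
move=> snp pf0; have := snp; case=> p0 pD pM pQ [p1 pK].
have pX := sq_seminormX f _ snp.
have pfn n : 0 < p f ^+ n by rewrite exprn_gt0.
have mono x m n : p (x * f ^+ (m + n)) / p f ^+ (m + n) <= p (x * f ^+ m) / p f ^+ m.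
  rewrite ler_pdivrMr // (exprD (p f) m n) mulrA divfK ?gt_eqF //.
  by rewrite -pX exprD mulrA.
apply: sq_seminorm_inf.
- by move=> x r [n ->]; rewrite divr_ge0 ?p0 // ltW.
- by move=> x; exists (p (x * f ^+ 0) / p f ^+ 0), 0%N.
- move=> x y _ _ [m ->] [n ->].
  exists (p ((x + y) * f ^+ (m + n)) / p f ^+ (m + n)); first by exists (m + n)%N.
  apply: le_trans (lerD (mono x m n) (_ : p (y * f ^+ (m + n)) / p f ^+ (m + n) <= _)).
    by rewrite -mulrDl ler_pM2r ?invr_gt0 // mulrDl.
  by rewrite addnC.
- move=> x y _ _ [m ->] [n ->].
  exists (p ((x * y) * f ^+ (m + n)) / p f ^+ (m + n)); first by exists (m + n)%N.
  rewrite mulrACA -invfM -exprD ler_pM2r ?invr_gt0 // (le_trans _ (pM _ _)) //.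
  by rewrite exprD mulrACA.
- move=> x _ [n ->]; exists (p (x * f ^+ n) / p f ^+ n); first by exists n.
  apply: le_trans (mono _ n n).
  by rewrite exprMn exprVn -pQ exprMn -!exprM muln2 -addnn.
- by move=> _ [n ->]; rewrite mul1r pX divff // gt_eqF.
- move=> a d Ka d0; exists (p a); last by rewrite ler_wpDr ?pK // ltW.
  by exists 0%N; rewrite !expr0 divr1 mulr1.
Qed.

Lemma sq_seminorm_minimal p0 : sq_seminorm p0 ->
  exists p, sq_seminorm p /\
    forall q, sq_seminorm q -> (forall x, q x <= p x) -> q = p.
Proof.
move=> sn0; pose T := {p | sq_seminorm p}.
(* The order is reversed: a maximal element for [le] is a pointwise minimal seminorm. *)
pose le (p q : T) := `[< forall x, sval q x <= sval p x >].
have [||A totA|[p snp] maxp] := @ZL_preorder T (exist _ p0 sn0) le.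
- by move=> p; apply/asboolP.
- move=> p q r /asboolP pq /asboolP qr; apply/asboolP => x.
  exact: le_trans (qr x) (pq x).
- have [[a0 Aa0]|] := pselect (A !=set0); last first.
    by move=> A0; exists (exist _ p0 sn0) => s As; case: A0; exists s.
  (* Values taken from two members of the chain are compared inside one member below both; totality
     of the chain provides it. *)
  have dir p q : A p -> A q -> exists r, [/\ A r, forall x, sval r x <= sval p x &
      forall x, sval r x <= sval q x].
    move=> Ap Aq; have [/asboolP pq|/asboolP qp] := totA p q Ap Aq.
      by exists q.
    by exists p.
  pose B x := [set r | exists2 p : T, A p & r = sval p x].
  have snB : sq_seminorm (fun x => inf (B x)).
    apply: sq_seminorm_inf.
    + by move=> x _ [[p [p0' ? ? ? ?]] Ap ->].
    + by move=> x; exists (sval a0 x), a0.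
    + move=> x y _ _ [p Ap ->] [q Aq ->]; have [r [Ar rp rq]] := dir _ _ Ap Aq.
      exists (sval r (x + y)); first by exists r.
      have [_ rD _ _ _] := svalP r; rewrite (le_trans (rD _ _)) // lerD //.
    + move=> x y _ _ [p Ap ->] [q Aq ->]; have [r [Ar rp rq]] := dir _ _ Ap Aq.
      exists (sval r (x * y)); first by exists r.
      by have [r0 _ rM _ _] := svalP r; rewrite (le_trans (rM _ _)) // ler_pM.
    + move=> x _ [p Ap ->]; exists (sval p x); first by exists p.
      by have [_ _ _ -> _] := svalP p.
    + by move=> _ [p Ap ->]; have [_ _ _ _ [-> _]] := svalP p.
    + move=> a d Ka d0; exists (sval a0 a); first by exists a0.
      by have [_ _ _ _ [_ pK]] := svalP a0; rewrite ler_wpDr ?pK // ltW.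
  exists (exist _ _ snB) => p Ap; apply/asboolP => x /=.
  apply: ge_inf; last by exists p.
  by exists 0 => _ [[q [q0 ? ? ? ?]] Aq ->]; exact: q0.
exists p; split=> // q snq qp; apply/funext => x; apply/eqP; rewrite eq_le qp /=.
by have /asboolP := maxp (exist _ q snq) (introT (asboolP _) qp); apply.
Qed.

(** By minimality the shrunken seminorm is [p] itself, so all its quotients at [x] are at least
    [p x]. The quotients at [x * f] are those at [x] with the index shifted by one, times [p f]. *)
Lemma sq_seminorm_minimal_mul p : sq_seminorm p ->
    (forall q, sq_seminorm q -> (forall x, q x <= p x) -> q = p) ->
  forall x y, p (x * y) = p x * p y.
Proof.
move=> snp minp x f; have [p0 pD pM pQ [p1 pK]] := snp.
apply/eqP; rewrite eq_le pM /=.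
have [->|pf0] := eqVneq (p f) 0; first by rewrite mulr0.
have {pf0} pf0 : 0 < p f by rewrite lt0r pf0 p0.
pose A z := [set r | exists n, r = p (z * f ^+ n) / p f ^+ n].
have lbA z : has_lbound (A z).
  by exists 0 => _ [n ->]; rewrite divr_ge0 ?p0 // exprn_ge0.
have eqp : (fun z => inf (A z)) = p.
  apply: minp; first exact: sq_seminorm_shrink.
  by move=> z; apply: ge_inf => //; exists 0%N; rewrite !expr0 mulr1 divr1.
rewrite -(congr1 (@^~ (x * f)) eqp) /=; apply: lb_le_inf.
  by exists (p (x * f * f ^+ 0) / p f ^+ 0), 0%N.
move=> _ [n ->]; rewrite -mulrA -exprS.
have : p x <= p (x * f ^+ n.+1) / p f ^+ n.+1.
  by rewrite -(congr1 (@^~ x) eqp) /=; apply: ge_inf => //; exists n.+1.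
rewrite -(ler_pM2r pf0) => /le_trans; apply.
by rewrite (exprSr (p f)) invfM -!mulrA mulVf ?mulr1 // gt_eqF.
Qed.

(* The infimum over [r] is the spectral radius of [x] for any norm on a number field
   containing [K] and [x]; quantifying over the family [e] makes it independent of
   the field, hence defined on all of [algC]. *)
Definition spectral_bound (x : algC) (r : R) := 0 < r /\
  exists (I : finType) (e : I -> algC) (C : R), 0 <= C /\
    forall k, exists a : I -> algC,
      [/\ forall i, K (a i), x ^+ k = \sum_i a i * e i &
          \sum_i phi (a i) <= C * r ^+ k].

Lemma spectral_bound_prod x y r r' k l (I J : finType) (e : I -> algC) (g : J -> algC)
    (a : I -> algC) (b : J -> algC) C D :
  (forall i, K (a i)) -> (forall j, K (b j)) ->
  x ^+ k = \sum_i a i * e i -> y ^+ l = \sum_j b j * g j ->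
  \sum_i phi (a i) <= C * r ^+ k -> \sum_j phi (b j) <= D * r' ^+ l ->
  [/\ forall p : I * J, K (a p.1 * b p.2),
      x ^+ k * y ^+ l = \sum_(p : I * J) (a p.1 * b p.2) * (e p.1 * g p.2) &
      \sum_(p : I * J) phi (a p.1 * b p.2) <= C * D * (r ^+ k * r' ^+ l)].
Proof.
move=> Ka Kb -> -> aC bD; split.
- by move=> p; exact: subfieldM.
- rewrite mulr_suml (eq_bigr (fun i => \sum_j (a i * b j) * (e i * g j))).
    by rewrite pair_bigA.
  by move=> i _; rewrite mulr_sumr; apply: eq_bigr => j _; rewrite mulrACA.
- rewrite mulrACA; have -> : \sum_(p : I * J) phi (a p.1 * b p.2) =
      (\sum_i phi (a i)) * (\sum_j phi (b j)).
    rewrite mulr_suml -(pair_bigA _ (fun i j => phi (a i * b j))) /=.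
    apply: eq_bigr => i _; rewrite mulr_sumr; apply: eq_bigr => j _.
    by rewrite (absvalM av).
  by apply: ler_pM => //; apply: sumr_ge0 => i _; exact: (absval_ge0 av).
Qed.

Lemma spectral_boundM x y r r' : spectral_bound x r -> spectral_bound y r' ->
  spectral_bound (x * y) (r * r').
Proof.
move=> [r0 [I [e [C [C0 HC]]]]] [r'0 [J [g [D [D0 HD]]]]].
split; first exact: mulr_gt0.
exists (I * J)%type, (fun p => e p.1 * g p.2), (C * D); split; first exact: mulr_ge0.
move=> k; have [a [Ka xk aC]] := HC k; have [b [Kb yk bD]] := HD k.
have [Kab xy abCD] := spectral_bound_prod Ka Kb xk yk aC bD.
by exists (fun p => a p.1 * b p.2); split; rewrite ?exprMn.
Qed.

(** The binomial formula gives the coefficients of [(x + y) ^+ k]. As [phi n%:R <= n%:R] for every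
    absolute value, the bounds add up to the expansion of [(r + r') ^+ k]. *)
Lemma spectral_boundD x y r r' : spectral_bound x r -> spectral_bound y r' ->
  spectral_bound (x + y) (r + r').
Proof.
move=> [r0 [I [e [C [C0 HC]]]]] [r'0 [J [g [D [D0 HD]]]]].
split; first exact: addr_gt0.
exists (I * J)%type, (fun p => e p.1 * g p.2), (C * D); split; first exact: mulr_ge0.
have [a HA] := choice HC; have [b HB] := choice HD.
move=> k; pose c (p : I * J) (i : 'I_k.+1) := a (k - i)%N p.1 * b i p.2.
have cP (i : 'I_k.+1) : [/\ forall p, K (c p i),
    x ^+ (k - i) * y ^+ i = \sum_p c p i * (e p.1 * g p.2) &
    \sum_p phi (c p i) <= C * D * (r ^+ (k - i) * r' ^+ i)].
  have [Ka xk aC] := HA (k - i)%N; have [Kb yk bD] := HB i.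
  exact: spectral_bound_prod Ka Kb xk yk aC bD.
have Kc p i : K (c p i) by have [Kab _ _] := cP i; exact: Kab.
exists (fun p => \sum_(i < k.+1) 'C(k, i)%:R * c p i); split.
- move=> p; apply: (subfield_sum sfK) => i _; apply: (subfieldM sfK).
    exact: subfield_nat.
  exact: Kc.
- rewrite exprDn; under [RHS]eq_bigr => p _ do rewrite mulr_suml.
  rewrite exchange_big /=; apply: eq_bigr => i _.
  have [_ -> _] := cP i; rewrite -mulr_natl mulr_sumr.
  by apply: eq_bigr => p _; rewrite -!mulrA.
apply: (@le_trans _ _ (\sum_(p : I * J) \sum_(i < k.+1) 'C(k, i)%:R * phi (c p i))).
  apply: ler_sum => p _.
  have KCc (i : 'I_k.+1) : K ('C(k, i)%:R * c p i) by apply: subfieldM => //; exact: subfield_nat.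
  rewrite (le_trans (absval_sum sfK av _ KCc)) //; apply: ler_sum => i _.
  rewrite (absvalM av) //; last exact: subfield_nat.
  by rewrite ler_wpM2r ?(absval_ge0 av) // (absval_nat sfK av).
rewrite exchange_big /= exprDn mulr_sumr; apply: ler_sum => i _.
rewrite -mulr_sumr mulrnAr -[leRHS]mulr_natl ler_wpM2l //.
by have [_ _] := cP i.
Qed.

Lemma spectral_bound_sq x r : spectral_bound (x ^+ 2) r ->
  spectral_bound x (Num.sqrt r).
Proof.
move=> [r0 [I [e [C [C0 HC]]]]]; split; first by rewrite sqrtr_gt0.
have [a HA] := choice HC.
exists (I + I)%type, (fun z => match z with inl i => e i | inr i => x * e i end).
(* For odd [k] the power of [x ^+ 2] yields [Num.sqrt r ^+ k.-1] only; the summand [(Num.sqrt r)^-1]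
   makes up for the missing factor, and the summand 1 is for even [k]. *)
have D0 : 0 <= C * (1 + (Num.sqrt r)^-1).
  by rewrite mulr_ge0 // addr_ge0 // invr_ge0 sqrtr_ge0.
exists (C * (1 + (Num.sqrt r)^-1)); split=> // k.
have [Ka xk aC] := HA k./2.
have x2 : x ^+ k = x ^+ (odd k) * \sum_i a k./2 i * e i.
  by rewrite -xk -exprM mul2n -exprD odd_double_half.
pose b (z : I + I) := match z with
  | inl i => if odd k then 0 else a k./2 i | inr i => if odd k then a k./2 i else 0 end.
exists b; split.
- by move=> [i|i] /=; case: (odd k) => //; exact: subfield0.
- rewrite x2 big_sumType /= ; case: (odd k).
    rewrite [X in X + _]big1 ?add0r => [|i _]; last by rewrite mul0r.
    by rewrite expr1 mulr_sumr; apply: eq_bigr => i _; rewrite mulrCA.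
  rewrite [X in _ + X]big1 ?addr0 => [|i _]; last by rewrite mul0r.
  by rewrite expr0 mul1r.
have -> : \sum_z phi (b z) = \sum_i phi (a k./2 i).
  rewrite big_sumType /=; case: (odd k).
    by rewrite [X in X + _]big1 ?add0r // => i _; rewrite (absval0 sfK av).
  by rewrite [X in _ + X]big1 ?addr0 // => i _; rewrite (absval0 sfK av).
have rk : r ^+ k./2 = Num.sqrt r ^+ (k./2).*2 by rewrite -mul2n exprM sqr_sqrtr // ltW.
rewrite (le_trans aC) // rk -mulrA ler_wpM2l // -{2}(odd_double_half k) exprD mulrA.
set u := Num.sqrt r ^+ _; have u0 : 0 <= u by rewrite exprn_ge0 ?sqrtr_ge0.
rewrite ler_peMl //; case: (odd k); rewrite ?expr0 ?mulr1 ?expr1; last first.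
  by rewrite lerDl invr_ge0 sqrtr_ge0.
by rewrite mulrDl mul1r mulVf ?lerDr ?sqrtr_ge0 // gt_eqF // sqrtr_gt0.
Qed.

(** [A] is the matrix of multiplication by [x] in the basis [f]. Since [D] exceeds all its column
    sums, each multiplication by [x] increases the sum of the coefficients by a factor of at most
    [D]. *)
Lemma spectral_bound_exists x : exists r, spectral_bound x r.
Proof.
have [M [nfM KM xM]] := number_field_ext [:: x] nfK.
have {xM} Mx : M x by apply: xM; rewrite mem_head.
have sfM := number_field_subfield nfM.
have [s trs] := trace_system_exists nfK nfM KM.
have [m [f [b [Mf Mb fb spf]]]] := dual_basis nfK nfM KM trs.
pose A i j := tr s (x * f j * b i).
have KA i j : K (A i j) by apply: (tr_in trs); do 2 apply: (subfieldM sfM) => //.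
pose D := 1 + \sum_j \sum_i phi (A i j).
have SA0 j : 0 <= \sum_i phi (A i j) by apply: sumr_ge0 => i _; exact: (absval_ge0 av).
have D1 : 1 <= D by rewrite lerDl sumr_ge0.
have D0 : 0 < D by exact: lt_le_trans D1.
exists D; split=> //; pose C := \sum_j phi (tr s (1 * b j)).
have K1 j : K (tr s (1 * b j)) by apply: (tr_in trs); rewrite mul1r.
exists 'I_m, f, C; split; first by apply: sumr_ge0 => i _; exact: (absval_ge0 av).
elim=> [|k [a [Ka xk aC]]].
  exists (fun j => tr s (1 * b j)); split; rewrite ?expr0 ?mulr1 //.
  exact: spf (subfield1 sfM).
exists (fun i => \sum_j a j * A i j); split.
- by move=> i; apply: (subfield_sum sfK) => j _; exact: subfieldM.
- rewrite exprS xk mulr_sumr; under [RHS]eq_bigr => i _ do rewrite mulr_suml.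
  rewrite exchange_big /=; apply: eq_bigr => j _.
  rewrite mulrCA {1}(spf (x * f j)); last exact: subfieldM.
  by rewrite mulr_sumr; apply: eq_bigr => i _; rewrite mulrA.
apply: (@le_trans _ _ (\sum_i \sum_j phi (a j) * phi (A i j))).
  apply: ler_sum => i _; have KaA j : K (a j * A i j) by exact: subfieldM.
  rewrite (le_trans (absval_sum sfK av _ KaA)) //; apply: ler_sum => j _.
  by rewrite (absvalM av).
rewrite exchange_big /= exprSr mulrA.
apply: (@le_trans _ _ ((\sum_j phi (a j)) * D)).
  rewrite mulr_suml; apply: ler_sum => j _; rewrite -mulr_sumr.
  rewrite ler_wpM2l ?(absval_ge0 av) // /D [X in 1 + X](bigD1 j) //= addrCA lerDl.
  by rewrite addr_ge0 // sumr_ge0.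
by rewrite ler_wpM2r // ltW.
Qed.

(** The trace divided by [size s] is [K]-linear and fixes 1. Applied to the expansions of [1 ^+ k]
    it bounds 1 by a constant times [r ^+ k] for every [k], which excludes [r < 1]. *)
Lemma spectral_bound1 r : spectral_bound 1 r -> 1 <= r.
Proof.
move=> [r0 [I [e [C [C0 HC]]]]].
have [M [nfM KM eM]] := number_field_ext (codom e) nfK.
have Me i : M (e i) by apply: eM; exact: codom_f.
have [s trs] := trace_system_exists nfK nfM KM.
have Kn : K (size s)%:R^-1 by apply/(subfieldV sfK)/(subfield_nat sfK).
pose t i := (size s)%:R^-1 * tr s (e i).
have Kt i : K (t i) by apply: (subfieldM sfK) => //; exact: (tr_in trs).
rewrite leNgt; apply/negP => r1.
have [N /(_ N (leqnn _))] := pow_small (C * \sum_i phi (t i)) (ltW r0) r1 ltr01.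
apply/negP; rewrite -leNgt mulrAC; move: N => k.
have [a [Ka xk aC]] := HC k.
have D1 : 1 = \sum_i a i * t i.
  have -> : 1 = (size s)%:R^-1 * tr s (1 ^+ k).
    by rewrite expr1n tr1 mulVf // (size_trace_neq0 trs).
  rewrite xk tr_sum mulr_sumr.
  by apply: eq_bigr => i _; rewrite (trM trs) // mulrCA.
have Kat i : K (a i * t i) by exact: subfieldM.
rewrite -{1}(absval1 sfK av) D1 (le_trans (absval_sum sfK av _ Kat)) //.
have t0 i : 0 <= phi (t i) by exact: (absval_ge0 av).
apply: (@le_trans _ _ (\sum_i phi (a i) * \sum_i phi (t i))).
  apply: ler_sum => i _; rewrite (absvalM av) // ler_wpM2l ?(absval_ge0 av) //.
  by rewrite (bigD1 i) //= lerDl sumr_ge0.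
by rewrite -mulr_suml ler_wpM2r // sumr_ge0.
Qed.

Lemma spectral_seminorm : sq_seminorm (fun x => inf (spectral_bound x)).
Proof.
apply: sq_seminorm_inf.
- by move=> x r [/ltW].
- exact: spectral_bound_exists.
- by move=> x y r r' bx by'; exists (r + r') => //; exact: spectral_boundD.
- by move=> x y r r' bx by'; exists (r * r') => //; exact: spectral_boundM.
- move=> x r bx; exists (Num.sqrt r); first exact: spectral_bound_sq.
  by rewrite sqr_sqrtr //; case: bx => /ltW.
- exact: spectral_bound1.
move=> a d Ka d0; exists (phi a + d) => //; split.
  by rewrite ltr_wpDl // (absval_ge0 av).
exists unit, (fun=> 1), 1; split=> // k; exists (fun=> a ^+ k); split.
- by move=> _; exact: subfieldX.
- by rewrite (big_pred1 tt) ?mulr1 // => -[].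
rewrite (big_pred1 tt) => [|[]//]; rewrite mul1r (absvalX sfK av) //.
by rewrite lerXn2r ?nnegrE ?addr_ge0 ?(absval_ge0 av) ?lerDl // ltW.
Qed.

(** For a multiplicative [p] the bound [p <= phi] on [K], applied to [x^-1] too, becomes an
    equality. *)
Theorem absval_extension : exists psi, absval setT psi /\ forall x, K x -> psi x = phi x.
Proof.
have [p [snp minp]] := sq_seminorm_minimal spectral_seminorm.
have pM := sq_seminorm_minimal_mul snp minp.
have [p0 pD _ _ [p1 pK]] := snp.
have pV x : x != 0 -> p x * p x^-1 = 1 by move=> x0; rewrite -pM mulfV.
have pE x : K x -> p x = phi x.
  move=> Kx; have [->|x0] := eqVneq x 0.
    have := pK 0 (subfield0 sfK); rewrite (absval0 sfK av) => p00.
    by apply/eqP; rewrite eq_le p00 p0.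
  apply/eqP; rewrite eq_le pK //=.
  have phx := absval_gt0 av Kx x0.
  have px : p x != 0.
    by apply: contraTneq (oner_neq0 R) => px; rewrite -(pV _ x0) px mul0r eqxx.
  have {px}px : 0 < p x by rewrite lt0r px p0.
  rewrite -(ler_pV2) ?inE ?unitfE ?gt_eqF //.
  rewrite -(absvalV sfK av) // (le_trans _ (pK _ _)) //; last exact: subfieldV.
  by rewrite -(ler_pM2l px) pV // mulfV // gt_eqF.
exists p; split=> //; split; first by move=> x _; exact: p0.
split.
  move=> x _; split=> [px|->]; last by rewrite pE ?(absval0 sfK av) //; exact: subfield0.
  apply/eqP; apply: contraT => x0; have := pV _ x0; rewrite px mul0r => /eqP.
  by rewrite eq_sym oner_eq0.
split; first by move=> x y _ _.
split; first by move=> x y _ _.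
have [x [Kx x0 x1]] := absval_nontrivial av.
by exists x; rewrite pE.
Qed.

End Seminorm.

(** * Weak approximation *)

Section Equivalence.
Variables (R : realType) (L : set algC) (sfL : subfield L).
Implicit Types (phi psi : algC -> R).

Lemma absval_equiv_refl phi : absval L phi -> absval_equiv L phi phi.
Proof.
by move=> av; exists 1; split=> // x Lx; rewrite powRr1 // (absval_ge0 av).
Qed.

Lemma absval_equiv_sym phi psi : absval L phi -> absval_equiv L phi psi ->
  absval_equiv L psi phi.
Proof.
move=> av [t [t0 H]]; exists t^-1; split; first by rewrite invr_gt0.
move=> x Lx; rewrite H // -powRrM mulfV ?powRr1 ?(absval_ge0 av) //.
by rewrite gt_eqF.
Qed.

Lemma absval_equiv_trans phi psi chi : absval_equiv L phi psi ->
  absval_equiv L psi chi -> absval_equiv L phi chi.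
Proof.
move=> [t [t0 H]] [u [u0 G]]; exists (t * u); split; first exact: mulr_gt0.
by move=> x Lx; rewrite G // H // powRrM.
Qed.

Lemma absval_small phi : absval L phi -> exists a, [/\ L a, a != 0, 0 < phi a & phi a < 1].
Proof.
move=> av; have [x [Lx x0 x1]] := absval_nontrivial av.
have px := absval_gt0 av Lx x0.
have [xlt|xgt|xe] := ltgtP (phi x) 1; first by exists x.
  exists x^-1; rewrite (absvalV sfL av) // invr_gt0 invr_eq0 invf_lt1 //; split=> //.
  exact: subfieldV.
by rewrite xe eqxx in x1.
Qed.

(** The ratio of the logarithms at [x] and at [a] is the same for [phi] and [psi]: a rational
    [p / d] strictly between two distinct ratios would make [x ^+ d * a ^- p] small for [phi] and
    large for [psi]. The exponent is then the quotient of the logarithms at [a]. *)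
Lemma absval_lt1_equiv phi psi : absval L phi -> absval L psi ->
  (forall x, L x -> phi x < 1 -> psi x < 1) -> absval_equiv L phi psi.
Proof.
move=> av bv H; have [a [La a0 pa pa1]] := absval_small av.
have qa := absval_gt0 bv La a0; have qa1 := H a La pa1.
have l1 : ln (phi a) < 0 by apply: ln_lt0; rewrite pa pa1.
have l2 : ln (psi a) < 0 by apply: ln_lt0; rewrite qa qa1.
have lnX (chi : algC -> R) x n : absval L chi -> L x -> x != 0 ->
    ln (chi (x ^+ n)) = n%:R * ln (chi x).
  move=> cv Lx x0; rewrite (absvalX sfL cv) // mulr_natl lnXn //.
  by rewrite (absval_gt0 cv).
have lnV' (chi : algC -> R) x : absval L chi -> L x -> x != 0 ->
    ln (chi x^-1) = - ln (chi x).
  move=> cv Lx x0; rewrite (absvalV sfL cv) // lnV //.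
  by rewrite posrE (absval_gt0 cv).
have lnZ (p : int) : exists z, [/\ L z, z != 0 &
    forall chi : algC -> R, absval L chi -> ln (chi z) = - (p%:~R * ln (chi a))].
  case: p => n.
    exists (a ^+ n)^-1; split=> [||chi cv]; first by apply: (subfieldV sfL); exact: subfieldX.
      by rewrite invr_eq0 expf_neq0.
    by rewrite lnV' ?expf_neq0 ?lnX //; exact: subfieldX.
  exists (a ^+ n.+1); split=> [||chi cv]; first exact: subfieldX.
    by rewrite expf_neq0.
  by rewrite lnX // NegzE mulrNz mulNr opprK.
(* One inequality suffices, since replacing [x] by [x^-1] reverses it. *)
have key x : L x -> x != 0 -> ln (phi x) / ln (phi a) <= ln (psi x) / ln (psi a).
  move=> Lx x0; rewrite leNgt; apply/negP => /rat_in_itvoo[q].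
  rewrite in_itv /= => /andP[]; rewrite /ratr; set d := denq q; set p := numq q.
  have d0 : 0 < d%:~R :> R by rewrite ltr0z denq_gt0.
  have -> : d%:~R = `|d|%N%:R :> R by rewrite pmulrn gez0_abs // ltW // denq_gt0.
  have {}d0 : 0 < `|d|%N%:R :> R by rewrite pmulrn gez0_abs // ltW // denq_gt0.
  have [z [Lz z0 lz]] := lnZ p.
  rewrite ltr_ndivrMr // ltr_ndivlMr // => H1 H2.
  pose y := x ^+ `|d|%N * z.
  have Ly : L y by apply: (subfieldM sfL) => //; exact: subfieldX.
  have lny (chi : algC -> R) : absval L chi ->
      ln (chi y) = `|d|%N%:R * ln (chi x) - p%:~R * ln (chi a).
    move=> cv; have Lxd := subfieldX sfL `|d|%N Lx.
    rewrite (absvalM cv) // lnM ?posrE ?(absval_gt0 cv) ?expf_neq0 //.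
    by rewrite lz // lnX.
  have y0 : y != 0 by rewrite mulf_neq0 ?expf_neq0.
  have p1 : phi y < 1.
    rewrite -ltr_ln ?posrE ?(absval_gt0 av) // ln1 lny // subr_lt0 mulrC.
    by rewrite -ltr_pdivlMr // mulrAC.
  have := H _ Ly p1; rewrite -ltr_ln ?posrE ?(absval_gt0 bv) // ln1 lny // subr_lt0.
  by rewrite mulrC -ltr_pdivlMr // mulrAC => /(lt_trans H1); rewrite ltxx.
exists (ln (psi a) / ln (phi a)); split; first by rewrite nmulr_lgt0 // invr_lt0.
move=> x Lx; have [->|x0] := eqVneq x 0.
  rewrite (absval0 sfL av) (absval0 sfL bv) powR0 // mulf_neq0 ?invr_eq0 ?lt_eqF //.
have px := absval_gt0 av Lx x0; have qx := absval_gt0 bv Lx x0.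
apply: ln_inj; rewrite ?posrE ?powR_gt0 // ln_powR.
have e : ln (phi x) / ln (phi a) = ln (psi x) / ln (psi a).
  apply/eqP; rewrite eq_le key //=; have x'0 : x^-1 != 0 by rewrite invr_eq0.
  by have := key x^-1 (subfieldV sfL Lx) x'0; rewrite !lnV' // !mulNr lerN2.
by rewrite mulrAC -mulrA e mulrC mulrVK // unitfE lt_eqF.
Qed.

(** The criterion [absval_lt1_equiv] fails in both directions, at [a] and at [b]; the quotient
    [b / a] combines the two failures. *)
Lemma absval_separate phi psi : absval L phi -> absval L psi ->
  ~ absval_equiv L phi psi -> exists x, [/\ L x, 1 < phi x & psi x < 1].
Proof.
move=> av bv neq.
have [a [La pa qa]] : exists a, [/\ L a, phi a < 1 & 1 <= psi a].
  apply: contrapT => H; apply: neq; apply: absval_lt1_equiv => // x Lx px.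
  by rewrite ltNge; apply/negP => qx; apply: H; exists x.
have [b [Lb qb pb]] : exists b, [/\ L b, psi b < 1 & 1 <= phi b].
  apply: contrapT => H; apply: neq; apply: absval_equiv_sym => //.
  apply: absval_lt1_equiv => // x Lx px.
  by rewrite ltNge; apply/negP => qx; apply: H; exists x.
have a0 : a != 0.
  by apply: contraTneq qa => ->; rewrite (absval0 sfL bv) ler10.
have La' := subfieldV sfL La.
exists (b / a); split; first exact: subfieldM.
  rewrite (absvalM av) // (absvalV sfL av) // ltr_pdivlMr ?(absval_gt0 av) //.
  by rewrite mul1r (lt_le_trans pa).
rewrite (absvalM bv) // (absvalV sfL bv) // ltr_pdivrMr ?(absval_gt0 bv) //.
by rewrite mul1r (lt_le_trans qb).
Qed.

Lemma eventually_all (T : Type) (r : seq T) (P : T -> nat -> Prop) :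
  (forall t, List.In t r -> exists N, forall n, (N <= n)%N -> P t n) ->
  exists N, forall n, (N <= n)%N -> forall t, List.In t r -> P t n.
Proof.
elim: r => [|t r IH] H; first by exists 0%N => n _ t [].
have [N1 H1] := H t (or_introl erefl).
have [N2 H2] := IH (fun u ru => H u (or_intror ru)).
exists (maxn N1 N2) => n; rewrite geq_max => /andP[n1 n2] u [<-|ru]; first exact: H1.
exact: H2.
Qed.

Lemma absval_ratio phi x n : absval L phi -> L x -> phi x < 1 ->
  phi (x ^+ n) + phi (1 + x ^+ n) >= 1.
Proof.
move=> av Lx x1; have Lxn := subfieldX sfL n Lx.
have L1 := subfield1 sfL; have L1x := subfieldD sfL L1 Lxn.
have := absvalB sfL av L1x Lxn; rewrite addrK (absval1 sfL av); lra.
Qed.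

(* [x^n / (1 + x^n)] tends to [1] where [x] is large and to [0] where [x] is small. *)
Lemma absval_idempotent phi (r : seq (algC -> R)) x e : absval L phi ->
  (forall psi, List.In psi r -> absval L psi) -> L x -> 1 < phi x ->
  (forall psi, List.In psi r -> psi x < 1) -> 0 < e ->
  exists N, forall n, (N <= n)%N -> let z := x ^+ n / (1 + x ^+ n) in
  [/\ L z, phi (z - 1) < e & forall psi, List.In psi r -> psi z < e].
Proof.
move=> av avr Lx x1 xr e0.
have x0 : x != 0.
  by apply: contraTneq x1 => ->; rewrite (absval0 sfL av) ltr10.
have px : 0 < phi x by exact: lt_trans x1.
(* This says [1 + e < e * phi x ^+ n], whence [phi (1 + x ^+ n)] exceeds [e^-1]. In [N2] the same
   shape gives [psi x ^+ n < e * (1 - psi x ^+ n)], and [N3] keeps [1 + x ^+ n] from vanishing. *)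
have [N1 H1] : exists N, forall n, (N <= n)%N -> (1 + e) * (phi x)^-1 ^+ n < e.
  by apply: pow_small; rewrite ?invr_ge0 ?invf_lt1 // ltW.
have [N2 H2] : exists N, forall n, (N <= n)%N -> forall psi, List.In psi r ->
    (1 + e) * psi x ^+ n < e.
  apply: eventually_all => psi rpsi; apply: pow_small => //; last exact: xr.
  exact: (absval_ge0 (avr _ rpsi)).
have [N3 H3] : exists N, forall n, (N <= n)%N -> 1 * (phi x)^-1 ^+ n < 1.
  by apply: pow_small; rewrite ?invr_ge0 ?invf_lt1 // ltW.
exists (maxn N3 (maxn N1 N2)) => n; rewrite !geq_max => /and3P[/H3 n3 /H1 n1 /H2 n2] z.
have Lxn := subfieldX sfL n Lx.
have L1 := subfield1 sfL; have L1x := subfieldD sfL L1 Lxn.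
have X0 : 0 < phi x ^+ n by rewrite exprn_gt0.
rewrite exprVn ltr_pdivrMr // in n1; rewrite exprVn mul1r invf_lt1 // in n3.
have tri : phi x ^+ n <= phi (1 + x ^+ n) + 1.
  have := absvalB sfL av L1x L1; rewrite addrAC subrr add0r (absval1 sfL av).
  by rewrite (absvalX sfL av).
have y0 : 1 + x ^+ n != 0.
  apply/negP => /eqP y0; move: tri; rewrite y0 (absval0 sfL av) add0r; lra.
have py := absval_gt0 av L1x y0.
split; first exact: (subfieldM sfL Lxn (subfieldV sfL L1x)).
  have -> : z - 1 = - (1 + x ^+ n)^-1 by rewrite /z; field.
  rewrite (absvalN sfL av) ?(absvalV sfL av) //; last exact: subfieldV.
  rewrite -ltf_pV2 ?posrE ?invr_gt0 // invrK.
  have : (1 + e) < e * (1 + phi (1 + x ^+ n)) by rewrite (lt_le_trans n1) // ler_pM2l // addrC.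
  move=> h; rewrite -[ltLHS]mul1r ltr_pdivrMr //; nra.
move=> psi rpsi; have bv := avr _ rpsi; have := n2 _ rpsi => h.
have pz := absval_gt0 bv L1x y0.
rewrite (absvalM bv) //; last exact: subfieldV.
rewrite (absvalV sfL bv) // ltr_pdivrMr // (absvalX sfL bv) //.
have := absval_ratio n bv Lx (xr _ rpsi); rewrite (absvalX sfL bv) // => h'.
nra.
Qed.

Lemma absval_separate_seq phi (r : seq (algC -> R)) : absval L phi ->
  (forall psi, List.In psi r -> absval L psi /\ ~ absval_equiv L phi psi) ->
  exists x, [/\ L x, 1 < phi x & forall psi, List.In psi r -> psi x < 1].
Proof.
move=> av; elim: r => [|chi r IH] H.
  have [a [La a0 pa pa1]] := absval_small av; exists a^-1; split=> //.
    exact: subfieldV.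
  by rewrite (absvalV sfL av) // invf_gt1.
have [x [Lx x1 xr]] := IH (fun psi rpsi => H psi (or_intror rpsi)).
have avr psi : List.In psi r -> absval L psi by move=> rpsi; case: (H psi (or_intror rpsi)).
have [cv neq] := H chi (or_introl erefl).
have [y [Ly y1 yc]] := absval_separate av cv neq.
(* If [chi x <= 1], a high power of [x] corrects [y] at the members of [r] and does no harm at
   [chi]. Otherwise [z = x ^+ n / (1 + x ^+ n)] is used, which tends to 1 at [phi] and at [chi], and
   to 0 on [r]. *)
have [cx|cx] := leP (chi x) 1.
  have [N HN] : exists N, forall n, (N <= n)%N -> forall psi, List.In psi r ->
      psi y * psi x ^+ n < 1.
    apply: eventually_all => psi rpsi; apply: pow_small => //; last exact: xr.
    exact: (absval_ge0 (avr _ rpsi)).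
  have Lxn := subfieldX sfL N Lx.
  exists (x ^+ N * y); split; first exact: subfieldM.
    rewrite (absvalM av) // (absvalX sfL av) // (lt_le_trans y1) // ler_peMl //.
      by rewrite (absval_ge0 av).
    by rewrite exprn_ege1 // ltW.
  move=> psi [<-|rpsi].
    rewrite (absvalM cv) // (absvalX sfL cv) // (le_lt_trans _ yc) // ler_piMl //.
      exact: (absval_ge0 cv).
    by rewrite exprn_ile1 // (absval_ge0 cv).
  rewrite (absvalM (avr _ rpsi)) // (absvalX sfL (avr _ rpsi)) // mulrC.
  exact: HN.
have ge0 psi z : absval L psi -> L z -> 0 <= psi z by move=> bv; exact: (absval_ge0 bv).
(* The tolerances are set by [y]: [1 - e0] is [(phi y)^-1], and the next one satisfies
   [(1 + e1) * chi y < 1], so [z * y] stays above 1 at [phi] and below 1 at [chi]. *)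
have e0 : 0 < (phi y - 1) / phi y by rewrite divr_gt0 ?subr_gt0 // (lt_trans ltr01).
have [N1 H1] := absval_idempotent av avr Lx x1 xr e0.
have e1 : 0 < (1 - chi y) / (1 + chi y).
  by rewrite divr_gt0 ?subr_gt0 // ltr_wpDr ?ge0.
have [N2 H2] := absval_idempotent (r := [::]) cv (fun _ => False_ind _) Lx cx
  (fun _ => False_ind _) e1.
have [N3 H3] : exists N, forall n, (N <= n)%N -> forall psi, List.In psi r ->
    psi (x ^+ n / (1 + x ^+ n)) < (1 + psi y)^-1.
  apply: eventually_all => psi rpsi.
  have e2 : 0 < (1 + psi y)^-1 by rewrite invr_gt0 ltr_wpDr // ge0 //; exact: avr.
  have [N HN] := absval_idempotent av avr Lx x1 xr e2.
  by exists N => n /HN[_ _]; apply.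
pose n := maxn N1 (maxn N2 N3).
have [Lz pz _] := H1 n (leq_maxl _ _).
have n2 : (N2 <= n)%N by rewrite /n maxnCA leq_maxl.
have n3 : (N3 <= n)%N by rewrite /n maxnA leq_maxr.
have [_ cz _] := H2 n n2; have {H3} rz := H3 n n3.
set z := _ / _ in Lz pz cz rz *; have L1 := subfield1 sfL.
have Lz1 := subfieldB sfL Lz L1.
exists (z * y); split; first exact: subfieldM.
  rewrite (absvalM av) //; rewrite ltr_pdivlMr ?(lt_trans ltr01) // in pz.
  have := absvalB sfL av Lz Lz1; rewrite opprB addrCA subrr addr0 (absval1 sfL av) => tri.
  have := ge0 _ _ av Ly; nra.
move=> psi [<-|rpsi].
  rewrite (absvalM cv) //; have c1 : 0 < 1 + chi y by rewrite ltr_wpDr // ge0.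
  rewrite ltr_pdivlMr // in cz.
  have := absvalD cv Lz1 L1; rewrite subrK (absval1 sfL cv) => tri.
  have := ler_wpM2r (ge0 _ _ cv Ly) tri; have := ge0 _ _ cv Lz1; lra.
have bv := avr _ rpsi; rewrite (absvalM bv) //.
have p1 : 0 < 1 + psi y by rewrite ltr_wpDr // ge0.
have := rz _ rpsi; rewrite -[ltRHS]mul1r ltr_pdivlMr // => h.
have := ge0 _ _ bv Ly; have := ge0 _ _ bv Lz; nra.
Qed.

Theorem weak_approximation n (phi : 'I_n -> algC -> R) (u : 'I_n -> algC) (e : R) :
  (forall i, absval L (phi i)) ->
  (forall i j, i != j -> ~ absval_equiv L (phi i) (phi j)) ->
  (forall i, L (u i)) -> 0 < e -> exists2 x, L x & forall i, phi i (x - u i) < e.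
Proof.
move=> av neq Lu e0.
have p0 i z : L z -> 0 <= phi i z by exact: (absval_ge0 (av i)).
(* The solution is [\sum_j u j * z j] with [z j] close to 1 at [phi j] and to 0 elsewhere. [C i] is
   the factor by which the errors of the [z j] grow at [phi i], and [D] exceeds all of them. *)
pose C i := \sum_j phi i (u j); pose D := 1 + \sum_i C i.
have C0 i : 0 <= C i by apply: sumr_ge0 => j _; exact: p0.
have CD i : C i < D.
  rewrite /D (bigD1 i) //= addrCA ltrDl (lt_le_trans ltr01) // lerDl.
  by apply: sumr_ge0 => j _.
have D0 : 0 < D by rewrite (lt_le_trans ltr01) // lerDl; apply: sumr_ge0 => j _.
have /choice[z Hz] : forall j, exists z, [/\ L z, phi j (z - 1) < e / D &
    forall i, i != j -> phi i z < e / D].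
  move=> j; pose r := [seq phi i | i <- enum 'I_n & i != j].
  have rP psi : List.In psi r -> exists2 i, i != j & psi = phi i.
    move=> rI; have [i] := In_mapP rI.
    by rewrite mem_filter => /andP[ij _] ->; exists i.
  have [||x [Lx x1 xr]] := @absval_separate_seq (phi j) r; first exact: av.
    by move=> psi /rP[i ij ->]; split; [exact: av | apply: neq; rewrite eq_sym].
  have avr psi : List.In psi r -> absval L psi by move=> /rP[i _ ->].
  have [N /(_ N (leqnn _))[Lz z1 zr]] := absval_idempotent (av j) avr Lx x1 xr (divr_gt0 e0 D0).
  exists (x ^+ N / (1 + x ^+ N)); split=> // i ij; apply: zr.
  have : i \in [seq i <- enum 'I_n | i != j] by rewrite mem_filter ij mem_enum.
  rewrite /r; elim: [seq _ <- _ | _] => [//|k l IH].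
  by rewrite inE => /orP[/eqP<-|/IH]; [left|right].
have Lz j : L (z j) by have [] := Hz j.
have Luz j : L (u j * z j) by exact: subfieldM.
exists (\sum_j u j * z j); first exact: subfield_sum.
move=> i; pose w j := z j - (j == i)%:R.
have Lw j : L (w j) by apply: (subfieldB sfL) => //; exact: subfield_nat.
have -> : \sum_j u j * z j - u i = \sum_j u j * w j.
  under [RHS]eq_bigr => j _ do rewrite mulrBr; rewrite sumrB; congr (_ - _).
  rewrite (bigD1 i) //= eqxx mulr1 big1 ?addr0 // => j /negPf->; by rewrite mulr0.
have Luw j : L (u j * w j) by exact: subfieldM.
rewrite (le_lt_trans (absval_sum sfL (av i) _ Luw)) //.
apply: (@le_lt_trans _ _ (C i * (e / D))).
  rewrite mulr_suml; apply: ler_sum => j _; rewrite (absvalM (av i)) //.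
  rewrite ler_wpM2l ?p0 // /w ltW //; have [_ z1 zr] := Hz j.
  have [ji|ji] := eqVneq j i; first by rewrite -ji.
  by rewrite subr0 zr // eq_sym.
by rewrite mulrCA gtr_pMr // ltr_pdivrMr // mul1r.
Qed.

End Equivalence.

(** * Completions and local degrees *)

(** [C] is a subring given as a predicate and [N] an ideal of it, maximal by the condition on
    inverses. In this form the lemma applies directly to Cauchy sequences modulo null sequences
    inside [nat -> rat]. *)
Lemma quotient_field (A : comNzRingType) (C N : set A) :
  C 1 -> (forall u v, C u -> C v -> C (u - v)) ->
  (forall u v, C u -> C v -> C (u * v)) -> N `<=` C ->
  N 0 -> (forall u v, N u -> N v -> N (u - v)) ->
  (forall u v, C u -> N v -> N (u * v)) -> ~ N 1 ->
  (forall u, C u -> ~ N u -> exists2 v, C v & N (v * u - 1)) ->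
  exists (F : fieldType) (q : A -> F),
    [/\ forall u v, C u -> C v -> q (u + v) = q u + q v,
        forall u v, C u -> C v -> q (u * v) = q u * q v,
        forall u, C u -> (q u = 0 <-> N u) &
        forall z, exists2 u, C u & q u = z].
Proof.
move=> C1 CB CM NC N0 NB NM N1 NV.
have C0 : C 0 by apply: NC.
have CN u : C u -> C (- u) by move=> Cu; rewrite -sub0r; exact: CB.
have CD u v : C u -> C v -> C (u + v).
  by move=> Cu Cv; rewrite -[v]opprK; apply: CB => //; exact: CN.
have NN u : N u -> N (- u) by move=> Nu; rewrite -sub0r; exact: NB.
have ND u v : N u -> N v -> N (u + v).
  by move=> Nu Nv; rewrite -[v]opprK; apply: NB => //; exact: NN.
pose cl u := [set v | C v /\ N (v - u)].
pose T := {X : set A | exists2 u, C u & X = cl u}.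
pose mk u (Cu : C u) : T := exist _ (cl u) (ex_intro2 _ _ u Cu erefl).
(* The class map is made total by sending what lies outside [C] to the class of 0. *)
pose q0 u : T := if pselect (C u) is left Cu then mk u Cu else mk 0 C0.
have q0P u v : C u -> C v -> q0 u = q0 v <-> N (u - v).
  move=> Cu Cv; rewrite /q0; case: pselect => // Cu'; case: pselect => // Cv'.
  split=> [/(congr1 sval)/= e|Nuv].
    have : cl u u by split=> //; rewrite subrr.
    by rewrite e => -[].
  apply: eq_exist; rewrite /=; apply/seteqP; split=> w [Cw Nw]; split=> //.
    by have := ND _ _ Nw Nuv; rewrite addrA subrK.
  by have := NB _ _ Nw Nuv; rewrite opprB addrA subrK.
have /choice[rep repP] : forall z : T, exists u, C u /\ q0 u = z.
  move=> [X [u Cu eX]]; exists u; split=> //; rewrite /q0; case: pselect => // Cu'.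
  by apply: eq_exist; rewrite eX.
have repC z : C (rep z) by have [] := repP z.
have repK z : q0 (rep z) = z by have [] := repP z.
have repN u : C u -> N (rep (q0 u) - u).
  by move=> Cu; apply/q0P => //; exact: repK.
pose add x y := q0 (rep x + rep y).
pose opp x := q0 (- rep x).
pose mul x y := q0 (rep x * rep y).
have addE u v : C u -> C v -> add (q0 u) (q0 v) = q0 (u + v).
  move=> Cu Cv; apply/q0P; [exact: CD|exact: CD|].
  by rewrite opprD addrACA; apply: ND; exact: repN.
have oppE u : C u -> opp (q0 u) = q0 (- u).
  move=> Cu; apply/q0P; [exact: CN|exact: CN|].
  by rewrite -opprD; apply: NN; exact: repN.
have mulE u v : C u -> C v -> mul (q0 u) (q0 v) = q0 (u * v).
  move=> Cu Cv; apply/q0P; [exact: CM|exact: CM|].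
  have -> : rep (q0 u) * rep (q0 v) - u * v =
      rep (q0 v) * (rep (q0 u) - u) + u * (rep (q0 v) - v) by ring.
  by apply: ND; apply: NM => //; exact: repN.
have elimT (P : T -> Prop) : (forall u, C u -> P (q0 u)) -> forall z, P z.
  by move=> H z; rewrite -(repK z); exact: H.
have addA : associative add.
  elim/elimT => u Cu; elim/elimT => v Cv; elim/elimT => w Cw.
  have Cuv := CD _ _ Cu Cv; have Cvw := CD _ _ Cv Cw.
  by rewrite !addE // addrA.
have addC : commutative add.
  by elim/elimT => u Cu; elim/elimT => v Cv; rewrite !addE // addrC.
have add0 : left_id (q0 0) add.
  by elim/elimT => u Cu; rewrite !addE // add0r.
have addN : left_inverse (q0 0) opp add.
  by elim/elimT => u Cu; have Cu' := CN _ Cu; rewrite oppE // addE // addNr.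
have mulA : associative mul.
  elim/elimT => u Cu; elim/elimT => v Cv; elim/elimT => w Cw.
  have Cuv := CM _ _ Cu Cv; have Cvw := CM _ _ Cv Cw.
  by rewrite !mulE // mulrA.
have mulC : commutative mul.
  by elim/elimT => u Cu; elim/elimT => v Cv; rewrite !mulE // mulrC.
have mul1 : left_id (q0 1) mul.
  by elim/elimT => u Cu; rewrite !mulE // mul1r.
have mulD : left_distributive mul add.
  elim/elimT => u Cu; elim/elimT => v Cv; elim/elimT => w Cw.
  have Cuv := CD _ _ Cu Cv; have Cuw := CM _ _ Cu Cw; have Cvw := CM _ _ Cv Cw.
  by rewrite addE // !mulE // addE // mulrDl.
have neq10 : q0 1 <> q0 0 by move/q0P; rewrite subr0 => H; apply: N1; exact: H.
pose Tc : choiceType := HB.pack T (gen_eqMixin T) (gen_choiceMixin T).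
pose Z : zmodType := HB.pack (Choice.sort Tc)
  (@GRing.isZmodule.Build Tc (q0 0) opp add addA addC add0 addN).
have neq10' : (q0 1 : Z) != (0 : Z) by apply/eqP.
pose Rg : comNzRingType := HB.pack (GRing.Zmodule.sort Z)
  (@GRing.Zmodule_isComNzRing.Build Z (q0 1) mul mulA mulC mul1 mulD neq10').
have /choice[iv ivP] : forall z : Rg, exists w : Rg,
    if z == 0 then w = 0 else w * z = 1.
  elim/elimT => u Cu; case: eqP => [_|nz]; first by exists 0.
  have nNu : ~ N u.
    by move=> Nu; apply: nz; apply/q0P; rewrite ?subr0.
  have [v Cv Nv] := NV _ Cu nNu; exists (q0 v : Rg).
  transitivity (mul (q0 v) (q0 u)); first by [].
  by rewrite mulE //; apply/q0P => //; exact: CM.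
have ivM (z : Rg) : z != 0 -> iv z * z = 1.
  by move=> z0; have := ivP z; rewrite (negPf z0).
have iv0 : iv (0 : Rg) = 0 by have := ivP 0; rewrite eqxx.
pose F : fieldType := HB.pack (GRing.ComNzRing.sort Rg)
  (@GRing.ComNzRing_isField.Build Rg iv ivM iv0).
exists F, (q0 : A -> F); split.
- by move=> u v Cu Cv; rewrite -addE.
- by move=> u v Cu Cv; rewrite -mulE.
- by move=> u Cu; rewrite -{2}(subr0 u); exact: q0P.
- by move=> z; exists (rep z).
Qed.

Section Sequences.
Variables (R : realType) (L : set algC) (sfL : subfield L) (phi : algC -> R).
Hypothesis av : absval L phi.
Implicit Types u v : nat -> algC.

Lemma null_cauchy u : (forall k, L (u k)) -> null phi u -> cauchy L phi u.
Proof.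
move=> Lu nu; split=> // e e0; have e20 : 0 < e / 2 by rewrite divr_gt0.
have [N HN] := nu _ e20; exists N => m n mN nN.
rewrite (le_lt_trans (absvalB sfL av (Lu _) (Lu _))) //.
by have := HN _ mN; have := HN _ nN; lra.
Qed.

Lemma nullD u v : (forall k, L (u k)) -> (forall k, L (v k)) ->
  null phi u -> null phi v -> null phi (fun k => u k + v k).
Proof.
move=> Lu Lv nu nv e e0; have e20 : 0 < e / 2 by rewrite divr_gt0.
have [N HN] := nu _ e20; have [M HM] := nv _ e20.
exists (maxn N M) => n; rewrite geq_max => /andP[/HN hu /HM hv].
by rewrite (le_lt_trans (absvalD av (Lu _) (Lv _))) //; lra.
Qed.

Lemma nullN u : (forall k, L (u k)) -> null phi u -> null phi (fun k => - u k).
Proof.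
move=> Lu nu e e0; have [N HN] := nu _ e0; exists N => n /HN.
by rewrite (absvalN sfL av).
Qed.

Lemma nullB u v : (forall k, L (u k)) -> (forall k, L (v k)) ->
  null phi u -> null phi v -> null phi (fun k => u k - v k).
Proof.
move=> Lu Lv nu nv; apply: nullD => //; last exact: nullN.
by move=> k; exact: subfieldN.
Qed.

Lemma null0 : null phi (fun=> 0).
Proof. by move=> e e0; exists 0%N => n _; rewrite (absval0 sfL av). Qed.

Lemma null_sum (I : Type) (r : seq I) (P : pred I) (u : I -> nat -> algC) :
  (forall i k, L (u i k)) -> (forall i, P i -> null phi (u i)) ->
  null phi (fun k => \sum_(i <- r | P i) u i k).
Proof.
move=> Lu nu; elim: r => [|i r IH].
  by under eq_fun do rewrite big_nil; exact: null0.
have LS k : L (\sum_(j <- r | P j) u j k) by exact: subfield_sum.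
under eq_fun do rewrite big_cons; case Pi : (P i) => //.
by apply: nullD => //; exact: nu.
Qed.

Lemma cauchy_in u k : cauchy L phi u -> L (u k). Proof. by case. Qed.

Lemma cauchy_bounded u : cauchy L phi u -> exists2 B : R, 0 < B & forall k, phi (u k) <= B.
Proof.
move=> [Lu cu]; have [N HN] := cu 1 ltr01.
have p0 k : 0 <= phi (u k) by exact: (absval_ge0 av).
exists (1 + \sum_(k < N.+1) phi (u k)).
  by rewrite ltr_wpDr // sumr_ge0.
move=> k; have [kN|Nk] := leqP k N.
  rewrite (bigD1 (Ordinal (kN : (k < N.+1)%N))) //= addrCA lerDl.
  by rewrite addr_ge0 // sumr_ge0.
have := HN k N (ltnW Nk) (leqnn _) => h.
have := absvalD av (subfieldB sfL (Lu k) (Lu N)) (Lu N); rewrite subrK => h2.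
rewrite big_ord_recr /= addrA (le_trans h2) // lerD2r (le_trans (ltW h)) //.
by rewrite lerDl sumr_ge0.
Qed.

Lemma cauchyD u v : cauchy L phi u -> cauchy L phi v -> cauchy L phi (fun k => u k + v k).
Proof.
move=> [Lu cu] [Lv cv]; split=> [k|e e0]; first exact: subfieldD.
have e20 : 0 < e / 2 by rewrite divr_gt0.
have [N HN] := cu _ e20; have [M HM] := cv _ e20.
exists (maxn N M) => m n; rewrite !geq_max => /andP[mN mM] /andP[nN nM].
have := HN _ _ mN nN; have := HM _ _ mM nM => h1 h2.
rewrite opprD addrACA (le_lt_trans (absvalD av _ _)) //; try exact: subfieldB.
lra.
Qed.

Lemma cauchyN u : cauchy L phi u -> cauchy L phi (fun k => - u k).
Proof.
move=> [Lu cu]; split=> [k|e e0]; first exact: subfieldN.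
have [N HN] := cu _ e0; exists N => m n mN nN.
by rewrite -opprD (absvalN sfL av) ?HN //; exact: subfieldB.
Qed.

Lemma cauchyB u v : cauchy L phi u -> cauchy L phi v -> cauchy L phi (fun k => u k - v k).
Proof. by move=> cu cv; apply: cauchyD => //; exact: cauchyN. Qed.

Lemma cauchyM u v : cauchy L phi u -> cauchy L phi v -> cauchy L phi (fun k => u k * v k).
Proof.
move=> cu cv; have [B B0 HB] := cauchy_bounded cu; have [D D0 HD] := cauchy_bounded cv.
case: cu cv => Lu cu [Lv cv]; split=> [k|e e0]; first exact: subfieldM.
have BD : 0 < B + D by exact: addr_gt0.
have e20 : 0 < e / (B + D) by rewrite divr_gt0.
have [N HN] := cu _ e20; have [M HM] := cv _ e20.
exists (maxn N M) => m n; rewrite !geq_max => /andP[mN mM] /andP[nN nM].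
have := HN _ _ mN nN; have := HM _ _ mM nM => h1 h2.
have Luu := subfieldB sfL (Lu m) (Lu n); have Lvv := subfieldB sfL (Lv m) (Lv n).
have -> : u m * v m - u n * v n = (u m - u n) * v m + u n * (v m - v n) by ring.
rewrite (le_lt_trans (absvalD av _ _)) //; try exact: subfieldM.
rewrite !(absvalM av) //.
apply: (@le_lt_trans _ _ (phi (u m - u n) * D + B * phi (v m - v n))).
  by apply: lerD; [rewrite ler_wpM2l ?(absval_ge0 av) |
                   rewrite ler_wpM2r ?(absval_ge0 av)].
have -> : e = e / (B + D) * D + B * (e / (B + D)).
  by field; rewrite gt_eqF.
by apply: ltrD; rewrite ?ltr_pM2r ?ltr_pM2l.
Qed.

Lemma cauchy_cst x : L x -> cauchy L phi (fun=> x).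
Proof.
move=> Lx; split=> // e e0; exists 0%N => m n _ _.
by rewrite subrr (absval0 sfL av).
Qed.

Lemma cauchy_sum (I : Type) (r : seq I) (u : I -> nat -> algC) :
  (forall i, cauchy L phi (u i)) -> cauchy L phi (fun k => \sum_(i <- r) u i k).
Proof.
move=> cu; elim: r => [|i r IH].
  by under eq_fun do rewrite big_nil; apply: cauchy_cst; exact: subfield0.
by under eq_fun do rewrite big_cons; exact: cauchyD.
Qed.

Lemma nullM u v : cauchy L phi u -> (forall k, L (v k)) -> null phi v ->
  null phi (fun k => u k * v k).
Proof.
move=> cu Lv nv e e0; have [B B0 HB] := cauchy_bounded cu.
have [N HN] := nv _ (divr_gt0 e0 B0); exists N => n /HN.
rewrite ltr_pdivlMr // => h; rewrite (absvalM av) //; last exact: cauchy_in.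
by rewrite (le_lt_trans _ h) // mulrC ler_wpM2l ?(absval_ge0 av).
Qed.

(** A Cauchy sequence that is not null is bounded away from 0 from some index on; earlier terms may
    vanish, and there the inverse is 0 by convention. *)
Lemma cauchy_inv u : cauchy L phi u -> ~ null phi u ->
  cauchy L phi (fun k => (u k)^-1) /\ null phi (fun k => (u k)^-1 * u k - 1).
Proof.
move=> [Lu cu] nu.
have [c c0 [N HN]] : exists2 c : R, 0 < c & exists N, forall n, (N <= n)%N -> c <= phi (u n).
  have /existsNP[e /not_implyP[e0 H]] := nu.
  have e20 : 0 < e / 2 by rewrite divr_gt0.
  have [N HN] := cu _ e20; exists (e / 2) => //; exists N => n nN.
  have /forallNP/(_ N)/existsNP[m /not_implyP[mN /negP]] := H; rewrite -leNgt => em.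
  have := HN _ _ mN nN.
  have := absvalD av (subfieldB sfL (Lu m) (Lu n)) (Lu n); rewrite subrK; lra.
have u0 n : (N <= n)%N -> u n != 0.
  move=> /HN; apply: contraTneq => ->; by rewrite (absval0 sfL av) -ltNge.
split; last first.
  move=> e e0; exists N => n /u0 un0; by rewrite mulVf // subrr (absval0 sfL av).
split=> [k|e e0]; first exact: subfieldV.
have ec : 0 < e * c * c by rewrite !mulr_gt0.
have [M HM] := cu _ ec.
exists (maxn N M) => m n; rewrite !geq_max => /andP[mN mM] /andP[nN nM].
have um0 := u0 _ mN; have un0 := u0 _ nN.
have -> : (u m)^-1 - (u n)^-1 = - ((u m - u n) / (u m * u n)) by field; rewrite um0 un0.
have Ld := subfieldB sfL (Lu m) (Lu n); have Lp := subfieldM sfL (Lu m) (Lu n).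
have Lq := subfieldM sfL Ld (subfieldV sfL Lp).
rewrite (absvalN sfL av) // (absvalM av) //; last exact: subfieldV.
rewrite (absvalV sfL av) // ltr_pdivrMr ?(absval_gt0 av) ?mulf_neq0 //.
rewrite (lt_le_trans (HM _ _ mM nM)) // (absvalM av) // -mulrA ler_wpM2l ?(ltW e0) //.
by rewrite ler_pM ?HN ?(ltW c0).
Qed.

End Sequences.

Section LocalCoordinates.
Variables (R : realType) (psi : algC -> R) (avQ : absval Qset psi).
Let sfQ := number_field_subfield number_field_Q.

Definition qcauchy (a : nat -> rat) := cauchy Qset psi (fun k => ratr (a k)).

(** [q] is the limit map onto the completion [F] of the rationals; nothing is required of it outside
    Cauchy sequences. *)
Definition is_completion (F : fieldType) (q : (nat -> rat) -> F) :=
  [/\ forall a b, qcauchy a -> qcauchy b -> q (fun k => a k + b k) = q a + q b,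
      forall a b, qcauchy a -> qcauchy b -> q (fun k => a k * b k) = q a * q b,
      forall a, qcauchy a -> (q a = 0 <-> null psi (fun k => ratr (a k))) &
      forall z, exists2 a, qcauchy a & q a = z].

Lemma completion_exists : exists (F : fieldType) (q : (nat -> rat) -> F), is_completion q.
Proof.
have Qr (x : rat) : Qset (ratr x) by exists x.
have [||||||||| F [q [qD qM q0 qs]]] := @quotient_field (nat -> rat)
  qcauchy [set a | qcauchy a /\ null psi (fun k => ratr (a k))].
- rewrite /qcauchy (_ : (fun k => _) = (fun=> 1)).
    exact: (cauchy_cst sfQ avQ (subfield1 sfQ)).
  by apply/funext => k; exact: rmorph1.
- move=> a b ca cb; rewrite /qcauchy.
  rewrite (_ : (fun k => _) = (fun k => ratr (a k) - ratr (b k))).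
    exact: cauchyB.
  by apply/funext => k; rewrite -rmorphB.
- move=> a b ca cb; rewrite /qcauchy.
  rewrite (_ : (fun k => _) = (fun k => ratr (a k) * ratr (b k))).
    exact: cauchyM.
  by apply/funext => k; rewrite -rmorphM.
- by move=> a [].
- have nul0 : null psi (fun k => ratr ((0 : nat -> rat) k)).
    rewrite (_ : (fun k => _) = (fun=> 0)); first exact: (null0 sfQ avQ).
    by apply/funext => k; exact: rmorph0.
  by split=> //; apply: null_cauchy.
- move=> a b [ca na] [cb nb].
  have e : (fun k => ratr ((a - b) k)) = (fun k => ratr (a k) - ratr (b k) : algC).
    by apply/funext => k; rewrite -rmorphB.
  by split; rewrite /qcauchy /= e; [exact: cauchyB | exact: (nullB sfQ avQ)].
- move=> a b ca [cb nb].
  have e : (fun k => ratr ((a * b) k)) = (fun k => ratr (a k) * ratr (b k) : algC).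
    by apply/funext => k; rewrite -rmorphM.
  by split; rewrite /qcauchy /= e; [exact: cauchyM | exact: (nullM sfQ avQ)].
- move=> [_ /(_ 1 ltr01)[N /(_ N (leqnn _))]].
  by rewrite (_ : ratr _ = 1) ?(absval1 sfQ avQ) ?ltxx //; exact: rmorph1.
- move=> a ca /not_andP[//|na]; have [civ niv] := cauchy_inv sfQ avQ ca na.
  exists (fun k => (a k)^-1).
    by rewrite /qcauchy; under eq_fun do rewrite fmorphV.
  have e : (fun k => ratr (((fun k => (a k)^-1) * a - 1 : nat -> rat) k)) =
      (fun k => (ratr (a k))^-1 * ratr (a k) - 1 : algC).
    apply/funext => k; transitivity (ratr ((a k)^-1 * a k - 1) : algC); first by [].
    by rewrite rmorphB rmorphM fmorphV rmorph1.
  split; rewrite /qcauchy /= e //; apply: cauchyB => //; first exact: cauchyM.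
  by apply: cauchy_cst => //; exists 1 => //; rewrite rmorph1.
exists F, q; split.
- exact: qD.
- exact: qM.
- by move=> a ca; rewrite (q0 a ca); split=> [[]|].
- exact: qs.
Qed.

Variables (F : fieldType) (q : (nat -> rat) -> F) (qP : is_completion q).

(** An isomorphism of the completion of [K] with [F ^ d], expressed on Cauchy sequences so that this
    completion itself need not be constructed. *)
Definition local_coord (K : set algC) (phi : algC -> R) d
    (c : (nat -> algC) -> 'rV[F]_d) :=
  [/\ forall u v, cauchy K phi u -> cauchy K phi v ->
        c (fun k => u k + v k) = c u + c v,
      forall a u, qcauchy a -> cauchy K phi u ->
        c (fun k => ratr (a k) * u k) = q a *: c u,
      forall u, cauchy K phi u -> (c u = 0 <-> null phi u) &
      forall z, exists2 u, cauchy K phi u & c u = z].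

Lemma local_coord_Q : exists c, @local_coord Qset psi 1 c.
Proof.
have /choice[g gP] : forall x : algC, exists a : rat, Qset x -> ratr a = x.
  move=> x; have [[a _ <-]|nQ] := pselect (Qset x); last by exists 0.
  by exists a.
have gK a : g (ratr a) = a.
  by apply: (fmorph_inj (ratr : rat -> algC)); apply: gP; exists a.
have gE u : cauchy Qset psi u -> u = (fun k => ratr (g (u k))).
  by move=> [Qu _]; apply/funext => k; rewrite gP.
have [qD qM q0 qs] := qP.
exists (fun u => const_mx (q (fun k => g (u k)))); split.
- move=> u v cu cv; rewrite -raddfD /= -qD; last first.
  + by rewrite /qcauchy -(gE _ cv).
  + by rewrite /qcauchy -(gE _ cu).
  congr (const_mx (q _)); apply/funext => k.
  by rewrite {1}(gE _ cu) {1}(gE _ cv) -rmorphD gK.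
- move=> a u ca cu; rewrite scalemx_const -qM //; last first.
    by rewrite /qcauchy -(gE _ cu).
  by congr (const_mx (q _)); apply/funext => k; rewrite {1}(gE _ cu) -rmorphM gK.
- move=> u cu; have cgu : qcauchy (fun k => g (u k)) by rewrite /qcauchy -(gE _ cu).
  have := q0 _ cgu; rewrite -(gE _ cu) => <-; split=> [/rowP/(_ ord0)|->].
    by rewrite !mxE.
  by apply/rowP => i; rewrite !mxE.
move=> z; have [a ca qa] := qs (z ord0 ord0); exists (fun k => ratr (a k)) => //.
by apply/rowP => i; rewrite mxE ord1 -qa; congr q; apply/funext => k; rewrite gK.
Qed.

Section LocalDegree.
Variables (K : set algC) (phi : algC -> R) (d : nat) (c : (nat -> algC) -> 'rV[F]_d).
Hypotheses (sfK : subfield K) (av : absval K phi) (cP : local_coord K phi c).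
Hypothesis phiQ : forall x, Qset x -> phi x = psi x.

Lemma qcauchy_cauchy a : qcauchy a <-> cauchy Qset phi (fun k => ratr (a k)).
Proof.
have e m n : phi (ratr (a m) - ratr (a n)) = psi (ratr (a m) - ratr (a n)).
  by rewrite phiQ // -rmorphB; exists (a m - a n).
by split=> -[Qa H]; split=> // e' e0; have [N HN] := H e' e0;
  exists N => m n mN nN; [rewrite e | rewrite -e]; exact: HN.
Qed.

Lemma qcauchy_cauchyK a : qcauchy a -> cauchy K phi (fun k => ratr (a k)).
Proof.
move=> /qcauchy_cauchy[Qa H]; split=> // k; exact: subfield_rat.
Qed.

Lemma qnull_null a : null psi (fun k => ratr (a k)) <-> null phi (fun k => ratr (a k)).
Proof.
have e m : phi (ratr (a m)) = psi (ratr (a m)) by rewrite phiQ //; exists (a m).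
by split=> H e' e0; have [N HN] := H e' e0; exists N => m mN;
  [rewrite e | rewrite -e]; exact: HN.
Qed.

Lemma local_coord0 : c (fun=> 0) = 0.
Proof.
have [_ _ c0 _] := cP; apply/c0; last exact: (null0 sfK av).
by apply: cauchy_cst => //; exact: subfield0.
Qed.

Lemma local_coord_sum (I : Type) (r : seq I) (a : I -> nat -> rat) (x : I -> nat -> algC) :
  (forall i, qcauchy (a i)) -> (forall i, cauchy K phi (x i)) ->
  c (fun k => \sum_(i <- r) ratr (a i k) * x i k) = \sum_(i <- r) q (a i) *: c (x i).
Proof.
have [cD cZ _ _] := cP; move=> ca cx.
have cax i : cauchy K phi (fun k => ratr (a i k) * x i k).
  by apply: cauchyM => //; exact: qcauchy_cauchyK.
elim: r => [|i r IH].
  by under eq_fun do rewrite big_nil; rewrite big_nil local_coord0.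
under eq_fun do rewrite big_cons; rewrite big_cons -IH cD ?cZ //.
exact: cauchy_sum.
Qed.

(** Coefficients in [F] lift along [q] to rational Cauchy sequences, so relations modulo null
    sequences are exactly relations between rows. *)
Lemma local_indep_row_free n (x : 'I_n -> nat -> algC) :
  local_indep K phi x <->
  (forall i, cauchy K phi (x i)) /\ row_free (\matrix_(i < n) c (x i)).
Proof.
have [_ _ c0 _] := cP; have [_ _ q0 qs] := qP.
split=> [] [cx H]; split=> //.
  rewrite -kermx_eq0; apply/rowV0P => w /sub_kermxP w0; apply/rowP => i; rewrite mxE.
  have /choice[a aP] : forall j, exists a, qcauchy a /\ q a = w ord0 j.
    by move=> j; have [a ca qa] := qs (w ord0 j); exists a.
  have ca j : qcauchy (a j) by have [] := aP j.
  have [_ <-] := aP i; apply/q0 => //; apply/qnull_null.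
  apply: H; first by move=> j; apply/qcauchy_cauchy.
  apply/c0; first by apply: cauchy_sum => // j; apply: cauchyM => //; exact: qcauchy_cauchyK.
  rewrite local_coord_sum // -[RHS]w0 mulmx_sum_row.
  by apply: eq_bigr => j _; have [_ ->] := aP j; rewrite rowK.
move=> a ca' na i; have ca j : qcauchy (a j) by apply/qcauchy_cauchy.
apply/qnull_null/q0 => //.
pose w := \row_j q (a j); suff : w = 0 by move/rowP/(_ i); rewrite !mxE.
apply: (row_free_inj H); rewrite mul0mx mulmx_sum_row.
under eq_bigr => j _ do rewrite rowK mxE.
rewrite -local_coord_sum //; apply/c0 => //.
by apply: cauchy_sum => // j; apply: cauchyM => //; exact: qcauchy_cauchyK.
Qed.

End LocalDegree.
End LocalCoordinates.

Section EquivSequences.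
Variables (R : realType) (K : set algC) (sfK : subfield K) (phi chi : algC -> R).
Hypotheses (av : absval K phi) (eqv : absval_equiv K phi chi).

Lemma powR_lt (x e t : R) : 0 <= x -> 0 < e -> 0 < t -> x < e `^ t^-1 -> x `^ t < e.
Proof.
move=> x0 e0 t0 h; rewrite (lt_le_trans (gt0_ltr_powR t0 _ _ h)) ?nnegrE ?powR_ge0 //.
by rewrite -powRrM mulVf ?gt_eqF // powRr1 // ltW.
Qed.

Lemma equiv_null u : (forall k, K (u k)) -> null phi u -> null chi u.
Proof.
case: eqv => t [t0 H] Ku nu e e0; have [N HN] := nu _ (powR_gt0 t^-1 e0).
exists N => n /HN h; rewrite H //; apply: powR_lt => //; exact: (absval_ge0 av).
Qed.

Lemma equiv_cauchy u : cauchy K phi u -> cauchy K chi u.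
Proof.
case: eqv => t [t0 H] [Ku cu]; split=> // e e0.
have [N HN] := cu _ (powR_gt0 t^-1 e0).
exists N => m n mN nN; have Kuu := subfieldB sfK (Ku m) (Ku n).
by rewrite H //; apply: powR_lt => //; [exact: (absval_ge0 av) | exact: HN].
Qed.

End EquivSequences.

Section LocalDegreeEq.
Variables (R : realType) (K : set algC) (sfK : subfield K).

Lemma cauchy_Qset (phi : algC -> R) (a : nat -> rat) :
  cauchy Qset phi (fun k => ratr (a k)) <-> cauchy K phi (fun k => ratr (a k)).
Proof.
split=> -[Ha cu]; split=> // k; first exact: subfield_rat.
by exists (a k).
Qed.

Lemma local_indep_equiv (phi chi : algC -> R) n (x : 'I_n -> nat -> algC) :
  absval K phi -> absval K chi -> absval_equiv K phi chi ->
  local_indep K phi x -> local_indep K chi x.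
Proof.
move=> av bv eqv [cx H]; split=> [i|a ca na i]; first exact: (equiv_cauchy sfK av eqv).
have eqv' := absval_equiv_sym av eqv.
have Kr k : K (ratr (a i k)) by exact: subfield_rat.
apply: (equiv_null av eqv) => //; apply: H.
  by move=> j; apply/cauchy_Qset/(equiv_cauchy sfK bv eqv')/cauchy_Qset.
apply: (equiv_null bv eqv') => // k; apply: (subfield_sum sfK) => j _.
by apply: (subfieldM sfK); [exact: subfield_rat | exact: cauchy_in (cx j)].
Qed.

Variables (psi : algC -> R) (avQ : absval Qset psi).
Variables (F : fieldType) (q : (nat -> rat) -> F) (qP : is_completion psi q).

Lemma local_degreeP (phi : algC -> R) d (c : (nat -> algC) -> 'rV[F]_d) :
  absval K phi -> (forall x, Qset x -> phi x = psi x) -> local_coord psi q K phi c ->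
  local_degree K [set chi | absval K chi /\ absval_equiv K phi chi] = d.
Proof.
move=> av phiQ cP; have [_ _ _ cs] := cP.
have RF n (x : 'I_n -> nat -> algC) := local_indep_row_free qP sfK av cP phiQ x.
(* Independent families of every size up to [d] are needed: a value [n] of the local degree excludes
   size [n.+1] only, and this has to contradict [n < d]. *)
have exd n : (n <= d)%N -> exists x : 'I_n -> nat -> algC, local_indep K phi x.
  move=> nd; have /choice[x xP] : forall i : 'I_n, exists u, cauchy K phi u /\
      c u = row i (pid_mx n : 'M[F]_(n, d)).
    by move=> i; have [u] := cs (row i (pid_mx n : 'M[F]_(n, d))); exists u.
  exists x; apply/RF; split=> [i|]; first by have [] := xP i.
  rewrite (_ : \matrix_i _ = pid_mx n) ?/row_free ?rank_pid_mx //.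
  by apply/row_matrixP => i; rewrite rowK; have [] := xP i.
have led n (x : 'I_n -> nat -> algC) : local_indep K phi x -> (n <= d)%N.
  by move=> /RF[_]; rewrite /row_free => /eqP <-; exact: rank_leq_col.
apply: xget_unique.
  exists phi; split; first by split=> //; exact: absval_equiv_refl.
  by split; [exact: exd | move=> [x /led]; rewrite ltnn].
move=> n [chi [[bv eqv] [[x ix] nx]]].
have eqv' := absval_equiv_sym av eqv.
apply/eqP; rewrite eqn_leq (led _ _ (local_indep_equiv bv av eqv' ix)) /= leqNgt.
apply/negP => /exd[y iy]; apply: nx; exists y.
exact: (local_indep_equiv av bv eqv iy).
Qed.

End LocalDegreeEq.

(** * Direct decompositions of a space of row vectors *)

Section DirectSplit.
Variable F : fieldType.

(** A matrix of maximal rank among those with rows in [E] spans [E]: a vector of [E] outside its row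
    space could be adjoined. *)
Lemma subspace_basis N (E : set 'rV[F]_N) : E 0 ->
  (forall a u v, E u -> E v -> E (a *: u + v)) ->
  exists d (B : 'M[F]_(d, N)), row_free B /\ forall w, E w <-> (w <= B)%MS.
Proof.
move=> E0 EL.
have Esum n (B : 'M[F]_(n, N)) w : (forall i, E (row i B)) -> E (w *m B).
  move=> EB; rewrite mulmx_sum_row; apply: (big_ind E) => //.
    by move=> u v Eu Ev; rewrite -[u]scale1r; exact: EL.
  by move=> i _; rewrite -[_ *: _]addr0; exact: EL.
pose P k := `[< exists B : 'M[F]_N, (forall i, E (row i B)) /\ \rank B = k >].
have exP : exists k, P k.
  exists (\rank (0 : 'M[F]_N)); apply/asboolP; exists 0; split=> // i.
  by rewrite row0.
have ubP k : P k -> (k <= N)%N.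
  by move=> /asboolP[B [_ <-]]; exact: rank_leq_col.
case: (ex_maxnP exP ubP) => k /asboolP[B [EB <-]] maxk.
exists (\rank B), (row_base B); split; first exact: row_base_free.
move=> w; rewrite eq_row_base; split=> [Ew|/submxP[z ->]]; last exact: Esum.
apply: contraT => wB; suff /maxk : P (\rank (B + w)%MS).
  have /ltn_leqif := mxrank_leqif_sup (addsmxSl B w).
  by rewrite addsmx_sub submx_refl /= wB ltnNge => /negPf->.
apply/asboolP; exists (B + w)%MS; split=> // i.
have /sub_addsmxP[[u v] ->] := row_sub i (B + w)%MS.
rewrite -[u *m B]scale1r; apply: EL; first exact: Esum.
by apply: Esum => j; rewrite ord1 row_id.
Qed.

Lemma direct_split N r (E : 'I_r -> set 'rV[F]_N) :
  (forall i, E i 0) -> (forall i a u v, E i u -> E i v -> E i (a *: u + v)) ->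
  (forall z, exists2 u : 'I_r -> 'rV[F]_N, (forall i, E i (u i)) & z = \sum_i u i) ->
  (forall u : 'I_r -> 'rV[F]_N, (forall i, E i (u i)) -> \sum_i u i = 0 ->
     forall i, u i = 0) ->
  exists (d : 'I_r -> nat) (B : forall i, 'M[F]_(d i, N)),
    [/\ forall i, row_free (B i), forall i w, E i w <-> (w <= B i)%MS &
        (\sum_i d i)%N = N].
Proof.
move=> E0 EL Espan Eind.
have H i : exists d : {d : nat & 'M[F]_(d, N)}, row_free (projT2 d) /\
    forall w, E i w <-> (w <= projT2 d)%MS.
  by have [d [B BP]] := subspace_basis (E0 i) (EL i); exists (existT _ d B).
have [D DP] := choice H.
exists (fun i => projT1 (D i)), (fun i => projT2 (D i)); split=> [i|i|].
- by have [] := DP i.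
- by have [] := DP i.
pose A i := <<projT2 (D i)>>%MS.
have EA i w : E i w <-> (w <= A i)%MS by rewrite genmxE; have [_] := DP i.
have /mxdirectP/= dA : mxdirect (\sum_i A i).
  apply/mxdirect_sumsP => i _; apply/eqP/rowV0P => w; rewrite sub_capmx.
  move=> /andP[wi /sub_sumsmxP[u Dw]].
  (* A vector common to [A i] and to the sum of the other spaces is rewritten as a family in the
     [E j] with sum 0. *)
  pose v j := if j == i then w else - (u j *m A j).
  have Ev j : E j (v j).
    rewrite /v; case: eqP => [->|_]; apply/EA => //.
    by rewrite eqmx_opp submxMl.
  have := Eind v Ev; rewrite (bigD1 i) //= /v eqxx.
  rewrite (eq_bigr (fun j => - (u j *m A j))) => [|j /negPf->//].
  by rewrite sumrN Dw subrr => /(_ erefl i); rewrite eqxx.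
have rN : \rank (\sum_i A i)%MS = N.
  apply/eqP; rewrite -[_ == N]/(row_full _); apply/row_fullP.
  have /submxP[z Dz] : ((1%:M : 'M[F]_N) <= \sum_i A i)%MS.
    apply/row_subP => k; have [u Eu ->] := Espan (row k 1%:M).
    by apply: summx_sub_sums => i _; apply/EA.
  by exists z.
apply: (etrans _ rN); rewrite dA; apply: eq_bigr => i _; rewrite mxrank_gen.
by have [/eqP->] := DP i.
Qed.

End DirectSplit.

(** * Places above a given place *)

Lemma absval_between (R : realType) (A B C : set algC) (phi : algC -> R) :
  A `<=` B -> B `<=` C -> absval A phi -> absval C phi -> absval B phi.
Proof.
move=> AB BC av [C0 [C1 [C2 [C3 _]]]].
split; first by move=> x Bx; exact/C0/BC.
split; first by move=> x Bx; exact/C1/BC.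
split; first by move=> x y Bx By; apply: C2; exact: BC.
split; first by move=> x y Bx By; apply: C3; exact: BC.
by have [x [Ax x0 x1]] := absval_nontrivial av; exists x; split=> //; exact: AB.
Qed.

Lemma absval_ext (R : realType) (K : set algC) (phi chi : algC -> R) :
  subfield K -> (forall x, K x -> chi x = phi x) -> absval K phi -> absval K chi.
Proof.
move=> sfK e [K0 [K1 [K2 [K3 [y [Ky [y0 y1]]]]]]].
split; first by move=> z Kz; rewrite e // K0.
split; first by move=> z Kz; rewrite e // K1.
split; first by move=> z w Kz Kw; rewrite !e ?K2 //; exact: subfieldM.
split; first by move=> z w Kz Kw; rewrite !e ?K3 //; exact: subfieldD.
by exists y; rewrite e.
Qed.

(** Serves to list, without repetition, the restrictions to [L] of the conjugates of [psi]. *)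
Lemma class_representatives (T : Type) (E : T -> T -> Prop) (t0 : T) (s : seq T) :
  (forall t, E t t) -> (forall t u, E t u -> E u t) ->
  exists r (g : 'I_r -> T), [/\ forall i, List.In (g i) s,
    forall i j, i != j -> ~ E (g i) (g j) & forall t, List.In t s -> exists i, E (g i) t].
Proof.
move=> Er Es.
suff [r [g [g1 g2 g3]]] : exists r (g : nat -> T), [/\ forall i, (i < r)%N -> List.In (g i) s,
    forall i j, (i < r)%N -> (j < r)%N -> i != j -> ~ E (g i) (g j) &
    forall t, List.In t s -> exists2 i, (i < r)%N & E (g i) t].
  exists r, (fun i : 'I_r => g i); split=> [i|i j ij|t /g3[i ir Ei]]; first exact: g1.
    by apply: g2.
  by exists (Ordinal ir).
elim: s => [|t s [r [g [g1 g2 g3]]]]; first by exists 0%N, (fun=> t0); split.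
have [[i ir Ei]|nE] := pselect (exists2 i, (i < r)%N & E (g i) t).
  exists r, g; split=> // [j jr|u [<-|/g3//]]; first by right; exact: g1.
  by exists i.
exists r.+1, (fun i => if i == r then t else g i); split=> [i|i j|u].
- by rewrite ltnS leq_eqVlt; case: eqP => [_ _|_ /= /g1]; [left | right].
- rewrite !ltnS (leq_eqVlt i) (leq_eqVlt j).
  case: eqVneq => [->|ir] /=; case: eqVneq => [->|jr] //=.
  + by move=> _ jr' _ /Es H; apply: nE; exists j.
  + by move=> ir' _ _ H; apply: nE; exists i.
  + exact: g2.
- move=> [<-|/g3[i ir Ei]]; first by exists r; rewrite ?eqxx.
  by exists i; rewrite ?ltn_eqF // ltnW.
Qed.

Lemma powR_fixed (R : realType) (x t : R) : 0 < x -> x < 1 -> x `^ t = x -> t = 1.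
Proof.
move=> x0 x1 /(congr1 (@ln R)); rewrite ln_powR.
have lx : ln x != 0 by rewrite lt_eqF // ln_lt0 // x0.
by rewrite -[X in _ = X]mul1r => /(mulIf lx).
Qed.

(** Nontriviality on [K] yields an element whose value is strictly between 0 and 1, and agreement
    there forces the exponent to be 1. *)
Lemma absval_equiv_eq (R : realType) (K L : set algC) (phi chi : algC -> R) :
  subfield K -> absval K phi -> absval L phi -> K `<=` L ->
  absval_equiv L phi chi -> (forall x, K x -> chi x = phi x) ->
  forall x, L x -> chi x = phi x.
Proof.
move=> sfK avK avL KL [t [t0 H]] e x Lx.
have [a [Ka a0 pa pa1]] := absval_small sfK avK.
have t1 : t = 1 by apply: (powR_fixed pa pa1); rewrite -H ?e //; exact: KL.
by rewrite H // t1 powRr1 // (absval_ge0 avL).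
Qed.

Lemma null_ext (R : realType) (phi : algC -> R) u v : (forall k, u k = v k) ->
  null phi u -> null phi v.
Proof. by move=> e; rewrite (funext e). Qed.

Lemma null_inv_nat (R : realType) (phi : algC -> R) u :
  (forall k, phi (u k) < k.+1%:R^-1) -> null phi u.
Proof.
move=> H e e0; have e1 : 0 <= e^-1 by rewrite invr_ge0 ltW.
exists (Num.bound e^-1) => n nN; rewrite (lt_le_trans (H n)) //.
rewrite -[leRHS]invrK lef_pV2 ?posrE ?invr_gt0 ?ltr0n //.
by rewrite (le_trans (ltW (archi_boundP e1))) // ler_nat leqW.
Qed.

(** * The product of the completions above a place *)

Section Step.
Variables (R : realType) (K L : set algC).
Hypotheses (nfK : number_field K) (nfL : number_field L) (KL : K `<=` L).
Variable psi : algC -> R.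
Hypotheses (avT : absval setT psi) (avK : absval K psi).
Variables (s : seq {rmorphism algC -> algC}) (trs : trace_system K L s).
Variables (m : nat) (f b : 'I_m -> algC).
Hypotheses (Lf : forall i, L (f i)) (Lb : forall i, L (b i)).
Hypothesis fb : forall i j, tr s (f i * b j) = (i == j)%:R.
Hypothesis spf : forall x, L x -> x = \sum_j tr s (x * b j) * f j.
Let sfK := number_field_subfield nfK.
Let sfL := number_field_subfield nfL.

Variables (r : nat) (nu : 'I_r -> {rmorphism algC -> algC}).
Hypothesis nu_in : forall i, List.In (nu i) s.
Hypothesis nu_neq : forall i j, i != j -> ~ (forall x, L x -> psi (nu i x) = psi (nu j x)).
Hypothesis nu_rep : forall mu, List.In mu s ->
  exists i, forall x, L x -> psi (nu i x) = psi (mu x).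

Let phi i x := psi (nu i x).

Lemma step_fixK i x : K x -> phi i x = psi x.
Proof. by move=> Kx; rewrite /phi; case: trs => _ H _; rewrite (H _ (nu_in i)). Qed.

Lemma step_absval i : absval L (phi i).
Proof.
have [T0 [T1 [T2 [T3 _]]]] := avT; rewrite /phi.
split; first by move=> x _; exact: T0.
split.
  move=> x _; rewrite (T1 (nu i x)) //; split=> [/eqP|->]; last by rewrite rmorph0.
  by rewrite fmorph_eq0 => /eqP.
split; first by move=> x y _ _; rewrite rmorphM T2.
split; first by move=> x y _ _; rewrite rmorphD T3.
have [x [Kx x0 x1]] := absval_nontrivial avK; exists x; split; first exact: KL.
by split=> //; rewrite [psi _](step_fixK i).
Qed.

Lemma step_inequiv i j : i != j -> ~ absval_equiv L (phi i) (phi j).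
Proof.
move=> ij eqv; apply: (nu_neq ij) => x Lx; apply/esym.
apply: (absval_equiv_eq sfK _ (step_absval i) KL eqv) => //.
  by apply: (absval_ext sfK _ avK) => z Kz; rewrite step_fixK.
by move=> z Kz; rewrite !step_fixK.
Qed.

(** On [L] every conjugate [psi (mu x)] with [mu] in [s] is one of the [phi i x], so the triangle
    inequality applies term by term. *)
Lemma step_tr_bound : exists2 C : R, 0 <= C &
  forall x j, L x -> psi (tr s (x * b j)) <= C * \sum_i phi i x.
Proof.
have T0 x : 0 <= psi x by have [H _] := avT; exact: H.
have p0 x : 0 <= \sum_i phi i x by apply: sumr_ge0 => i _; exact: T0.
exists (\sum_j \sum_(mu <- s) psi (mu (b j))).
  by apply: sumr_ge0 => j _; apply: sumr_ge0.
move=> x j Lx; apply: (@le_trans _ _ ((\sum_(mu <- s) psi (mu (b j))) * \sum_i phi i x)).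
  rewrite /tr mulr_suml; elim: s nu_rep => [|mu s' IH] rep.
    by rewrite !big_nil; case: avT => _ [H _]; rewrite (H 0 I).2.
  rewrite !big_cons; have [_ [_ [T2 [T3 _]]]] := avT.
  apply: (le_trans (T3 _ _ I I)); apply: lerD; last first.
    by apply: IH => mu' s'mu; apply: rep; right.
  rewrite rmorphM T2 // mulrC ler_wpM2l //.
  have [i iP] := rep mu (or_introl erefl).
  by rewrite -iP // (bigD1 i) //= lerDl; apply: sumr_ge0 => l _; exact: T0.
rewrite ler_wpM2r // (bigD1 j) //= lerDl sumr_ge0 // => k _; exact: sumr_ge0.
Qed.

(* By weak approximation, multi-Cauchy sequences modulo null ones form the product of
   the completions of [L] above [psi]. *)
Definition multi_cauchy (x : nat -> algC) :=
  (forall k, L (x k)) /\ forall i, cauchy L (phi i) x.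

Lemma step_tr_cauchy x j : multi_cauchy x -> cauchy K psi (fun k => tr s (x k * b j)).
Proof.
move=> [Lx cx]; have [C C0 HC] := step_tr_bound.
split=> [k|e e0]; first by apply: (tr_in trs); exact: subfieldM.
have C1 : 0 < C + 1 by rewrite ltr_wpDl.
have r1 : 0 < r%:R + 1 :> R by rewrite ltr_wpDl.
(* Each of the [r] places contributes at most [e']; the added ones keep the divisors positive even
   if [C] or [r] is 0. *)
pose e' := e / (C + 1) / (r%:R + 1).
have e'0 : 0 < e' by rewrite !divr_gt0.
have /choice[N HN] : forall i, exists N, forall k l, (N <= k)%N -> (N <= l)%N ->
  phi i (x k - x l) < e' by move=> i; have [_ /(_ _ e'0)] := cx i.
exists (\max_i N i) => k l kN lN; rewrite -trB -mulrBl.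
have Ld := subfieldB sfL (Lx k) (Lx l).
rewrite (le_lt_trans (HC _ _ Ld)) //.
have : \sum_i phi i (x k - x l) <= r%:R * e'.
  rewrite -[r in r%:R]card_ord -sum1_card natr_sum mulr_suml; apply: ler_sum => i _.
  rewrite mul1r ltW // HN // (leq_trans _ kN, leq_trans _ lN) //; exact: leq_bigmax.
move=> h; apply: (@le_lt_trans _ _ (C * (r%:R * e'))); first by rewrite ler_wpM2l.
have -> : e = (C + 1) * ((r%:R + 1) * e').
  by rewrite /e'; field; rewrite !gt_eqF.
have r0 : 0 <= r%:R :> R by [].
nra.
Qed.

Lemma step_tr_null x j : (forall k, L (x k)) -> (forall i, null (phi i) x) ->
  null psi (fun k => tr s (x k * b j)).
Proof.
move=> Lx nx; have [C C0 HC] := step_tr_bound => e e0.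
have C1 : 0 < C + 1 by rewrite ltr_wpDl.
have r1 : 0 < r%:R + 1 :> R by rewrite ltr_wpDl.
pose e' := e / (C + 1) / (r%:R + 1).
have e'0 : 0 < e' by rewrite !divr_gt0.
have /choice[N HN] : forall i, exists N, forall k, (N <= k)%N ->
  phi i (x k) < e' by move=> i; exact: nx.
exists (\max_i N i) => k kN; rewrite (le_lt_trans (HC _ _ (Lx k))) //.
have : \sum_i phi i (x k) <= r%:R * e'.
  rewrite -[r in r%:R]card_ord -sum1_card natr_sum mulr_suml; apply: ler_sum => i _.
  rewrite mul1r ltW // HN // (leq_trans _ kN) //; exact: leq_bigmax.
move=> h; apply: (@le_lt_trans _ _ (C * (r%:R * e'))); first by rewrite ler_wpM2l.
have -> : e = (C + 1) * ((r%:R + 1) * e').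
  by rewrite /e'; field; rewrite !gt_eqF.
have r0 : 0 <= r%:R :> R by [].
nra.
Qed.

(** Expand [x] in the basis [f]. An arbitrary [chi] above the place is allowed because completeness
    of the list of the [phi i] is proved by applying this to a hypothetical further one. *)
Lemma step_null_of_tr chi x : absval L chi -> absval_equiv K psi chi ->
  (forall k, L (x k)) -> (forall j, null psi (fun k => tr s (x k * b j))) -> null chi x.
Proof.
move=> bv eqv Lx nx.
have Kt k j : K (tr s (x k * b j)) by apply: (tr_in trs); exact: subfieldM.
apply: (@null_ext _ _ (fun k => \sum_j f j * tr s (x k * b j))) => [k|].
  by rewrite [RHS]spf //; apply: eq_bigr => j _; rewrite mulrC.
apply: (null_sum sfL bv) => [j k|j _]; first by apply: (subfieldM sfL) => //; exact: KL.
apply: (nullM sfL bv (u := fun=> f j)); first exact: cauchy_cst.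
  by move=> k; exact: KL.
by apply: (equiv_null avK eqv) => //.
Qed.

Lemma step_null_of_tr_phi i x : (forall k, L (x k)) ->
  (forall j, null psi (fun k => tr s (x k * b j))) -> null (phi i) x.
Proof.
apply: step_null_of_tr; first exact: step_absval.
exists 1; split=> // y Ky; rewrite powRr1 ?step_fixK //; exact: (absval_ge0 avK).
Qed.

Lemma step_approx (U : 'I_r -> nat -> algC) : (forall i k, L (U i k)) ->
  exists x, (forall k, L (x k)) /\ forall i, null (phi i) (fun k => x k - U i k).
Proof.
move=> LU; have /choice[x xP] : forall k, exists y, L y /\
    forall i, phi i (y - U i k) < k.+1%:R^-1.
  move=> k; have k0 : 0 < k.+1%:R^-1 :> R by rewrite invr_gt0 ltr0n.
  have [y Ly yP] := weak_approximation sfL step_absval step_inequiv (fun i => LU i k) k0.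
  by exists y.
exists x; split=> [k|i]; first by have [] := xP k.
by apply: null_inv_nat => k; have [_] := xP k; apply.
Qed.

(** If [chi] were new, weak approximation would give a sequence tending to 0 at all [phi i] and to 1
    at [chi]. Its coordinates are then null, so it also tends to 0 at [chi]. *)
Lemma step_complete chi : absval L chi -> absval_equiv K psi chi ->
  exists i, absval_equiv L (phi i) chi.
Proof.
move=> bv eqv; apply: contrapT => /forallNP neq.
pose ph (i : 'I_r.+1) := if unlift ord_max i is Some j then phi j else chi.
pose U (i : 'I_r.+1) : algC := if unlift ord_max i is Some j then 0 else 1.
have avp i : absval L (ph i).
  by rewrite /ph; case: unliftP => [j _|_] //; exact: step_absval.
have neqp i j : i != j -> ~ absval_equiv L (ph i) (ph j).
  rewrite /ph; case: unliftP => [i' ->|->]; case: unliftP => [j' ->|->] //=.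
  - by rewrite (inj_eq (lift_inj (h := _))) => /step_inequiv.
  - by move=> _ /(absval_equiv_sym bv)/neq.
  - by rewrite eqxx.
have LU i : L (U i) by rewrite /U; case: unlift => [_|]; 
  [exact: (subfield0 sfL)|exact: (subfield1 sfL)].
have /choice[x xP] : forall k, exists y, L y /\
    forall i, ph i (y - U i) < k.+1%:R^-1.
  move=> k; have k0 : 0 < k.+1%:R^-1 :> R by rewrite invr_gt0 ltr0n.
  by have [y Ly yP] := weak_approximation sfL avp neqp LU k0; exists y.
have Lx k : L (x k) by have [] := xP k.
have nx i : null (phi i) x.
  apply: null_inv_nat => k; have [_ /(_ (lift ord_max i))] := xP k.
  by rewrite /ph /U liftK subr0.
have ncx := step_null_of_tr bv eqv Lx (fun j => step_tr_null j Lx nx).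
have n1 : null chi (fun k => x k - 1).
  apply: null_inv_nat => k; have [_ /(_ ord_max)] := xP k.
  by rewrite /ph /U unlift_none.
have h0 : 0 < 2^-1 :> R by rewrite invr_gt0.
have [N HN] := ncx _ h0; have [M HM] := n1 _ h0.
have := HN (maxn N M) (leq_maxl _ _); have := HM (maxn N M) (leq_maxr _ _).
set y := x _ => h1 h2; have L1 := subfield1 sfL.
have := absvalB sfL bv (Lx (maxn N M)) (subfieldB sfL (Lx (maxn N M)) L1).
rewrite -/y opprB addrCA subrr addr0 (absval1 sfL bv); lra.
Qed.

Section Coordinates.
Hypothesis avQ : absval Qset psi.
Variables (F : fieldType) (q : (nat -> rat) -> F) (qP : is_completion psi q).
Variables (d : nat) (c : (nat -> algC) -> 'rV[F]_d) (cP : local_coord psi q K psi c).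

Let QK : Qset `<=` K. Proof. by move=> _ [x _ <-]; exact: subfield_rat. Qed.

Lemma step_phiQ i x : Qset x -> phi i x = psi x.
Proof. by move=> /QK; exact: step_fixK. Qed.

Definition step_coord (x : nat -> algC) : 'rV[F]_(m * d) :=
  mxvec (\matrix_(j < m) c (fun k => tr s (x k * b j))).

Lemma multi_cauchyD x y : multi_cauchy x -> multi_cauchy y ->
  multi_cauchy (fun k => x k + y k).
Proof.
move=> [Lx cx] [Ly cy]; split=> [k|i]; first exact: subfieldD.
exact: (cauchyD sfL (step_absval i)).
Qed.

Lemma multi_cauchyN x : multi_cauchy x -> multi_cauchy (fun k => - x k).
Proof.
move=> [Lx cx]; split=> [k|i]; first exact: subfieldN.
exact: (cauchyN sfL (step_absval i)).
Qed.

Lemma multi_cauchyZ a x : qcauchy psi a -> multi_cauchy x ->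
  multi_cauchy (fun k => ratr (a k) * x k).
Proof.
move=> ca [Lx cx]; split=> [k|i]; first by apply: (subfieldM sfL) => //; exact: subfield_rat.
apply: (cauchyM sfL (step_absval i)) => //.
exact: (qcauchy_cauchyK sfL (step_phiQ i)).
Qed.

Lemma multi_cauchy0 : multi_cauchy (fun=> 0).
Proof.
split=> [k|i]; first exact: subfield0.
by apply: (cauchy_cst sfL (step_absval i)); exact: subfield0.
Qed.

Lemma step_coordD x y : multi_cauchy x -> multi_cauchy y ->
  step_coord (fun k => x k + y k) = step_coord x + step_coord y.
Proof.
move=> mx my; rewrite -linearD; congr mxvec; apply/row_matrixP => j.
rewrite linearD /= !rowK; have [cD _ _ _] := cP; rewrite -cD; try exact: step_tr_cauchy.
by congr c; apply/funext => k; rewrite mulrDl trD.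
Qed.

Lemma step_coordZ a x : qcauchy psi a -> multi_cauchy x ->
  step_coord (fun k => ratr (a k) * x k) = q a *: step_coord x.
Proof.
move=> ca mx; rewrite -linearZ; congr mxvec; apply/row_matrixP => j.
rewrite linearZ /= !rowK; have [_ cZ _ _] := cP; rewrite -cZ //; last exact: step_tr_cauchy.
congr c; apply/funext => k; rewrite -mulrA (trM trs) //; exact: subfield_rat.
Qed.

Lemma step_coord_eq0 x : multi_cauchy x ->
  step_coord x = 0 <-> forall i, null (phi i) x.
Proof.
move=> mx; have [Lx _] := mx; have [_ _ c0 _] := cP.
have E : step_coord x = 0 <-> forall j, null psi (fun k => tr s (x k * b j)).
  split=> [/eqP|H].
    rewrite mxvec_eq0 => /eqP M0 j; apply/c0; first exact: step_tr_cauchy.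
    by have := congr1 (row j) M0; rewrite rowK row0.
  apply/eqP; rewrite mxvec_eq0; apply/eqP/row_matrixP => j; rewrite rowK row0.
  by apply/c0 => //; exact: step_tr_cauchy.
rewrite E; split=> [H i|H j]; first exact: step_null_of_tr_phi.
exact: step_tr_null.
Qed.

Lemma step_coord_surj z : exists2 x, multi_cauchy x & step_coord x = z.
Proof.
have [_ _ _ cs] := cP; have /choice[y yP] : forall j, exists u, cauchy K psi u /\
    c u = row j (vec_mx z).
  by move=> j; have [u cu e] := cs (row j (vec_mx z)); exists u.
have Ky j k : K (y j k) by have [[]] := yP j.
pose x k := \sum_j y j k * f j.
have Lx k : L (x k).
  by apply: (subfield_sum sfL) => j _; apply: (subfieldM sfL) => //; exact: KL.
have mx : multi_cauchy x.
  split=> // i; apply: (cauchy_sum sfL (step_absval i)) => j.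
  apply: (cauchyM sfL (step_absval i)); last exact: (cauchy_cst sfL (step_absval i)).
  have [[_ H] _] := yP j; split=> [k|e e0]; first exact: KL.
  have [N HN] := H e e0; exists N => k l kN lN; rewrite step_fixK ?HN //.
  exact: subfieldB.
exists x => //; rewrite -[RHS]vec_mxK; congr mxvec; apply/row_matrixP => j.
rewrite rowK; have [_ <-] := yP j; congr c; apply/funext => k.
exact: (tr_coord trs j fb (fun j => Ky j k)).
Qed.

Lemma step_coord_sum (I : Type) (l : seq I) (x : I -> nat -> algC) :
  (forall i, multi_cauchy (x i)) ->
  multi_cauchy (fun k => \sum_(i <- l) x i k) /\
  step_coord (fun k => \sum_(i <- l) x i k) = \sum_(i <- l) step_coord (x i).
Proof.
move=> mx; elim: l => [|i l [mS eS]].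
  under eq_fun do rewrite big_nil; rewrite big_nil; split; first exact: multi_cauchy0.
  apply/step_coord_eq0; first exact: multi_cauchy0.
  by move=> i; exact: (null0 sfL (step_absval i)).
under eq_fun do rewrite big_cons; rewrite big_cons -eS step_coordD //; split=> //.
exact: multi_cauchyD.
Qed.

Lemma step_coord_eq x y : multi_cauchy x -> multi_cauchy y ->
  (forall i, null (phi i) (fun k => x k - y k)) -> step_coord x = step_coord y.
Proof.
move=> mx my nxy; have mN := multi_cauchyN my; have mxy := multi_cauchyD mx mN.
have e0 : step_coord (fun k => x k - y k) = 0 by apply/step_coord_eq0.
have -> : x = (fun k => (x k - y k) + y k) by apply/funext => k; rewrite subrK.
by rewrite step_coordD // e0 add0r.
Qed.

Lemma cauchy_null_diff i x u : (forall k, L (x k)) -> cauchy L (phi i) u ->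
  null (phi i) (fun k => x k - u k) -> cauchy L (phi i) x.
Proof.
move=> Lx cu nxu; have av := step_absval i.
have Lu k : L (u k) by exact: cauchy_in cu.
rewrite (_ : x = (fun k => (x k - u k) + u k)); last first.
  by apply/funext => k; rewrite subrK.
apply: (cauchyD sfL av) => //; apply: (null_cauchy sfL av) => // k.
exact: subfieldB.
Qed.

(** [x] represents the element of the product of completions whose entry is [u] at the place [i] and
    0 at the others. *)
Definition component i (u x : nat -> algC) := [/\ forall k, L (x k),
  null (phi i) (fun k => x k - u k) & forall l, l != i -> null (phi l) x].

Lemma component_exists i u : (forall k, L (u k)) -> exists x, component i u x.
Proof.
move=> Lu; pose U l k : algC := if l == i then u k else 0.
have LU l k : L (U l k) by rewrite /U; case: ifP => _ //; exact: (subfield0 sfL).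
have [x [Lx nx]] := step_approx LU; exists x; split=> //.
  by have := nx i; rewrite /U eqxx.
move=> l /negPf li; have := nx l; rewrite /U li.
by apply: null_ext => k; rewrite subr0.
Qed.

Lemma component_multi_cauchy i u x : cauchy L (phi i) u -> component i u x ->
  multi_cauchy x.
Proof.
move=> cu [Lx nxu nx]; split=> // l; have [->|li] := eqVneq l i.
  exact: cauchy_null_diff nxu.
by apply: (null_cauchy sfL (step_absval l)) => //; exact: nx.
Qed.

(** Makes the coordinates independent of the approximating sequence, so that a map defined by
    choosing approximants is additive and homogeneous. *)
Lemma component_coord_eq i u v x y : cauchy L (phi i) u -> cauchy L (phi i) v ->
  component i u x -> component i v y -> null (phi i) (fun k => u k - v k) ->
  step_coord x = step_coord y.
Proof.
move=> cu cv cx cy nuv.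
apply: step_coord_eq; [exact: component_multi_cauchy cx | exact: component_multi_cauchy cy |].
have [Lx nxu nx] := cx; have [Ly nyv ny] := cy => l.
have av := step_absval l; have [li|li] := eqVneq l i; last first.
  by apply: (nullB sfL av) => //; [exact: nx | exact: ny].
rewrite -li in nxu nyv nuv cu cv.
have Lu k := cauchy_in k cu; have Lv k := cauchy_in k cv.
have Lxu k := subfieldB sfL (Lx k) (Lu k); have Lyv k := subfieldB sfL (Ly k) (Lv k).
have Luv k := subfieldB sfL (Lu k) (Lv k).
have Lxy k := subfieldB sfL (Lxu k) (Lyv k).
apply: (@null_ext _ _ (fun k => ((x k - u k) - (y k - v k)) + (u k - v k))).
  by move=> k; ring.
by apply: (nullD av) => //; exact: (nullB sfL av).
Qed.

(** [E i] is the image in [F ^ (m * d)] of the factor at the place [i]. Weak approximation makes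
    these subspaces span, and a sum is null only if every component is, so their dimensions add up
    to [m * d]. *)
Lemma step_split : exists dd : 'I_r -> nat, (\sum_i dd i)%N = (m * d)%N /\
  forall i, exists g : (nat -> algC) -> 'rV[F]_(dd i), local_coord psi q L (phi i) g.
Proof.
have [_ qM q0 qs] := qP.
pose E i := [set z | exists2 x, multi_cauchy x /\ (forall l, l != i -> null (phi l) x) &
  z = step_coord x].
have [||||dd [B [Bf EB sdd]]] := @direct_split F (m * d) r E.
- move=> i; exists (fun=> 0).
    by split; [exact: multi_cauchy0 | move=> l _; exact: (null0 sfL (step_absval l))].
  apply/esym/step_coord_eq0; first exact: multi_cauchy0.
  by move=> l; exact: (null0 sfL (step_absval l)).
- move=> i a' _ _ [x [mx nx] ->] [y [my ny] ->]; have [a ca <-] := qs a'.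
  have max := multi_cauchyZ ca mx; have [Lx _] := mx; have [Ly _] := my.
  have [Lax _] := max.
  exists (fun k => ratr (a k) * x k + y k); last by rewrite step_coordD // step_coordZ.
  split; first exact: multi_cauchyD.
  move=> l li; apply: (nullD (step_absval l)) => //; last exact: ny.
  apply: (nullM sfL (step_absval l)) => //; last exact: nx.
  exact: (qcauchy_cauchyK sfL (step_phiQ l)).
- move=> z; have [x mx <-] := step_coord_surj z; have [Lx cx] := mx.
  have /choice[y yP] : forall i, exists y, component i x y.
    by move=> i; exact: component_exists.
  have my i : multi_cauchy (y i) by exact: component_multi_cauchy (cx i) (yP i).
  have [mS eS] := step_coord_sum (index_enum 'I_r) my.
  exists (fun i => step_coord (y i)).
    by move=> i; exists (y i) => //; split=> //; have [] := yP i.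
  rewrite -eS; apply: step_coord_eq => // l; have av := step_absval l.
  have Ly i k : L (y i k) by have [] := my i.
  have [_ nl _] := yP l.
  apply: (@null_ext _ _ (fun k => - ((y l k - x k) + \sum_(i | i != l) y i k))).
    by move=> k; rewrite [in RHS](bigD1 l) //= opprD opprB opprD addrA.
  have Lyl k := subfieldB sfL (Ly l k) (Lx k).
  have LS k : L (\sum_(i | i != l) y i k) by exact: subfield_sum.
  apply: (nullN sfL av) => [k|]; first exact: subfieldD.
  apply: (nullD av) => //.
  apply: (null_sum sfL av) => // i il.
  by have [_ _] := yP i; apply; rewrite eq_sym.
- move=> u Eu S0 l.
  have /choice[x xP] : forall i, exists x, [/\ multi_cauchy x,
      (forall l, l != i -> null (phi l) x) & u i = step_coord x].
    by move=> i; have [x [mx nx] ->] := Eu i; exists x.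
  have mx i : multi_cauchy (x i) by have [] := xP i.
  have [mS eS] := step_coord_sum (index_enum 'I_r) mx.
  have : step_coord (fun k => \sum_i x i k) = 0.
    by rewrite eS; apply: (etrans _ S0); apply: eq_bigr => i _; have [_ _ ->] := xP i.
  move=> /(step_coord_eq0 mS)/(_ l) nS.
  have [_ nl ->] := xP l; apply/step_coord_eq0 => // i.
  have [->|il] := eqVneq i l; last exact: nl.
  have av := step_absval l; have Lx i' k : L (x i' k) by have [] := mx i'.
  have LS k : L (\sum_i x i k) by exact: subfield_sum.
  have LS' k : L (\sum_(i | i != l) x i k) by exact: subfield_sum.
  apply: (@null_ext _ _ (fun k => (\sum_i x i k) - \sum_(i | i != l) x i k)).
    by move=> k; rewrite (bigD1 l) //= addrK.
  apply: (nullB sfL av) => //.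
  apply: (null_sum sfL av) => // i' il.
  by have [_ + _] := xP i'; apply; rewrite eq_sym.
exists dd; split=> // i; have av := step_absval i.
(* A total choice of approximants, with the sequence itself as default value outside [L]. *)
have /choice[apx apxP] : forall u, exists x, (forall k, L (u k)) -> component i u x.
  move=> u; have [Lu|nL] := pselect (forall k, L (u k)); last by exists u.
  by have [x xP] := component_exists i Lu; exists x.
have cpx u : cauchy L (phi i) u -> component i u (apx u).
  by move=> cu; apply: apxP => k; exact: cauchy_in cu.
have mpx u : cauchy L (phi i) u -> multi_cauchy (apx u).
  by move=> cu; exact: component_multi_cauchy (cpx _ cu).
have Epx u : cauchy L (phi i) u -> (step_coord (apx u) <= B i)%MS.
  move=> cu; apply/EB; exists (apx u) => //; split; first exact: mpx.
  by have [] := cpx _ cu.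
have pI (z : 'rV[F]_(m * d)) : (z <= B i)%MS -> z *m pinvmx (B i) = 0 -> z = 0.
  by move=> zB z0; rewrite -(mulmxKpV zB) z0 mul0mx.
(* [B i] is row free, so multiplying by its pseudo-inverse gives the coordinates with respect to its
   rows. *)
exists (fun u => step_coord (apx u) *m pinvmx (B i)); split.
- move=> u v cu cv; rewrite -mulmxDl; congr (_ *m _).
  rewrite -step_coordD; try exact: mpx.
  have cuv := cauchyD sfL av cu cv.
  apply: (component_coord_eq cuv cuv (cpx _ cuv)).
    have [Lx nx ex] := cpx _ cu; have [Ly ny ey] := cpx _ cv.
    have Lxu k := subfieldB sfL (Lx k) (cauchy_in k cu).
    have Lyv k := subfieldB sfL (Ly k) (cauchy_in k cv).
    split=> [k||l li]; first exact: subfieldD.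
      apply: (@null_ext _ _ (fun k => (apx u k - u k) + (apx v k - v k))).
        by move=> k; ring.
      exact: (nullD av).
    by apply: (nullD (step_absval l)) => //; [exact: ex | exact: ey].
  by apply: (@null_ext _ _ (fun=> 0)) => [k|]; [rewrite subrr | exact: (null0 sfL av)].
- move=> a u ca cu; rewrite scalemxAl; congr (_ *m _).
  have ca' := qcauchy_cauchyK sfL (step_phiQ i) ca.
  rewrite -step_coordZ //; last exact: mpx.
  have cau := cauchyM sfL av ca' cu.
  apply: (component_coord_eq cau cau (cpx _ cau)).
    have [Lx nx ex] := cpx _ cu.
    have Lxu k := subfieldB sfL (Lx k) (cauchy_in k cu).
    split=> [k||l li].
    + by apply: (subfieldM sfL) => //; exact: subfield_rat.
    + apply: (@null_ext _ _ (fun k => ratr (a k) * (apx u k - u k))).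
        by move=> k; rewrite mulrBr.
      exact: (nullM sfL av).
    apply: (nullM sfL (step_absval l)) => //; last exact: ex.
    exact: (qcauchy_cauchyK sfL (step_phiQ l)).
  by apply: (@null_ext _ _ (fun=> 0)) => [k|]; [rewrite subrr | exact: (null0 sfL av)].
- move=> u cu; have [Lx nx ex] := cpx _ cu; have Lu k := cauchy_in k cu.
  have Lxu k := subfieldB sfL (Lx k) (Lu k).
  split=> [/(pI _ (Epx _ cu))/(step_coord_eq0 (mpx _ cu))/(_ i) ni|ni].
    apply: (@null_ext _ _ (fun k => apx u k - (apx u k - u k))).
      by move=> k; ring.
    exact: (nullB sfL av).
  rewrite (_ : step_coord _ = 0) ?mul0mx //; apply/step_coord_eq0; first exact: mpx.
  move=> l; have [->|li] := eqVneq l i; last exact: ex.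
  apply: (@null_ext _ _ (fun k => (apx u k - u k) + u k)).
    by move=> k; rewrite subrK.
  exact: (nullD av).
- move=> z; have /EB[x [mx nx] ex] : (z *m B i <= B i)%MS by exact: submxMl.
  have [Lx cx] := mx; exists x; first exact: cx.
  suff -> : step_coord (apx x) = z *m B i by rewrite mulmxKp.
  rewrite ex; apply: (component_coord_eq (cx i) (cx i) (cpx _ (cx i))).
    split=> //.
    by apply: (@null_ext _ _ (fun=> 0)) => [k|]; [rewrite subrr | exact: (null0 sfL av)].
  by apply: (@null_ext _ _ (fun=> 0)) => [k|]; [rewrite subrr | exact: (null0 sfL av)].
Qed.

End Coordinates.
End Step.

Definition place_of (R : realType) (K : set algC) (phi : algC -> R) :=
  [set chi | absval K chi /\ absval_equiv K phi chi].

Section DegreeFormula.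
Variables (R : realType) (psi : algC -> R).
Hypotheses (avT : absval setT psi) (avQ : absval Qset psi).

Lemma number_field_Qsub K : number_field K -> Qset `<=` K.
Proof. by move=> [sfK _] _ [x _ <-]; exact: subfield_rat. Qed.

Lemma absval_number_field K : number_field K -> absval K psi.
Proof. by move=> /number_field_Qsub QK; exact: absval_between QK _ avQ avT. Qed.

(* The places of [L] above the place [psi] of [K] are the [psi \o nu i], and
   [m = [L : K]]. *)
Record places_above (K L : set algC) (m r : nat) (nu : 'I_r -> {rmorphism algC -> algC}) :=
  PlacesAbove {
    pa_fix : forall i x, K x -> nu i x = x;
    pa_absval : forall i, absval L (fun x => psi (nu i x));
    pa_inequiv : forall i j, i != j ->
      ~ absval_equiv L (fun x => psi (nu i x)) (fun x => psi (nu j x));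
    pa_complete : forall chi, absval L chi -> absval_equiv K psi chi ->
      exists i, absval_equiv L (fun x => psi (nu i x)) chi;
    pa_degree : degree L = (m * degree K)%N;
    pa_coord : forall (F : fieldType) (q : (nat -> rat) -> F) d
        (c : (nat -> algC) -> 'rV[F]_d),
      is_completion psi q -> local_coord psi q K psi c ->
      exists dd : 'I_r -> nat, (\sum_i dd i)%N = (m * d)%N /\
        forall i, exists g : (nat -> algC) -> 'rV[F]_(dd i),
          local_coord psi q L (fun x => psi (nu i x)) g }.

Lemma places_above_exist K L : number_field K -> number_field L -> K `<=` L ->
  exists m r (nu : 'I_r -> {rmorphism algC -> algC}), places_above K L m nu.
Proof.
move=> nfK nfL KL; have avK := absval_number_field nfK.
have [s trs] := trace_system_exists nfK nfL KL.
have [m [f [b [Lf Lb fb spf]]]] := dual_basis nfK nfL KL trs.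
have [||r [nu [nu1 nu2 nu3]]] := @class_representatives _
  (fun mu nu : {rmorphism algC -> algC} => forall x, L x -> psi (mu x) = psi (nu x))
  idfun s; [by [] | by move=> mu mu' H x Lx; rewrite H |].
exists m, r, nu; split.
- by move=> i x Kx; case: trs => _ H _; apply: H (nu1 i) _ Kx.
- exact: (step_absval KL avT avK trs nu1).
- exact: (step_inequiv nfK KL avT avK trs nu1 nu2).
- exact: (step_complete nfK nfL KL avT avK trs Lf Lb spf nu1 nu2 nu3).
- have [n [e [_ inde spe ->]]] := number_field_basis nfK.
  exact: (trace_degree nfL KL trs Lf Lb fb spf inde spe).
move=> F q d c qP cP.
exact: (step_split nfK nfL KL avT avK trs Lf Lb fb spf nu1 nu2 nu3 qP cP).
Qed.

Lemma local_coord_ext (F : fieldType) (q : (nat -> rat) -> F) K d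
    (c : (nat -> algC) -> 'rV[F]_d) (phi chi : algC -> R) : subfield K ->
  (forall x, K x -> phi x = chi x) ->
  local_coord psi q K phi c -> local_coord psi q K chi c.
Proof.
move=> sfK e.
have ec u : cauchy K chi u <-> cauchy K phi u.
  by split=> -[Ku H]; split=> // d0 d1; have [N HN] := H d0 d1; exists N => k l kN lN;
    have := HN k l kN lN; rewrite e //; exact: subfieldB.
have en u : cauchy K phi u -> null phi u <-> null chi u.
  by move=> [Ku _]; split=> H d0 d1; have [N HN] := H d0 d1; exists N => k kN;
    have := HN k kN; rewrite e.
move=> [cD cZ c0 cs]; split.
- by move=> u v /ec cu /ec cv; exact: cD.
- by move=> a u ca /ec cu; exact: cZ.
- by move=> u /ec cu; rewrite -en //; exact: c0.
- by move=> z; have [u /ec cu uz] := cs z; exists u.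
Qed.

(** Split the completions of [K] above the place of [Qset] and take the factor equivalent to [psi].
    Both absolute values agree on the rationals, hence on [K]. *)
Lemma local_coord_exists (F : fieldType) (q : (nat -> rat) -> F) K :
  is_completion psi q -> number_field K ->
  exists d (c : (nat -> algC) -> 'rV[F]_d), local_coord psi q K psi c.
Proof.
move=> qP nfK; have sfK := number_field_subfield nfK.
have sfQ := number_field_subfield number_field_Q.
have QK := number_field_Qsub nfK; have avK := absval_number_field nfK.
have [m [r [nu PA]]] := places_above_exist number_field_Q nfK QK.
have [c0 c0P] := local_coord_Q qP.
have [dd [_ ddP]] := pa_coord PA qP c0P.
have [i ei] := pa_complete PA avK (absval_equiv_refl avQ).
have eq x : K x -> psi x = psi (nu i x).
  apply: (absval_equiv_eq sfQ _ (pa_absval PA i) QK ei) => [|y Qy].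
    by apply: (absval_ext sfQ _ avQ) => y Qy; rewrite (pa_fix PA).
  by rewrite (pa_fix PA).
have [g gP] := ddP i; exists (dd i), g.
by apply: (local_coord_ext sfK _ gP) => x Kx; rewrite [RHS]eq.
Qed.

Lemma degree_gt0 K : number_field K -> (0 < degree K)%N.
Proof. by move=> /number_field_basis[n [e [n0 _ _ ->]]]. Qed.

Theorem local_degree_sum K L m r (nu : 'I_r -> {rmorphism algC -> algC}) :
  number_field K -> number_field L -> K `<=` L -> places_above K L m nu ->
  (0 < local_degree K (place_of K psi))%N /\
  (\sum_i local_degree L (place_of L (fun x => psi (nu i x))))%N =
    (m * local_degree K (place_of K psi))%N.
Proof.
move=> nfK nfL KL PA; have sfK := number_field_subfield nfK.
have sfL := number_field_subfield nfL; have avK := absval_number_field nfK.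
have [F [q qP]] := completion_exists avQ.
have [d [c cP]] := local_coord_exists qP nfK.
have [dd [sdd ddP]] := pa_coord PA qP cP.
have eK : local_degree K (place_of K psi) = d.
  exact: (local_degreeP sfK qP avK (fun _ _ => erefl) cP).
rewrite eK; split.
  (* In dimension 0 the constant sequence 1 would be null. *)
  rewrite lt0n; apply/eqP => d0; have [_ _ c0 _] := cP.
  have c1 := cauchy_cst sfK avK (subfield1 sfK).
  have /(c0 _ c1)/(_ 1 ltr01)[N /(_ N (leqnn _))] : c (fun=> 1) = 0.
    by move: (c _); rewrite d0 => z; exact: thinmx0.
  by rewrite (absval1 sfK avK) ltxx.
rewrite -sdd; apply: eq_bigr => i _; have [g gP] := ddP i.
apply: (local_degreeP sfL qP (pa_absval PA i) _ gP) => x Qx.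
by rewrite (pa_fix PA) //; exact: number_field_Qsub Qx.
Qed.

End DegreeFormula.

(** * Places of the algebraic numbers *)

HB.instance Definition _ (R : realType) (S : set (set (algC -> R))) := gen_eqMixin (J S).

Lemma List_InP (T : eqType) (s : seq T) x : List.In x s <-> x \in s.
Proof.
elim: s => [|y s IH] //=; rewrite inE; split=> [[->|/IH->]|/orP[/eqP->|/IH]].
- by rewrite eqxx.
- by rewrite orbT.
- by left.
- by right.
Qed.

Lemma List_NoDupP (T : eqType) (s : seq T) : List.NoDup s <-> uniq s.
Proof.
elim: s => [|y s IH] /=; first by split=> // _; constructor.
split=> [H|/andP[/negP ys /IH us]].
  by inversion H; subst; apply/andP; split; [apply/negP => /List_InP | apply/IH].
by constructor => // /List_InP.
Qed.

Section PlaceLemmas.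
Variables (R : realType) (K : set algC) (sfK : subfield K).
Implicit Types (v : set (algC -> R)) (phi psi : algC -> R).

Lemma place_absval v phi : place K v -> v phi -> absval K phi.
Proof. by move=> [chi [_ ->]] []. Qed.

Lemma placeE v phi : place K v -> v phi -> v = place_of K phi.
Proof.
move=> [chi [av ->]] [bv e]; apply/seteqP; split=> psi [cv e']; split=> //.
  by apply: absval_equiv_trans e'; exact: absval_equiv_sym.
exact: absval_equiv_trans e e'.
Qed.

Lemma place_of_self phi : absval K phi -> place_of K phi phi.
Proof. by move=> av; split=> //; exact: absval_equiv_refl. Qed.

Lemma place_place_of phi : absval K phi -> place K (place_of K phi).
Proof. by move=> av; exists phi. Qed.

Lemma place_ext v phi psi : place K v -> v phi -> (forall x, K x -> psi x = phi x) -> v psi.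
Proof.
move=> pv vphi e; have av := place_absval pv vphi; rewrite (placeE pv vphi).
split; first exact: absval_ext e av.
by exists 1; split=> // x Kx; rewrite e // powRr1 // (absval_ge0 av).
Qed.

Lemma place_equiv v phi psi : place K v -> v phi -> absval K psi ->
  absval_equiv K phi psi -> v psi.
Proof. by move=> pv vphi av e; rewrite (placeE pv vphi). Qed.

Lemma place_mem_equiv v phi psi : place K v -> v phi -> v psi -> absval_equiv K phi psi.
Proof. by move=> pv vphi; rewrite (placeE pv vphi) => -[]. Qed.

Lemma absval_equiv_sub L phi psi : K `<=` L -> absval_equiv L phi psi ->
  absval_equiv K phi psi.
Proof. by move=> KL [t [t0 H]]; exists t; split=> // x /KL; exact: H. Qed.

End PlaceLemmas.

Section JLevel.
Variables (R : realType) (S : set (set (algC -> R))).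
Hypothesis HS : forall s, S s -> place Qset s.
Let sfQ := number_field_subfield number_field_Q.

Definition over (j : J S) (x : Xt S) := Ybasis (jK j) (jv j) (proj1_sig x).

(** Representatives of the points of [X]; being nontrivial on [Qset], they restrict to absolute
    values of every number field. *)
Definition S_absval (psi : algC -> R) :=
  [/\ absval setT psi, absval Qset psi & exists2 s, S s & s psi].

Lemma jK_nf (j : J S) : number_field (jK j).
Proof. by have [] := proj2_sig j. Qed.

Lemma jv_place (j : J S) : place (jK j) (jv j).
Proof. by have [_ []] := proj2_sig j. Qed.

Lemma J_eq (j j' : J S) : jK j = jK j' -> jv j = jv j' -> j = j'.
Proof.
case: j j' => [[K v] p] [[K' v'] p']; rewrite /jK /jv /= => eK ev; subst.
by congr exist.
Qed.

Lemma S_absval_J psi K : S_absval psi -> number_field K ->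
  exists j : J S, jK j = K /\ jv j = place_of K psi.
Proof.
move=> [avT avQ [s Ss spsi]] nfK; have avK := absval_number_field avT avQ nfK.
have P : number_field (K, place_of K psi).1 /\
    place (K, place_of K psi).1 (K, place_of K psi).2 /\
    MKS S (K, place_of K psi).1 (K, place_of K psi).2.
  split=> //; split; first exact: place_place_of.
  by exists s; split=> //; exists psi; split=> //; exact: place_of_self.
by exists (exist _ (K, place_of K psi) P).
Qed.

Lemma S_absval_comp psi (nu : {rmorphism algC -> algC}) :
  S_absval psi -> S_absval (fun x => psi (nu x)).
Proof.
move=> [avT avQ [s Ss spsi]].
have eQ x : Qset x -> psi (nu x) = psi x by move=> [a _ <-]; rewrite rmorph_rat.
split; last by exists s => //; exact: (place_ext sfQ (HS Ss) spsi eQ).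
  have [T0 [T1 [T2 [T3 _]]]] := avT.
  split; first by move=> x _; exact: T0.
  split.
    move=> x _; rewrite (T1 (nu x)) //; split=> [/eqP|->]; last by rewrite rmorph0.
    by rewrite fmorph_eq0 => /eqP.
  split; first by move=> x y _ _; rewrite rmorphM T2.
  split; first by move=> x y _ _; rewrite rmorphD T3.
  by have [x [Qx x0 x1]] := absval_nontrivial avQ; exists x; rewrite eQ.
exact: absval_ext eQ avQ.
Qed.

(** The extension of absolute values to [algC] enters here; it is what puts a point above every
    place. *)
Lemma J_S_absval (j : J S) : exists2 psi, S_absval psi & jv j psi.
Proof.
have nfK := jK_nf j; have sfK := number_field_subfield nfK; have pv := jv_place j.
have [_ [_ [s [Ss [chi [vchi schi]]]]]] := proj2_sig j.
have av := place_absval pv vchi.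
have [psi [avT e]] := absval_extension nfK av.
have eQ x : Qset x -> psi x = chi x by move=> Qx; apply: e; exact: number_field_Qsub Qx.
exists psi; last exact: place_ext vchi e.
split=> //; last by exists s => //; exact: place_ext (HS Ss) schi eQ.
exact: absval_ext eQ (place_absval (HS Ss) schi).
Qed.

Lemma X_S_absval (x : Xt S) : exists2 psi, S_absval psi & proj1_sig x = place_of setT psi.
Proof.
have [py [s [Ss [psi [ypsi spsi]]]]] := proj2_sig x.
exists psi; last exact: placeE py ypsi.
split; [exact: place_absval py ypsi | exact: place_absval (HS Ss) spsi |].
by exists s.
Qed.

Lemma S_absval_X psi : S_absval psi -> exists x : Xt S, proj1_sig x = place_of setT psi.
Proof.
move=> [avT avQ [s Ss spsi]].
have P : place setT (place_of setT psi) /\ exists s, S s /\ divides Qset s (place_of setT psi).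
  split; first exact: place_place_of.
  by exists s; split=> //; exists psi; split=> //; exact: place_of_self.
by exists (exist _ (place_of setT psi) P : Xt S).
Qed.

Lemma overP (j : J S) (x : Xt S) psi : S_absval psi -> proj1_sig x = place_of setT psi ->
  over j x <-> jv j psi.
Proof.
move=> [avT avQ _] e; have nfK := jK_nf j; have pv := jv_place j.
have avK := absval_number_field avT avQ nfK.
rewrite /over /Ybasis e; split=> [[_ [chi [[_ eqv] vchi]]]|vpsi].
  apply: (place_equiv pv vchi avK); apply: absval_equiv_sym => //.
  exact: (absval_equiv_sub (@subsetT _ _) eqv).
split; first exact: place_place_of.
by exists psi; split=> //; exact: place_of_self.
Qed.

Lemma restriction_exists (x : Xt S) K : number_field K -> exists2 j : J S, jK j = K & over j x.
Proof.
move=> nfK; have [psi psiS e] := X_S_absval x; have [j [jKe jve]] := S_absval_J psiS nfK.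
exists j => //; apply/(overP _ psiS e); rewrite jve; apply: place_of_self.
by have [avT avQ _] := psiS; exact: absval_number_field.
Qed.

Lemma over_inj (x : Xt S) (j j' : J S) : jK j = jK j' -> over j x -> over j' x -> j = j'.
Proof.
move=> eK; have [psi psiS e] := X_S_absval x.
move=> /(overP _ psiS e) h /(overP _ psiS e) h'; apply: J_eq => //.
by rewrite (placeE (jv_place j) h) (placeE (jv_place j') h') eK.
Qed.

Lemma over_exists (j : J S) : exists x, over j x.
Proof.
have [psi psiS vpsi] := J_S_absval j; have [x e] := S_absval_X psiS.
by exists x; apply/(overP _ psiS e).
Qed.

(** A single point above [w] decides divisibility, so later arguments compare points instead of
    absolute values. *)
Lemma over_divides (j w : J S) (x : Xt S) : jK j `<=` jK w -> over w x ->
  divides (jK j) (jv j) (jv w) <-> over j x.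
Proof.
move=> KL; have [psi psiS e] := X_S_absval x.
have [avT avQ _] := psiS; have avK := absval_number_field avT avQ (jK_nf j).
move=> /(overP _ psiS e) h; rewrite (overP _ psiS e).
split=> [[chi [wchi vchi]]|vpsi]; last by exists psi.
apply: (place_equiv (jv_place j) vchi avK).
exact: absval_equiv_sub KL (place_mem_equiv (jv_place w) wchi h).
Qed.

Lemma lam_gt0 (j : J S) : 0 < lam j.
Proof.
have [psi [avT avQ _] vpsi] := J_S_absval j.
have nfK := jK_nf j; have [m [r [nu PA]]] := places_above_exist avT avQ nfK nfK (@subset_refl _ _).
have [l0 _] := local_degree_sum avT avQ nfK nfK (@subset_refl _ _) PA.
by rewrite /lam divr_gt0 ?ltr0n ?(degree_gt0 nfK) // (placeE (jv_place j) vpsi).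
Qed.

(** The places above [j] are the classes of the [psi (nu i x)], pairwise inequivalent. The sum
    formula for [lam] is the local degree formula divided by [degree L], which is [m] times the
    degree below. *)
Lemma divisors_finite (j : J S) L : number_field L -> jK j `<=` L ->
  exists ws : seq (J S), [/\ uniq ws,
    forall w, w \in ws <-> jK w = L /\ divides (jK j) (jv j) (jv w) &
    lam j = \sum_(w <- ws) lam w].
Proof.
move=> nfL KL; have nfK := jK_nf j.
have [psi psiS vpsi] := J_S_absval j; have [avT avQ _] := psiS.
have [m [r [nu PA]]] := places_above_exist avT avQ nfK nfL KL.
have [l0 ls] := local_degree_sum avT avQ nfK nfL KL PA.
have /choice[w wP] : forall i, exists w : J S,
    jK w = L /\ jv w = place_of L (fun x => psi (nu i x)).
  by move=> i; apply: S_absval_J => //; exact: S_absval_comp.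
have avw i := pa_absval PA i.
have w_inj : injective w.
  move=> i i' e; apply/eqP; apply: contraT => /(pa_inequiv PA)[].
  have [_ e1] := wP i; have [_ e2] := wP i'.
  have : place_of L (fun x => psi (nu i x)) (fun x => psi (nu i' x)).
    by rewrite -e1 e e2; exact: place_of_self.
  by case.
exists (map w (enum 'I_r)); split.
- by rewrite map_inj_uniq ?enum_uniq.
- move=> w'; split=> [/mapP[i _ ->]|[eK [chi [wchi vchi]]]].
    have [-> ->] := wP i; split=> //; exists (fun x => psi (nu i x)); split.
      exact: place_of_self.
    apply: (place_ext (number_field_subfield nfK) (jv_place j) vpsi) => x Kx.
    by rewrite (pa_fix PA).
  have pw' := jv_place w'; have av := place_absval pw' wchi; rewrite eK in av pw'.
  have [i ei] := pa_complete PA av (place_mem_equiv (jv_place j) vpsi vchi).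
  have [e1 e2] := wP i; apply/mapP; exists i; first by rewrite mem_enum.
  apply: J_eq; first by rewrite eK.
  rewrite e2 (placeE pw' wchi); apply/esym.
  exact: (placeE (place_place_of (avw i)) (conj av ei)).
rewrite big_map big_enum /= /lam.
rewrite (eq_bigr (fun i => (local_degree L (place_of L (fun x => psi (nu i x))))%:R /
    (degree L)%:R)) => [|i _]; last by have [-> ->] := wP i.
have m0 : (0 < m)%N.
  by have := degree_gt0 nfL; rewrite (pa_degree PA) muln_gt0 => /andP[].
rewrite -mulr_suml -natr_sum ls (placeE (jv_place j) vpsi) (pa_degree PA) !natrM.
have d0 : (degree (jK j))%:R != 0 :> R by rewrite pnatr_eq0 -lt0n degree_gt0.
have m0' : m%:R != 0 :> R by rewrite pnatr_eq0 -lt0n.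
by field; rewrite d0 m0'.
Qed.

Lemma lam_consistent : consistent (@lam R S).
Proof.
move=> j L nfL KL; have [ws [uws wsP ->]] := divisors_finite nfL KL.
exists ws; split; first exact/List_NoDupP; split=> // w.
rewrite List_InP wsP; split=> [|[]//] H; split=> //.
by rewrite gt_eqF // lam_gt0.
Qed.

End JLevel.

(** * Compactness of the sets of points above a place *)

Section Compactness.
Variables (R : realType) (S : set (set (algC -> R))).
Hypothesis HS : forall s, S s -> place Qset s.

Lemma Ybasis_J K v (x : Xt S) : number_field K -> place K v -> Ybasis K v (proj1_sig x) ->
  exists j : J S, [/\ jK j = K, jv j = v & over j x].
Proof.
move=> nfK pv yb; have [psi psiS e] := X_S_absval HS x.
have [avT avQ _] := psiS; have avK := absval_number_field avT avQ nfK.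
have [_ [chi []]] := yb; rewrite e => -[_ eqv] vchi.
have eqK := absval_equiv_sub (@subsetT _ K) eqv.
have vpsi : v psi.
  by apply: (place_equiv pv vchi avK); exact: absval_equiv_sym.
have [j [jKe jve]] := S_absval_J psiS nfK.
have jv' : jv j = v by rewrite jve -(placeE pv vpsi).
by exists j; split=> //; rewrite /over jKe jv'.
Qed.

Lemma divides_trans (j w w' : J S) : jK j `<=` jK w -> jK w `<=` jK w' ->
  divides (jK j) (jv j) (jv w) -> divides (jK w) (jv w) (jv w') ->
  divides (jK j) (jv j) (jv w').
Proof.
move=> KL LM jw ww'; have [x ox] := over_exists HS w'.
have ow : over w x by apply/(over_divides HS LM ox).
apply/(over_divides HS _ ox); first exact: subset_trans LM.
by apply/(over_divides HS KL ow).
Qed.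

(** A representative of [w] may differ from [psi] on the base field by an exponent, but [w] is also
    the class of some [psi (nu i x)], and [nu i] fixes the base field. *)
Lemma normalized_rep (j w : J S) psi : jK j `<=` jK w ->
  divides (jK j) (jv j) (jv w) -> S_absval S psi -> jv j psi ->
  exists psi', [/\ S_absval S psi', jv w psi' & forall x, jK j x -> psi' x = psi x].
Proof.
move=> KL [chi [wchi vchi]] psiS vpsi; have [avT avQ _] := psiS.
have [m [r [nu PA]]] := places_above_exist avT avQ (jK_nf j) (jK_nf w) KL.
have av := place_absval (jv_place w) wchi.
have [i ei] := pa_complete PA av (place_mem_equiv (jv_place j) vpsi vchi).
exists (fun x => psi (nu i x)); split.
- exact: S_absval_comp.
- apply: (place_equiv (jv_place w) wchi (pa_absval PA i)).
  exact: absval_equiv_sym (pa_absval PA i) ei.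
- by move=> x Kx; rewrite (pa_fix PA).
Qed.

Section Koenig.
Variables (j0 : J S) (Fam : set (set (Xt S))).
Hypothesis Fopen : forall U, Fam U -> openX U.
Hypothesis Fcover : forall x, over j0 x -> exists U, Fam U /\ U x.

Definition coverable (w : J S) := exists s : seq (set (Xt S)),
  (forall U, List.In U s -> Fam U) /\
  forall x, over w x -> exists U, List.In U s /\ U x.

(** Finitely many places lie above [w] in a field containing [z]; finite covers for all of them
    would combine to one for [w]. *)
Lemma uncoverable_step (w : J S) (z : algC) : ~ coverable w ->
  exists w' : J S, [/\ ~ coverable w', jK w `<=` jK w', jK w' z &
                       divides (jK w) (jv w) (jv w')].
Proof.
move=> bad; have [L [nfL KL zL]] := number_field_ext [:: z] (jK_nf w).
have [ws [_ wsP _]] := divisors_finite HS nfL KL.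
apply: contrapT => H; apply: bad.
have good w' : w' \in ws -> coverable w'.
  move=> /wsP[eK dv]; apply: contrapT => bad; apply: H; exists w'; rewrite eK.
  by split=> //; apply: zL; rewrite mem_head.
have [s [sF sC]] : exists s : seq (set (Xt S)), (forall U, List.In U s -> Fam U) /\
    forall w', w' \in ws -> forall x, over w' x -> exists U, List.In U s /\ U x.
  elim: ws good {wsP H} => [_|w1 ws IH good]; first by exists [::]; split.
  have [s1 [F1 C1]] := good w1 (mem_head _ _).
  have [s2 [F2 C2]] := IH (fun w' h => good w' (mem_behead (s := w1 :: ws) h)).
  exists (s1 ++ s2); split=> [U /List.in_app_iff[/F1|/F2]//|w'].
  rewrite inE => /orP[/eqP-> x /C1|/C2 H x /H] [U [sU Ux]]; exists U; split=> //;
    apply/List.in_app_iff; [by left | by right].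
exists s; split=> // x ox; have [w' eK ow'] := restriction_exists HS x nfL.
apply: (sC w') => //; apply/wsP; split=> //.
by apply/(over_divides HS _ ow') => //; rewrite eK.
Qed.

Hypothesis bad0 : ~ coverable j0.

Lemma uncoverable_chain : exists w : nat -> J S,
  [/\ w 0%N = j0, forall n, ~ coverable (w n),
      forall n, jK (w n) `<=` jK (w n.+1) /\ divides (jK (w n)) (jv (w n)) (jv (w n.+1)) &
      forall z, exists n, jK (w n) z].
Proof.
pose T := {w : J S | ~ coverable w}.
(* Since [algC] is countable, adjoining at stage [n] the number with code [n] exhausts it; 0 stands
   in where the code denotes nothing. *)
have H (p : nat * T) : exists t : T, [/\ jK (sval p.2) `<=` jK (sval t),
    jK (sval t) (odflt 0 (unpickle p.1)) &
    divides (jK (sval p.2)) (jv (sval p.2)) (jv (sval t))].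
  case: p => n [w bw] /=; have [w' [bw' h1 h2 h3]] := uncoverable_step (odflt 0 (unpickle n)) bw.
  by exists (exist _ w' bw').
have [nxt nxtP] := choice H.
pose W := fix W n : T := if n is k.+1 then nxt (k, W k) else exist _ j0 bad0.
exists (fun n => sval (W n)); split=> // [n|n|z]; first exact: (svalP (W n)).
  by have [h1 _ h3] := nxtP (n, W n).
exists (pickle z).+1; have [_ + _] := nxtP (pickle z, W (pickle z)).
by rewrite /= pickleK.
Qed.

(* The restrictions of a limit place are only compatible up to exponents; choosing
   representatives that all extend the same [psi] on the base field removes them. *)
Lemma uncoverable_absurd : False.
Proof.
have [w [w0 wbad wstep wfull]] := uncoverable_chain.
have Kmono n k : jK (w n) `<=` jK (w (n + k)%N).
  elim: k => [|k IH]; first by rewrite addn0.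
  by rewrite addnS; apply: subset_trans IH _; have [] := wstep (n + k)%N.
have dvd n k : divides (jK (w n)) (jv (w n)) (jv (w (n + k)%N)).
  elim: k => [|k IH].
    have [psi _ vpsi] := J_S_absval HS (w n).
    by rewrite addn0; exists psi.
  rewrite addnS; have [h1 h2] := wstep (n + k)%N.
  exact: divides_trans (Kmono n k) h1 IH h2.
have [psi psiS vpsi] := J_S_absval HS j0.
have /choice[ps psP] : forall n, exists psi', [/\ S_absval S psi', jv (w n) psi' &
    forall x, jK j0 x -> psi' x = psi x].
  move=> n; apply: normalized_rep => //.
    by have := Kmono 0%N n; rewrite add0n w0.
  by have := dvd 0%N n; rewrite add0n w0.
have agree n k x : jK (w n) x -> ps (n + k)%N x = ps n x.
  have [psS vn en] := psP n; have [psS' vnk enk] := psP (n + k)%N.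
  have [avT avQ _] := psS; have [avT' avQ' _] := psS'.
  have K0n : jK j0 `<=` jK (w n) by have := Kmono 0%N n; rewrite add0n w0.
  apply: (absval_equiv_eq (number_field_subfield (jK_nf j0)) _ _ K0n).
  - exact: (absval_number_field avT avQ (jK_nf j0)).
  - exact: (absval_number_field avT avQ (jK_nf (w n))).
  - apply: (place_mem_equiv (jv_place (w n)) vn).
    have [chi [wchi vchi]] := dvd n k.
    apply: (place_equiv (jv_place (w n)) vchi).
      exact: (absval_number_field avT' avQ' (jK_nf (w n))).
    apply: (absval_equiv_sub (Kmono n k)).
    exact: (place_mem_equiv (jv_place (w (n + k)%N)) wchi vnk).
  - by move=> z Kz; rewrite enk // en.
have [N NP] := choice wfull.
pose Psi z := ps (N z) z.
have PsiE n z : jK (w n) z -> Psi z = ps n z.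
  move=> Kz; rewrite /Psi; have [h|/ltnW h] := leqP (N z) n.
    by rewrite -(subnKC h) agree //; exact: NP.
  by rewrite -{1}(subnKC h) agree.
have common x y : exists n, jK (w n) x /\ jK (w n) y.
  exists (N x + N y)%N; split; first exact: Kmono (NP x).
  by rewrite addnC; exact: Kmono (NP y).
have psT n : absval setT (ps n) by have [[]] := psP n.
have Q0 x : Qset x -> Psi x = psi x.
  move=> Qx; have Kx : jK j0 x by exact: (number_field_Qsub (jK_nf j0)).
  by rewrite (PsiE 0%N) ?w0 //; have [_ _] := psP 0%N; apply.
have sfQ := number_field_subfield number_field_Q.
have PsiS : S_absval S Psi.
  have [avT avQ [s Ss spsi]] := psiS.
  split; last by exists s => //; exact: (place_ext sfQ (HS Ss) spsi Q0).
    split; first by move=> x _; exact: (absval_ge0 (psT _)).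
    split; first by move=> x _; exact: (absval_eq0 (psT _)).
    split.
      move=> x y _ _; have [n [nx ny]] := common x y.
      have nxy := subfieldM (number_field_subfield (jK_nf (w n))) nx ny.
      by rewrite !(PsiE n) // (absvalM (psT n)).
    split.
      move=> x y _ _; have [n [nx ny]] := common x y.
      have nxy := subfieldD (number_field_subfield (jK_nf (w n))) nx ny.
      by rewrite !(PsiE n) // (absvalD (psT n)).
    by have [x [Qx x0 x1]] := absval_nontrivial avQ; exists x; rewrite Q0.
  exact: absval_ext Q0 avQ.
have [x xE] := S_absval_X PsiS.
have ox n : over (w n) x.
  apply/(overP _ PsiS xE); have [_ vn _] := psP n.
  apply: (place_ext (number_field_subfield (jK_nf (w n))) (jv_place (w n)) vn) => z.
  exact: PsiE.
have [U [FU Ux]] : exists U, Fam U /\ U x by apply: Fcover; rewrite -w0.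
have [K' [v' [nfK' [pv' [yb sub]]]]] := Fopen FU Ux.
have [j' [jK' jv' oj']] := Ybasis_J nfK' pv' yb.
have [d [e [Ke spe]]] := number_field_span nfK'.
(* The sum is an index beyond all [N (e i)], so this field of the chain contains [K']. All points
   above [w n] then lie in [U], and one open set covers them. *)
pose n := (\sum_(i < d) N (e i))%N.
have sfn := number_field_subfield (jK_nf (w n)).
have Kn : jK j' `<=` jK (w n).
  rewrite jK' => y /spe[a ->]; apply: (subfield_sum sfn) => i _.
  apply: (subfieldM sfn); first exact: subfield_rat.
  by rewrite /n (bigD1 i) //=; exact: Kmono (NP (e i)).
have dvn : divides (jK j') (jv j') (jv (w n)) by apply/(over_divides HS Kn (ox n)).
apply: (wbad n); exists [:: U]; split=> [V [<-|[]]//|x' ox'].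
exists U; split; first by left.
apply: sub; rewrite -jK' -jv'.
by apply/(over_divides HS Kn ox').
Qed.

End Koenig.

Lemma over_compact (j : J S) : compactX [set x | over j x].
Proof.
move=> Fam Fo Fc; apply: contrapT => bad.
exact: (uncoverable_absurd Fo Fc bad).
Qed.

End Compactness.

(** * Consistent maps and functionals *)

Lemma uniq_flatten_map (T U : eqType) (s : seq T) (F : T -> seq U) : uniq s ->
  (forall t, uniq (F t)) -> (forall t t' u, u \in F t -> u \in F t' -> t = t') ->
  uniq (flatten [seq F t | t <- s]).
Proof.
move=> us uF dF; elim: s us => [//|t s IH] /= /andP[ts us].
rewrite cat_uniq uF IH // andbT /=; apply/hasPn => u /flattenP[_ /mapP[t' st' ->] ut'].
by apply/negP => ut; move: ts; rewrite (dF _ _ _ ut ut') st'.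
Qed.

Section Functionals.
Variables (R : realType) (S : set (set (algC -> R))).
Hypothesis HS : forall s, S s -> place Qset s.
Implicit Types (f : Xt S -> R) (c g : J S -> R) (j w : J S).

Lemma is_finsum_seq (A : set (J S)) (F : J S -> R) (s : seq (J S)) : uniq s ->
  (forall j, j \in s -> A j) -> (forall j, A j -> F j != 0 -> j \in s) ->
  is_finsum A F (\sum_(j <- s) F j).
Proof.
move=> us sA As; exists [seq j <- s | F j != 0]; split.
  by apply/List_NoDupP; exact: filter_uniq.
split.
  move=> j; rewrite List_InP mem_filter; split=> [/andP[F0 /sA]//|[Aj F0]].
  by rewrite F0 As.
rewrite big_filter [LHS](bigID (fun j => F j != 0)) /= [X in _ + X]big1 ?addr0 //.
by move=> j /negPn/eqP.
Qed.

Lemma is_finsum_unique (A : set (J S)) (F : J S -> R) r r' :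
  is_finsum A F r -> is_finsum A F r' -> r = r'.
Proof.
move=> [s [/List_NoDupP us [sP ->]]] [s' [/List_NoDupP us' [sP' ->]]].
apply: perm_big; apply: uniq_perm => // j.
by apply/idP/idP => /List_InP h; apply/List_InP; [apply/sP'/sP | apply/sP/sP'].
Qed.

Definition divisor_list j (L : set algC) (ws : seq (J S)) :=
  uniq ws /\ forall w, w \in ws <-> jK w = L /\ divides (jK j) (jv j) (jv w).

Lemma divisor_list_exists j L : number_field L -> jK j `<=` L ->
  exists ws, divisor_list j L ws.
Proof. by move=> nfL KL; have [ws [u P _]] := divisors_finite HS nfL KL; exists ws. Qed.

Lemma consistentP c : consistent c <-> forall j L ws, number_field L -> jK j `<=` L ->
  divisor_list j L ws -> c j = \sum_(w <- ws) c w.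
Proof.
split=> [cc j L ws nfL KL [uws wsP]|H j L nfL KL].
  apply: is_finsum_unique (cc j L nfL KL) _; apply: is_finsum_seq => // w.
    by move=> /wsP.
  by move=> h _; apply/wsP.
have [ws wsP] := divisor_list_exists nfL KL; rewrite (H j L ws) //.
have [uws wsE] := wsP; apply: is_finsum_seq => // w; first by move=> /wsE.
by move=> h _; apply/wsE.
Qed.

Lemma consistent_lin c1 c2 a b : consistent c1 -> consistent c2 ->
  consistent (fun j => a * c1 j + b * c2 j).
Proof.
move=> /consistentP h1 /consistentP h2; apply/consistentP => j L ws nfL KL wsP.
by rewrite (h1 j L ws) // (h2 j L ws) // !mulr_sumr -big_split.
Qed.

Lemma point_exists : exists pt : J S -> Xt S, forall j, over j (pt j).
Proof. by have [pt ptP] := choice (over_exists HS); exists pt. Qed.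

(** The list may contain zeros of [g], so that two functions can share one list. *)
Definition places_seq (K : set algC) (g : J S -> R) (s : seq (J S)) :=
  [/\ uniq s, forall j, j \in s -> jK j = K & forall j, jK j = K -> g j != 0 -> j \in s].

Lemma adapted_seq K f g : adapted K f g -> exists s, places_seq K g s.
Proof.
move=> [nfK [fg [s sP]]]; exists (undup [seq j <- s | `[< jK j = K >]]); split.
- exact: undup_uniq.
- by move=> j; rewrite mem_undup mem_filter => /andP[/asboolP].
- move=> j jKe g0; rewrite mem_undup mem_filter; apply/andP; split; first exact/asboolP.
  by apply/List_InP; exact: sP.
Qed.

Lemma places_seq_adapted K f g s : number_field K -> places_seq K g s ->
  (forall j x, jK j = K -> over j x -> f x = g j) -> adapted K f g.
Proof.
move=> nfK [us sK sg] fg; split=> //; split=> [j jKe x ox|].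
  by apply: fg => //; rewrite /over jKe.
by exists s => j jKe g0; apply/List_InP; exact: sg.
Qed.

Lemma adapted_over K f g j x : adapted K f g -> jK j = K -> over j x -> f x = g j.
Proof. by move=> [_ [fg _]] jKe ox; apply: fg => //; rewrite -jKe. Qed.

Lemma over_trans j w x : jK j `<=` jK w -> divides (jK j) (jv j) (jv w) ->
  over w x -> over j x.
Proof. by move=> KL dv ow; apply/(over_divides HS KL ow). Qed.

(** Each place in [s] is replaced by the places of [L] above it: [f] keeps its value there, and
    consistency splits [c j] accordingly. *)
Lemma adapted_refine c K L f g s : consistent c -> adapted K f g -> places_seq K g s ->
  number_field L -> K `<=` L -> exists g' s',
  [/\ adapted L f g', places_seq L g' s' &
      \sum_(j <- s) c j * g j = \sum_(w <- s') c w * g' w].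
Proof.
move=> /consistentP cc ad [us sK sg] nfL KL; have [pt ptP] := point_exists.
have [nfK _] := ad.
have /choice[ws wsP] : forall j, exists ws, if j \in s then divisor_list j L ws else ws = [::].
  move=> j; have [/sK jKe|_] := boolP (j \in s); last by exists [::].
  by apply: divisor_list_exists => //; rewrite jKe.
have wsD j : j \in s -> divisor_list j L (ws j) by move=> js; have := wsP j; rewrite js.
have ws_in j w : w \in ws j -> [/\ j \in s, jK w = L & forall x, over w x -> over j x].
  have := wsP j; case: ifP => [js [_ wsE]|_ ->//] /wsE[eL dv]; split=> // x ox.
  by apply: over_trans dv ox; rewrite eL sK.
have gw j w : w \in ws j -> f (pt w) = g j.
  by move=> /ws_in[js eL ow]; apply: adapted_over ad (sK _ js) _; exact: ow.
(* The lists [ws j] are disjoint because a point lies over only one place of [K]. *)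
have P' : places_seq L (fun w => f (pt w)) (flatten [seq ws j | j <- s]).
  split.
  - apply: uniq_flatten_map => // [j|j j' w /ws_in[js _ o1] /ws_in[js' _ o2]].
      by have := wsP j; case: ifP => [_ []|_ ->].
    by apply: (over_inj HS (x := pt w)); [rewrite !sK | exact: o1 | exact: o2].
  - by move=> w /flattenP[_ /mapP[j js ->]] /ws_in[].
  move=> w eL fw; have [j eK oj] := restriction_exists HS (pt w) nfK.
  have js : j \in s by apply: sg => //; rewrite -(adapted_over ad eK oj).
  apply/flattenP; exists (ws j); first exact: map_f.
  have [_ wsE] := wsD _ js; apply/wsE; split=> //.
  by apply/(over_divides HS _ (ptP w)) => //; rewrite eK eL.
exists (fun w => f (pt w)), (flatten [seq ws j | j <- s]); split=> //.
  apply: places_seq_adapted P' _ => // w x eL ox.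
  have [j eK oj] := restriction_exists HS (pt w) nfK.
  have KL' : jK j `<=` jK w by rewrite eK eL.
  have dv : divides (jK j) (jv j) (jv w) by apply/(over_divides HS KL' (ptP w)).
  by rewrite (adapted_over ad eK oj) (adapted_over ad eK (over_trans KL' dv ox)).
rewrite big_flatten big_map; apply: eq_big_seq => j js /=.
have -> : c j = \sum_(w <- ws j) c w by apply: cc (wsD _ js) => //; rewrite sK.
by rewrite mulr_suml; apply: eq_big_seq => w /gw ->.
Qed.

Lemma places_seq_sum_eq K f g g' s s' c : adapted K f g -> adapted K f g' ->
  places_seq K g s -> places_seq K g' s' ->
  \sum_(j <- s) c j * g j = \sum_(j <- s') c j * g' j.
Proof.
move=> ad ad' [us sK sg] [us' sK' sg'].
have gg' j : jK j = K -> g j = g' j.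
  move=> eK; have [x ox] := over_exists HS j.
  by rewrite -(adapted_over ad eK ox) (adapted_over ad' eK ox).
apply: (@is_finsum_unique [set j | jK j = K] (fun j => c j * g j)).
  apply: is_finsum_seq => // j /= eK; apply: contraNT => js.
  by apply/eqP; rewrite (_ : g j = 0) ?mulr0 //; apply/eqP; apply: contraNT js; exact: sg.
rewrite (eq_big_seq (fun j => c j * g j)) => [|j /sK' eK]; last by rewrite gg'.
apply: is_finsum_seq => // j /= eK; apply: contraNT => js.
apply/eqP; rewrite (_ : g j = 0) ?mulr0 //; apply/eqP; apply: contraNT js => gj.
by apply: sg' => //; rewrite -gg'.
Qed.

(** Independence of the adapted field: any other one is compared with [K] in a common extension. *)
Lemma PhiE c K f g s : consistent c -> adapted K f g -> places_seq K g s ->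
  Phi c f = \sum_(j <- s) c j * g j.
Proof.
move=> cc ad ps; apply: xget_unique.
  exists K, g; split=> //; have [us sK sg] := ps; apply: is_finsum_seq => // j /= eK.
  by move=> h; apply: sg => //; apply: contraNneq h => ->; rewrite mulr0.
move=> r' [K' [g' [ad' fs']]]; have [s' ps'] := adapted_seq ad'.
have -> : r' = \sum_(j <- s') c j * g' j.
  apply: is_finsum_unique fs' _; have [us sK sg] := ps'.
  apply: is_finsum_seq => // j /= eK.
  by move=> h; apply: sg => //; apply: contraNneq h => ->; rewrite mulr0.
have [nfK _] := ad; have [nfK' _] := ad'.
have [M [nfM KM K'M]] := number_field_sub_ext nfK nfK'.
have [g1 [s1 [ad1 ps1 ->]]] := adapted_refine cc ad ps nfM KM.
have [g2 [s2 [ad2 ps2 ->]]] := adapted_refine cc ad' ps' nfM K'M.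
exact: places_seq_sum_eq ad2 ad1 ps2 ps1.
Qed.

Lemma over_open j : openX [set x : Xt S | over j x].
Proof.
move=> x /= ox; exists (jK j), (jv j); split; first exact: jK_nf.
by split; first exact: jv_place.
Qed.

Lemma adapted_LCc K f g : adapted K f g -> LCc f.
Proof.
move=> ad; have [nfK _] := ad; have [s [us sK sg]] := adapted_seq ad.
split.
  move=> x; have [j eK ox] := restriction_exists HS x nfK.
  exists [set z | over j z]; split; first exact: over_open.
  by split=> // z oz; rewrite (adapted_over ad eK oz) (adapted_over ad eK ox).
(* [f] is constant on an open neighbourhood of each point, so its nonvanishing set is already
   closed. *)
have supp x : closureX [set x | f x != 0] x -> f x != 0.
  move=> cx; have [j eK ox] := restriction_exists HS x nfK.
  have [z [oz /= fz]] := cx _ (@over_open j) ox.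
  by rewrite (adapted_over ad eK ox) -(adapted_over ad eK oz).
move=> Fam Fo Fc.
have cov j : j \in s -> exists t : seq (set (Xt S)), (forall U, List.In U t -> Fam U) /\
    forall x, over j x -> f x != 0 -> exists U, List.In U t /\ U x.
  move=> js; have [g0|g0] := eqVneq (g j) 0.
    by exists [::]; split=> // x ox; rewrite (adapted_over ad (sK _ js) ox) g0 eqxx.
  have [|t [tF tC]] := over_compact HS Fo (j := j).
    move=> x ox; apply: Fc => U oU Ux; exists x; split=> //=.
    by rewrite (adapted_over ad (sK _ js) ox).
  by exists t; split=> // x ox _; exact: tC.
have [t [tF tC]] : exists t : seq (set (Xt S)), (forall U, List.In U t -> Fam U) /\
    forall j, j \in s -> forall x, over j x -> f x != 0 -> exists U, List.In U t /\ U x.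
  elim: s cov {us sK sg} => [_|j s IH cov]; first by exists [::]; split.
  have [t1 [F1 C1]] := cov j (mem_head _ _).
  have [t2 [F2 C2]] := IH (fun w h => cov w (mem_behead (s := j :: s) h)).
  exists (t1 ++ t2); split=> [U /List.in_app_iff[/F1|/F2]//|w].
  rewrite inE => /orP[/eqP-> x /C1 H f0|/C2 H x /H {}H f0];
    have [U [tU Ux]] := H f0; exists U; split=> //;
    apply/List.in_app_iff; [by left | by right].
exists t; split=> // x /supp fx; have [j eK ox] := restriction_exists HS x nfK.
by apply: (tC j) => //; apply: sg => //; rewrite -(adapted_over ad eK ox).
Qed.

Lemma number_field_all (js : seq (J S)) K0 : number_field K0 ->
  exists K, [/\ number_field K, K0 `<=` K & forall j, j \in js -> jK j `<=` K].
Proof.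
move=> nf0; elim: js => [|j js [K [nfK K0K jsK]]]; first by exists K0; split.
have [M [nfM KM jM]] := number_field_sub_ext nfK (jK_nf j).
exists M; split=> // [|w]; first exact: subset_trans KM.
by rewrite inE => /orP[/eqP->//|/jsK h]; exact: subset_trans KM.
Qed.

(** Compactness covers the support by finitely many sets of points above places [js] on which [f] is
    constant; a field containing the fields of all of them is adapted to [f]. *)
Lemma LCc_adapted f : LCc f -> exists K g, adapted K f g.
Proof.
move=> [lcf cpt]; have [pt ptP] := point_exists.
pose cst j := forall z z', over j z -> over j z' -> f z = f z'.
pose Fam := [set U | exists2 j, cst j & U = [set z | over j z]].
have loc x : exists2 j, cst j & over j x.
  have [U [oU [Ux fU]]] := lcf x; have [K [v [nfK [pv [yb sub]]]]] := oU x Ux.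
  have [j [jKe jve ox]] := Ybasis_J HS nfK pv yb; exists j => // z z' oz oz'.
  by rewrite !fU //; apply: sub; rewrite -jKe -jve.
have [U [j _ ->]|x _|t [tF tC]] := cpt Fam; first exact: over_open.
  by have [j cj ox] := loc x; exists [set z | over j z]; split=> //; exists j.
have [js [jsc jsC]] : exists js : seq (J S), (forall j, j \in js -> cst j) /\
    forall U, List.In U t -> exists2 j, j \in js & U = [set z | over j z].
  elim: t tF {tC} => [_|U t IH tF]; first by exists [::]; split.
  have [j cj ->] := tF U (or_introl erefl).
  have [js [jsc jsC]] := IH (fun V h => tF V (or_intror h)).
  exists (j :: js); split=> [w|V [<-|/jsC[w wj ->]]].
  - by rewrite inE => /orP[/eqP->//|/jsc].
  - by exists j; rewrite ?mem_head.
  - by exists w => //; rewrite inE wj orbT.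
have cover x : f x != 0 -> exists2 j, j \in js & over j x.
  move=> fx; have [|U [tU Ux]] := tC x; first by move=> V oV Vx; exists x.
  by have [j jj e] := jsC U tU; exists j => //; move: Ux; rewrite e.
have [K [nfK _ jsK]] := number_field_all js number_field_Q.
have /choice[ws wsP] : forall j, exists ws, j \in js -> divisor_list j K ws.
  move=> j; have [jj|_] := boolP (j \in js); last by exists [::].
  by have [ws h] := divisor_list_exists nfK (jsK j jj); exists ws.
have fE w x : jK w = K -> over w x -> f x != 0 ->
    (exists2 j, j \in js & w \in ws j) /\ forall z, over w z -> f z = f x.
  move=> eK ox fx; have [j jj oj] := cover x fx.
  have KL : jK j `<=` jK w by rewrite eK; exact: jsK.
  have dv : divides (jK j) (jv j) (jv w) by apply/(over_divides HS KL ox).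
  split; first by exists j => //; have [_ h] := wsP j jj; apply/h.
  by move=> z oz; apply: (jsc j) => //; exact: over_trans oz.
exists K, (fun w => f (pt w)); split=> //; split.
  move=> w eK x; rewrite -eK -/(over w x) => ox.
  (* A nonzero value at [x] or at [pt w] spreads to every point above [w]; otherwise both values are
     0. *)
  have [fx|fx] := eqVneq (f x) 0; last first.
    by have [_ h] := fE w x eK ox fx; rewrite h.
  have [fp|fp] := eqVneq (f (pt w)) 0; first by rewrite fx fp.
  by have [_ h] := fE w (pt w) eK (ptP w) fp; exact: h.
exists (flatten [seq ws j | j <- js]) => w eK fw; apply/List_InP/flattenP.
have [[j jj wj] _] := fE w (pt w) eK (ptP w) fw.
by exists (ws j) => //; exact: map_f.
Qed.

Lemma places_seqW K g s s' : places_seq K g s -> uniq s' ->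
  (forall j, j \in s' -> jK j = K) -> {subset s <= s'} -> places_seq K g s'.
Proof. by move=> [_ _ sg] us' sK' ss'; split=> // j eK g0; apply/ss'/sg. Qed.

Lemma LCc_common f1 f2 : LCc f1 -> LCc f2 -> exists K g1 g2 s,
  [/\ adapted K f1 g1, adapted K f2 g2, places_seq K g1 s & places_seq K g2 s].
Proof.
move=> /LCc_adapted[K1 [g1 ad1]] /LCc_adapted[K2 [g2 ad2]].
have [nf1 _] := ad1; have [nf2 _] := ad2.
have [s1 ps1] := adapted_seq ad1; have [s2 ps2] := adapted_seq ad2.
have [M [nfM KM1 KM2]] := number_field_sub_ext nf1 nf2.
(* Only the passage to [M] matters here; [lam] is supplied as a consistent map and the equality of
   sums is dropped. *)
have [h1 [t1 [a1 p1 _]]] := adapted_refine (lam_consistent HS) ad1 ps1 nfM KM1.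
have [h2 [t2 [a2 p2 _]]] := adapted_refine (lam_consistent HS) ad2 ps2 nfM KM2.
exists M, h1, h2, (undup (t1 ++ t2)).
have tM j : j \in undup (t1 ++ t2) -> jK j = M.
  have [_ k1 _] := p1; have [_ k2 _] := p2.
  by rewrite mem_undup mem_cat => /orP[/k1|/k2].
split=> //.
  apply: places_seqW p1 _ tM _; first exact: undup_uniq.
  by move=> j; rewrite mem_undup mem_cat => ->.
apply: places_seqW p2 _ tM _; first exact: undup_uniq.
by move=> j; rewrite mem_undup mem_cat => ->; rewrite orbT.
Qed.

Lemma adapted_lin K f1 f2 g1 g2 s a b : adapted K f1 g1 -> adapted K f2 g2 ->
  places_seq K g1 s -> places_seq K g2 s ->
  adapted K (fun x => a * f1 x + b * f2 x) (fun j => a * g1 j + b * g2 j) /\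
  places_seq K (fun j => a * g1 j + b * g2 j) s.
Proof.
move=> ad1 ad2 [us sK sg1] [_ _ sg2]; have [nfK _] := ad1.
have ps : places_seq K (fun j => a * g1 j + b * g2 j) s.
  split=> // j eK; apply: contraNT => js.
  have -> : g1 j = 0 by apply/eqP; apply: contraNT js; exact: sg1.
  have -> : g2 j = 0 by apply/eqP; apply: contraNT js; exact: sg2.
  by rewrite !mulr0 addr0.
split=> //; apply: places_seq_adapted ps _ => // j x eK ox.
by rewrite (adapted_over ad1 eK ox) (adapted_over ad2 eK ox).
Qed.

Lemma LCc_lin f1 f2 a b : LCc f1 -> LCc f2 -> LCc (fun x => a * f1 x + b * f2 x).
Proof.
move=> l1 l2; have [K [g1 [g2 [s [a1 a2 p1 p2]]]]] := LCc_common l1 l2.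
by have [ad _] := adapted_lin a b a1 a2 p1 p2; exact: adapted_LCc ad.
Qed.

Lemma Phi_lin c f1 f2 a b : consistent c -> LCc f1 -> LCc f2 ->
  Phi c (fun x => a * f1 x + b * f2 x) = a * Phi c f1 + b * Phi c f2.
Proof.
move=> cc l1 l2; have [K [g1 [g2 [s [a1 a2 p1 p2]]]]] := LCc_common l1 l2.
have [ad ps] := adapted_lin a b a1 a2 p1 p2.
rewrite (PhiE cc ad ps) (PhiE cc a1 p1) (PhiE cc a2 p2) !mulr_sumr -big_split.
by apply: eq_bigr => j _ /=; ring.
Qed.

Lemma Phi_lin_consistent c1 c2 f a b : consistent c1 -> consistent c2 -> LCc f ->
  Phi (fun j => a * c1 j + b * c2 j) f = a * Phi c1 f + b * Phi c2 f.
Proof.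
move=> cc1 cc2 /LCc_adapted[K [g ad]]; have [s ps] := adapted_seq ad.
rewrite (PhiE (consistent_lin a b cc1 cc2) ad ps) (PhiE cc1 ad ps) (PhiE cc2 ad ps).
by rewrite !mulr_sumr -big_split; apply: eq_bigr => j _ /=; ring.
Qed.

Lemma L0_lin f1 f2 a b : L0 f1 -> L0 f2 -> L0 (fun x => a * f1 x + b * f2 x).
Proof.
move=> [l1 i1] [l2 i2]; split; first exact: LCc_lin.
rewrite /integral Phi_lin //; last exact: lam_consistent.
by rewrite -/(integral f1) -/(integral f2) i1 i2 !mulr0 addr0.
Qed.

Lemma L0_zero : L0 (fun _ : Xt S => 0).
Proof.
have ps : places_seq Qset (fun=> 0) [::] by split=> // j _; rewrite eqxx.
have ad : adapted Qset (fun _ : Xt S => 0) (fun=> 0).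
  by apply: places_seq_adapted ps _ => //; exact: number_field_Q.
split; first exact: adapted_LCc ad.
by rewrite /integral (PhiE (lam_consistent HS) ad ps) big_nil.
Qed.

Definition indic j (x : Xt S) : R := `[< over j x >]%:R.

Lemma indic_adapted j : adapted (jK j) (indic j) (fun i => (i == j)%:R) /\
  places_seq (jK j) (fun i => (i == j)%:R) [:: j].
Proof.
have ps : places_seq (jK j) (fun i => (i == j)%:R) [:: j].
  split=> // [i|i _]; first by rewrite inE => /eqP->.
  by rewrite inE; case: (i == j) => //; rewrite eqxx.
split=> //; apply: places_seq_adapted ps _ => [|i x eK ox]; first exact: jK_nf.
rewrite /indic; congr (_%:R); congr nat_of_bool; apply/asboolP/eqP => [oj|<-//].
exact: (over_inj HS eK ox oj).
Qed.

Lemma indic_LCc j : LCc (indic j).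
Proof. by have [ad _] := indic_adapted j; exact: adapted_LCc ad. Qed.

Lemma Phi_indic c j : consistent c -> Phi c (indic j) = c j.
Proof.
move=> cc; have [ad ps] := indic_adapted j.
by rewrite (PhiE cc ad ps) big_seq1 eqxx mulr1.
Qed.

Lemma linL0_zero l : @linL0 R S l -> l (fun=> 0) = 0.
Proof.
move=> ll; have := ll (fun=> 0) (fun=> 0) 0 0 L0_zero L0_zero.
by rewrite !mul0r !addr0.
Qed.

Lemma linL0_sum l (s : seq (J S)) (a : J S -> R) (h : J S -> Xt S -> R) :
  linL0 l -> (forall j, L0 (h j)) ->
  L0 (fun x => \sum_(j <- s) a j * h j x) /\
  l (fun x => \sum_(j <- s) a j * h j x) = \sum_(j <- s) a j * l (h j).
Proof.
move=> ll Lh; elim: s => [|j s [Ls es]].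
  under eq_fun do rewrite big_nil; rewrite big_nil.
  by split; [exact: L0_zero | exact: linL0_zero].
have e : (fun x => \sum_(i <- j :: s) a i * h i x) =
    (fun x => a j * h j x + 1 * \sum_(i <- s) a i * h i x).
  by apply/funext => x; rewrite big_cons mul1r.
rewrite e; split; first exact: L0_lin.
by rewrite ll // es mul1r big_cons.
Qed.

Lemma adapted_decomp K f g s x : adapted K f g -> places_seq K g s ->
  f x = \sum_(j <- s) g j * indic j x.
Proof.
move=> ad [us sK sg]; have [nfK _] := ad.
have [j eK ox] := restriction_exists HS x nfK.
have ind i : i \in s -> i != j -> indic i x = 0.
  move=> /sK iK ij; rewrite /indic; case: asboolP => // oi.
  by rewrite (over_inj HS _ oi ox) ?eqxx ?iK // in ij.
have indj : indic j x = 1 by rewrite /indic; case: asboolP.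
rewrite (adapted_over ad eK ox); have [js|js] := boolP (j \in s).
  rewrite (bigD1_seq j) //= indj mulr1 big_seq_cond big1 ?addr0 // => i /andP[si ij].
  by rewrite ind ?mulr0.
have -> : g j = 0 by apply/eqP; apply: contraNT js; exact: sg.
rewrite big_seq big1 // => i si; rewrite ind ?mulr0 //.
by apply: contraNneq js => <-.
Qed.

Lemma indic_refine j L ws x : number_field L -> jK j `<=` L -> divisor_list j L ws ->
  indic j x = \sum_(w <- ws) indic w x.
Proof.
move=> nfL KL [uws wsE]; have [w eL ow] := restriction_exists HS x nfL.
have KL' : jK j `<=` jK w by rewrite eL.
have ind i : i \in ws -> i != w -> indic i x = 0.
  move=> /wsE[iK _] ij; rewrite /indic; case: asboolP => // oi.
  by rewrite (over_inj HS _ oi ow) ?eqxx ?iK // in ij.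
have [ww|ww] := boolP (w \in ws).
  rewrite (bigD1_seq w) //= big_seq_cond big1 ?addr0 => [|i /andP[si ij]]; last exact: ind.
  have /wsE[_ dv] := ww; rewrite /indic; case: asboolP => [_|[]].
    by case: asboolP.
  exact: over_trans dv ow.
rewrite big_seq big1 => [|i si]; last first.
  by apply: ind => //; apply: contraNneq ww => <-.
rewrite /indic; case: asboolP => // oj; case/negP: ww; apply/wsE; split=> //.
by apply/(over_divides HS KL' ow).
Qed.

Section Normalized.
Variable j0 : J S.

(* [indic j] corrected by a multiple of [indic j0] so as to have integral 0 *)
Definition indic0 j (x : Xt S) : R := 1 * indic j x + (- (lam j / lam j0)) * indic j0 x.

Lemma Phi_indic0 c j : consistent c -> Phi c (indic0 j) = c j - lam j / lam j0 * c j0.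
Proof.
move=> cc; rewrite /indic0 (Phi_lin _ _ cc) ?Phi_indic //; try exact: indic_LCc.
by rewrite mul1r mulNr.
Qed.

Lemma indic0_L0 j : L0 (indic0 j).
Proof.
split; first by apply: LCc_lin; exact: indic_LCc.
rewrite /integral Phi_indic0; last exact: lam_consistent.
by rewrite divfK ?subrr // gt_eqF // lam_gt0.
Qed.

(** Indicators and [lam] are both additive under passage to the places above, hence so is [indic0];
    linearity of [l] carries this over to its values. *)
Lemma consistent_of_linL0 l : linL0 l -> consistent (fun j => l (indic0 j)).
Proof.
move=> ll; apply/consistentP => j L ws nfL KL wsP.
have [_ e] := linL0_sum ws (fun=> 1) ll indic0_L0.
under eq_bigr => w _ do rewrite -[l _]mul1r.
rewrite -e; congr l; apply/funext => x; rewrite /indic0.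
under [RHS]eq_bigr => w _ do rewrite mul1r.
rewrite big_split /= -!mulr_suml -mulr_sumr (indic_refine x nfL KL wsP); congr (_ + _ * _).
have /consistentP/(_ j L ws nfL KL wsP)-> := lam_consistent HS.
by rewrite sumrN mulr_suml.
Qed.

(** Replacing [indic] by [indic0] in the decomposition of [f] changes it by a multiple of [indic j0]
    whose coefficient is proportional to the integral of [f], which is 0. *)
Lemma Phi_of_linL0 l f : linL0 l -> L0 f -> Phi (fun j => l (indic0 j)) f = l f.
Proof.
move=> ll [lf i0]; have [K [g ad]] := LCc_adapted lf; have [s ps] := adapted_seq ad.
rewrite (PhiE (consistent_of_linL0 ll) ad ps).
have [_ e] := linL0_sum s g ll indic0_L0.
under eq_bigr => j _ do rewrite mulrC.
rewrite -e; congr l; apply/funext => x; rewrite (adapted_decomp x ad ps) /indic0.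
under eq_bigr => j _ do rewrite mulrDr mul1r.
rewrite big_split /= [X in _ + X](_ : _ = 0) ?addr0 //.
move: i0; rewrite /integral (PhiE (lam_consistent HS) ad ps) => i0.
rewrite (eq_bigr (fun j => (lam j * g j) * (- (lam j0)^-1 * indic j0 x))).
  by rewrite -mulr_suml i0 mul0r.
by move=> j _; ring.
Qed.

(** Evaluation on [indic0 j] gives [c j - lam j / lam j0 * c j0 = 0]. *)
Lemma kernel_Phi c : consistent c -> (forall f, L0 f -> Phi c f = 0) ->
  forall j, c j = c j0 / lam j0 * lam j.
Proof.
move=> cc ker j; have := ker _ (indic0_L0 j); rewrite Phi_indic0 //.
by move/eqP; rewrite subr_eq0 => /eqP ->; ring.
Qed.

End Normalized.
End Functionals.

Theorem theorem1p3 (R : realType) (S : set (set (algC -> R)))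
  (HS : forall s, S s -> place Qset s) :
  (* lambda is consistent (so Lambda = R.lambda is a subspace of J^* ) *)
  consistent (@lam R S) /\
  (* Psi^*(c) = Phi_c|_{L_0} lies in L_0^* *)
  (forall c, consistent c -> @linL0 R S (Phi c)) /\
  (* Psi^* is linear *)
  (forall (c1 c2 : J S -> R) (a b : R), consistent c1 -> consistent c2 ->
     forall f, L0 f ->
       Phi (fun j => a * c1 j + b * c2 j) f = a * Phi c1 f + b * Phi c2 f) /\
  (* Psi^* is surjective *)
  (forall l, @linL0 R S l -> exists c, consistent c /\ forall f, L0 f -> Phi c f = l f) /\
  (* ker Psi^* = Lambda *)
  (forall c, consistent c ->
     ((forall f, L0 f -> Phi c f = 0) <-> exists t : R, forall j, c j = t * @lam R S j)).
Proof.
have lamC := lam_consistent HS.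
split=> //; split; first by move=> c cc f g a b [lf _] [lg _]; exact: Phi_lin.
split; first by move=> c1 c2 a b cc1 cc2 f [lf _]; exact: Phi_lin_consistent.
split.
  move=> l ll; have [[j0 _]|noJ] := pselect (exists j : J S, True).
    exists (fun j => l (indic0 j0 j)); split; first exact: consistent_of_linL0.
    by move=> f Lf; exact: Phi_of_linL0.
  (* If [J] is empty, so is [X], as a point would restrict to a place of [Qset]. Every function is
     then the zero function, where [l] vanishes. *)
  have cc : consistent (fun _ : J S => 0 : R) by move=> j; case: noJ; exists j.
  exists (fun=> 0); split=> // f [lf _]; have [K [g ad]] := LCc_adapted HS lf.
  have [s ps] := adapted_seq ad; rewrite (PhiE HS cc ad ps) big1 => [|j _]; last first.
    by rewrite mul0r.
  rewrite -(linL0_zero HS ll); congr l; apply/funext => x.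
  by have [j _ _] := restriction_exists HS x number_field_Q; case: noJ; exists j.
move=> c cc; split=> [ker|[t ct] f [lf i0]].
  have [[j0 _]|noJ] := pselect (exists j : J S, True); last first.
    by exists 0 => j; case: noJ; exists j.
  by exists (c j0 / lam j0) => j; exact: kernel_Phi.
have [K [g ad]] := LCc_adapted HS lf; have [s ps] := adapted_seq ad.
move: i0; rewrite /integral (PhiE HS lamC ad ps) (PhiE HS cc ad ps) => i0.
under eq_bigr => j _ do rewrite ct -mulrA.
by rewrite -mulr_sumr i0 mulr0.
Qed.
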